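(* In the setting of the context, assume that as $p \to +\infty$: $s \to +\infty$, $s = o(p)$, $n_1 = \omega(s)$ and $n_2 = \omega(s)$. Let $n_{\mathrm{ALG}} := 2 s\log(p-s) + s + 1$. (i) If there exists $\varepsilon>0$ such that $n < (1-\varepsilon) n_{\mathrm{ALG}}$, then for any sequence $\lambda_p > 0$ such that $\frac{n_1\sigma_1^2 + n_2\sigma_2^2}{\lambda_p^2 n^2}$ has a limit in $\mathbb{R}_{\ge 0}\cup\{+\infty\}$, we have $\mathbb{P}_{X,Z}(\mathcal{R}(X,\beta^\star,Z,\lambda_p)) \to 0$. (ii) If there exists $\varepsilon > 0$ such that $n > (1+\varepsilon) n_{\mathrm{ALG}}$, and $(\lambda_p)_{p\ge1} \to 0$ is chosen such that $$ \frac{n\lambda_p^2}{\sigma_{\mathrm{avg}}^2 \log(p-s)} \to +\infty \quad\text{and}\quad \frac{1}{\rho}\left[\lambda_p\sqrt{s} + \sqrt{\frac{\sigma_{\mathrm{avg}}^2 \log s}{n}}\right] \to 0, $$ then $\mathbb{P}_{X,Z}(\mathcal{R}(X,\beta^\star,Z,\lambda_p)) \to 1$.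
   Context: All quantities ($s, n_1, n_2, \sigma_1, \sigma_2, \rho, \beta^\star, \lambda_p$) may depend on $p$; limits are as $p\to+\infty$. $n = n_1 + n_2$. The design $X \in \mathbb{R}^{n\times p}$ has i.i.d. $\mathcal{N}(0,1)$ entries; $0<\sigma_1^2<\sigma_2^2$; $\Sigma = \begin{pmatrix} \sigma_1 I_{n_1} & 0 \\ 0 & \sigma_2 I_{n_2}\end{pmatrix}$; $W \sim \mathcal{N}(0,I_n)$ independent of $X$; $Z = \Sigma W$; $Y = X\beta^\star + Z$. The signal $\beta^\star \in \mathbb{R}^p$ is deterministic with exactly $s$ nonzero coordinates, each satisfying $|\beta^\star_i| \ge \rho$ for some $\rho > 0$. $\sigma_{\mathrm{avg}}^2 := (n_1\sigma_1^2 + n_2\sigma_2^2)/n$. The Lasso solution set is $\mathcal{B}_{\mathrm{Lasso}} := \arg\min_{\beta\in\mathbb{R}^p}\{ \frac{1}{2n}\|Y - X\beta\|_2^2 + \lambda_p\|\beta\|_1\}$. With $\operatorname{sign}(0)=0$, $\operatorname{sign}(x)=x/|x|$ for $x\neq 0$ applied coordinatewise, the recovery event is $\mathcal{R}(X,\beta^\star,Z,\lambda_p) := \{\exists\, \hat\beta\in\mathcal{B}_{\mathrm{Lasso}} : \operatorname{sign}(\hat\beta) = \operatorname{sign}(\beta^\star)\}$.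
   Formalization: In part (ii) the sequence λ_p is additionally assumed to be positive for every p; for negative λ_p the Lasso problem has no minimizer when n < p and the claim would fail. *)

(* Defs.v *)
From HB Require Import structures.
From mathcomp Require Import all_boot all_order all_algebra.
From mathcomp Require Import all_classical all_reals all_analysis.
Set Implicit Arguments. Unset Strict Implicit. Unset Printing Implicit Defensive.
Import Order.TTheory GRing.Theory Num.Theory.
Import numFieldNormedType.Exports.
Local Open Scope classical_set_scope.
Local Open Scope ring_scope.

Section Defs.
Context {R : realType}.

Definition lasso_obj (n p : nat) (X : 'M[R]_(n, p)) (Y : 'cV[R]_n) (lam : R)
  (b : 'cV[R]_p) : R :=
  (2 * n%:R)^-1 * (\sum_(i < n) ((Y - X *m b) i 0) ^+ 2)
  + lam * (\sum_(j < p) `|b j 0|).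

Definition lasso_set (n p : nat) (X : 'M[R]_(n, p)) (Y : 'cV[R]_n) (lam : R)
  : set 'cV[R]_p :=
  [set b | forall b' : 'cV[R]_p, lasso_obj X Y lam b <= lasso_obj X Y lam b'].

(* coordinatewise sign, with sign 0 = 0 *)
Definition sign_vec (p : nat) (b : 'cV[R]_p) : 'cV[R]_p := map_mx Num.sg b.

Definition recovery (n p : nat) (X : 'M[R]_(n, p)) (beta : 'cV[R]_p)
  (Z : 'cV[R]_n) (lam : R) : Prop :=
  exists2 b, lasso_set X (X *m beta + Z) lam b & sign_vec b = sign_vec beta.

(* Z = Sigma W with Sigma = diag(sigma1 I_{n1}, sigma2 I_{n2}) *)
Definition hetero_noise (n1 n2 : nat) (sigma1 sigma2 : R)
  (W : 'cV[R]_(n1 + n2)) : 'cV[R]_(n1 + n2) :=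
  col_mx (sigma1 *: usubmx W) (sigma2 *: dsubmx W).

Definition support_size (p : nat) (b : 'cV[R]_p) : nat :=
  #|[set i : 'I_p | b i 0 != 0]|.

End Defs.

Section Prob.
Context {d : measure_display} {T : measurableType d} {R : realType}.

Definition iid_std_gaussian (I : finType) (P : probability T R)
  (G : I -> T -> R) : Prop :=
  [/\ (forall i, measurable_fun [set: T] (G i)),
      (forall i (B : set R), measurable B ->
          P (G i @^-1` B) = normal_prob 0 1 B) &
      (forall B : I -> set R, (forall i, measurable (B i)) ->
          P (\bigcap_(i in [set: I]) (G i @^-1` B i))
          = (\prod_(i : I) P (G i @^-1` B i))%E)].

Definition entries_family (n p : nat) (X : T -> 'M[R]_(n, p))
  (W : T -> 'cV[R]_n) : ('I_n * 'I_p + 'I_n)%type -> T -> R :=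
  fun k w => match k with
             | inl ij => X w ij.1 ij.2
             | inr i => W w i 0
             end.

End Prob.

(* Main.v *)
Require Import Defs.
From HB Require Import structures.
From mathcomp Require Import all_boot all_order all_algebra.
From mathcomp Require Import all_classical all_reals all_analysis.
From mathcomp Require Import measurable_realfun ring lra.
Import Order.TTheory GRing.Theory Num.Theory.
Import numFieldNormedType.Exports.
Local Open Scope classical_set_scope.
Local Open Scope ring_scope.
Set Implicit Arguments.
Unset Strict Implicit.
Unset Printing Implicit Defensive.

(** Let S be the support of beta and eta its sign vector.  By the optimality
    conditions of the Lasso, recovery holds iff some b with the signs of beta has a
    residual r = X beta + Z - X b with X_j . r = n lam eta_j on S and
    |X_j . r| <= n lam off S.  The on-support equations determine r from (X_S, Z),
    and r is independent of the off-support columns, so given r the correlations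
    X_j . r are p - s independent centered Gaussians of variance |r|^2; recovery is
    thus decided by comparing 2 |r|^2 log (p - s) with (n lam)^2.

    Below the threshold, Cauchy-Schwarz applied to
    r . X_S eta = n lam s with |X_S eta|^2 ~ s n gives |r|^2 >= (n lam)^2 s / n
    up to 1 + o(1), so one off-support constraint is violated.

    Above it, the Gram matrices of the two row blocks of X_S are within a factor
    1 +- delta of n_1 I and n_2 I, by a union bound over integer points, of which
    there are only exponentially many in s = o(n_k).  This bounds |r|^2 from above,
    and it bounds the errors of the on-support coefficients: n_1 and n_2 are both
    used there, because the noise covariance is not a multiple of the identity.

    Conditioning is done by replacing a block of coordinates with an independent
    copy, on the product of the probability space with itself; each conditional
    statement then concerns sections of the (measurable) recovery event only, and
    neither r nor an inverse Gram matrix has to be shown measurable. *)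

(** * Gaussian integrals on the line *)

(** The constant in [n_ALG]: on both sides of the threshold the part of |r|^2 forced by the
    on-support equations is (n lam)^2 s / n up to 1 + o(1), so (n lam)^2 / (2 |r|^2) is about n / (2
    s), and this is compared with log (p - s), the logarithm of the number of off-support columns.
    Below the threshold only a lower bound on |r| is needed, so nothing about the noise has to be
    estimated and a single direction X_S eta has to concentrate. Above it, the noise adds its energy
    to |r|^2; the assumption n lam^2 / (sigma_avg^2 log (p - s)) -> +oo leaves room to bound that
    energy by Markov's inequality, with a threshold that is large against its mean and still
    negligible against (n lam)^2 / log (p - s). Because log (p - s) diverges, every bound may lose a
    constant factor or a small multiple of log (p - s) in the exponent, which permits crude Gaussian
    tails. The delicate point is that recovery quantifies over real vectors b, an uncountable union;
    its measurability rests on compactness and rational approximation. *)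

Section gaussian_line.
Context {R : realType}.
Notation mu := (@lebesgue_measure R).
Notation gamma := (normal_prob (0 : R) 1).
Implicit Types (f : R -> \bar R) (a b c m t x y z : R).

(** The Radon-Nikodym derivative of the normal law and [normal_pdf] have the same integral over
    every measurable set, hence agree almost everywhere. *)
Lemma ge0_integral_normal m c f : measurable_fun [set: R] f -> (forall x, 0 <= f x)%E ->
  (\int[normal_prob m c]_x f x = \int[mu]_x (f x * (normal_pdf m c x)%:E))%E.
Proof.
move=> mf f0; have dom := @normal_prob_dominates R m c.
rewrite -(Radon_Nikodym_SigmaFinite.change_of_variables dom)//.
apply: ae_eq_integral => //.
- apply: emeasurable_funM => //; apply: (measurable_int mu).
  exact: Radon_Nikodym_SigmaFinite.f_integrable.
- apply: emeasurable_funM => //; apply/measurable_EFinP.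
  exact: measurable_normal_pdf.
- apply: ae_eqe_mul2l; apply: integral_ae_eq => //.
  + exact: Radon_Nikodym_SigmaFinite.f_integrable.
  + by apply/measurable_EFinP; exact: measurable_normal_pdf.
  + by move=> E _ mE; rewrite -Radon_Nikodym_SigmaFinite.f_integral.
Qed.

Lemma lebesgue_measure_affine c m (A : set (measurableTypeR R)) : 0 < c -> measurable A ->
  pushforward mu ((fun x => c * x + m) : measurableTypeR R -> measurableTypeR R) A
  = (c^-1%:E * mu A)%E.
Proof.
move=> c0 mA.
pose phi : measurableTypeR R -> measurableTypeR R := fun x => c * x + m.
have mphi : measurable_fun setT phi.
  by apply: measurable_funD => //; exact: measurable_funM.
have c0' : 0 <= c by exact: ltW.
(* [nu] is c times the image measure; it gives intervals ]a, b] their length, so it is Lebesgue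
   measure by uniqueness. *)
pose nu : {measure set (measurableTypeR R) -> \bar R} :=
  mscale (NngNum c0') (pushforward mu phi).
have -> : mu A = nu mphi A.
  apply: (@lebesgue_measure_unique R (nu mphi)) => // _ [[a b]] _ <-; rewrite /nu/=.
  rewrite /mscale/= /pushforward.
  have -> : (fun x : R => c * x + m) @^-1` `]a, b]%classic = `](a - m) / c, (b - m) / c]%classic.
    apply/seteqP; split => x /=; rewrite !in_itv/= ltr_pdivrMr// ler_pdivlMr//
      ltrBlDr lerBrDr mulrC//.
  rewrite !lebesgue_measure_itv/= !lte_fin ltr_pM2r ?invr_gt0// ltrD2r.
  case: ifP => _; last by rewrite mule0.
  by rewrite -!EFinB -EFinM; congr EFin; field; rewrite gt_eqF.
by rewrite /mscale/= muleA -EFinM mulVf ?gt_eqF// mul1e.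
Qed.

Lemma measurable_affine c m : measurable_fun [set: R] (fun x => c * x + m).
Proof. by apply: measurable_funD => //; exact: measurable_funM. Qed.

Lemma ge0_integral_affine c m f : 0 < c -> measurable_fun [set: R] f ->
  (forall x, 0 <= f x)%E ->
  (\int[mu]_x f (c * x + m)%R = c^-1%:E * \int[mu]_x f x)%E.
Proof.
move=> c0 mf f0.
pose phi : measurableTypeR R -> measurableTypeR R := fun x => c * x + m.
have mphi : measurable_fun setT phi.
  by apply: measurable_funD => //; exact: measurable_funM.
have c0' : 0 <= c^-1 by rewrite invr_ge0 ltW.
have -> : (c^-1%:E * \int[mu]_x f x = \int[mscale (NngNum c0') mu]_x f x)%E.
  by rewrite ge0_integral_mscale.
transitivity (\int[pushforward mu phi]_x f x)%E.
  by rewrite ge0_integral_pushforward.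
apply: eq_measure_integral => //= A mA _.
by rewrite lebesgue_measure_affine.
Qed.

Lemma ge0_integral_opp f : measurable_fun [set: R] f -> (forall x, 0 <= f x)%E ->
  (\int[mu]_x f (- x)%R = \int[mu]_x f x)%E.
Proof.
move=> mf f0.
pose phi : measurableTypeR R -> measurableTypeR R := fun x => - x.
have mphi : measurable_fun setT phi by exact: oppr_measurable.
transitivity (\int[pushforward mu phi]_x f x)%E.
  by rewrite ge0_integral_pushforward.
apply: eq_measure_integral => //= A mA _.
exact: lebesgue_measureN.
Qed.

Lemma normal_peakE c : 0 < c -> normal_peak c = c^-1 * normal_peak 1.
Proof.
move=> c0; rewrite /normal_peak -mulrnAr sqrtrM ?sqr_ge0// sqrtr_sqr gtr0_norm//.
by rewrite invfM expr1n mul1r.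
Qed.

Lemma ge0_integral_gauss_affine c m f : 0 < c -> measurable_fun [set: R] f ->
  (forall x, 0 <= f x)%E ->
  (\int[gamma]_y f (c * y + m)%R = \int[normal_prob m c]_z f z)%E.
Proof.
move=> c0 mf f0.
have mfa := measurableT_comp mf (measurable_affine c m).
apply: etrans (esym (ge0_integral_normal m c mf f0)).
apply: etrans (ge0_integral_normal 0 1 mfa (fun x => f0 _)) _.
pose g x := (f x * (normal_pdf m c x)%:E)%E.
have mg : measurable_fun [set: R] g.
  apply: emeasurable_funM => //; apply/measurable_EFinP.
  exact: measurable_normal_pdf.
have g0 x : (0 <= g x)%E by rewrite mule_ge0// lee_fin normal_pdf_ge0.
transitivity (\int[mu]_x (c%:E * g (c * x + m)%R))%E.
  apply: eq_integral => x _; rewrite /g muleCA -EFinM; congr (_ * _%:E)%E.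
  rewrite !normal_pdfE ?gt_eqF// (normal_peakE c0) mulrA mulrA divff ?gt_eqF// mul1r.
  congr (_ * _); rewrite /normal_fun; congr expR.
  by field; rewrite gt_eqF.
rewrite ge0_integralZl//; last 2 first.
- exact: (measurableT_comp mg (measurable_affine c m)).
- by rewrite lee_fin ltW.
by rewrite ge0_integral_affine// muleA -EFinM divff ?gt_eqF// mul1e.
Qed.

Lemma ge0_integral_gauss_opp f : measurable_fun [set: R] f ->
  (forall x, 0 <= f x)%E ->
  (\int[gamma]_y f (- y)%R = \int[gamma]_y f y)%E.
Proof.
move=> mf f0.
have mfo : measurable_fun [set: R] (f \o -%R).
  exact: (measurableT_comp mf (@oppr_measurable _ _)).
apply: etrans (esym (ge0_integral_normal 0 1 mf f0)).
apply: etrans (ge0_integral_normal 0 1 mfo (fun x => f0 _)) _.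
pose g x := (f x * (normal_pdf 0 1 x)%:E)%E.
have mg : measurable_fun [set: R] g.
  apply: emeasurable_funM => //; apply/measurable_EFinP.
  exact: measurable_normal_pdf.
have g0 x : (0 <= g x)%E by rewrite mule_ge0// lee_fin normal_pdf_ge0.
apply: etrans (ge0_integral_opp mg g0); apply: eq_integral => x _.
by rewrite /g !normal_pdfE// /normal_fun !subr0 sqrrN.
Qed.

Lemma ge0_integral_gauss_abs a f : measurable_fun [set: R] f ->
  (forall x, 0 <= f x)%E ->
  (\int[gamma]_y f (`|a| * y)%R = \int[gamma]_y f (a * y)%R)%E.
Proof.
move=> mf f0; have [a0|a0] := leP 0 a; first by rewrite ger0_norm.
rewrite ltr0_norm// -(@ge0_integral_gauss_opp (fun y => f (a * y)%R))//.
  by apply: eq_integral => y _; rewrite mulNr mulrN.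
by apply: (measurableT_comp mf); exact: measurable_funM.
Qed.

(** The joint density of (x, z) with z = a x + b y is factored in two ways: law of x times law of z
    given x, and law of z times law of x given z. The second form lets x be integrated out. *)
Lemma normal_pdf_conv a b x z : 0 < b ->
  normal_pdf (a * x) b z * normal_pdf 0 1 x =
  normal_pdf 0 (Num.sqrt (a ^+ 2 + b ^+ 2)) z *
  normal_pdf (a * z / (a ^+ 2 + b ^+ 2)) (b / Num.sqrt (a ^+ 2 + b ^+ 2)) x.
Proof.
move=> b0; have ab0 : 0 < a ^+ 2 + b ^+ 2.
  by rewrite ltr_wpDl ?sqr_ge0// exprn_gt0.
set c := Num.sqrt _; have c0 : 0 < c by rewrite sqrtr_gt0.
have cE : a ^+ 2 + b ^+ 2 = c ^+ 2 by rewrite sqr_sqrtr// ltW.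
have bc0 : 0 < b / c by rewrite divr_gt0.
rewrite !normal_pdfE ?gt_eqF// (normal_peakE b0) (normal_peakE c0) (normal_peakE bc0).
rewrite /normal_fun cE.
have aE : a ^+ 2 = c ^+ 2 - b ^+ 2 by rewrite -cE addrK.
set k := normal_peak 1.
rewrite [LHS]mulrACA -expRD [RHS]mulrACA -expRD.
congr (_ * expR _).
  by field; rewrite !gt_eqF.
apply/eqP; rewrite -subr_eq0; apply/eqP.
(* The difference of the two exponents is a multiple of this quantity, so the relation defining c
   has to be fed in by hand. *)
have h : c ^+ 2 - a ^+ 2 - b ^+ 2 = 0 by rewrite -cE; ring.
transitivity ((c ^+ 2 - a ^+ 2 - b ^+ 2) * (x ^+ 2 / (2 * b ^+ 2)
  - z ^+ 2 / (2 * b ^+ 2 * c ^+ 2))).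
  by field; rewrite !gt_eqF.
by rewrite h mul0r.
Qed.

End gaussian_line.

Section measurable_comparison.
Context {d : measure_display} {T : measurableType d} {R : realType}.
Implicit Types f g : T -> R.

Lemma measurable_set_le f g : measurable_fun setT f -> measurable_fun setT g ->
  measurable [set x | f x <= g x].
Proof.
move=> mf mg; rewrite -[X in measurable X]setTI.
exact: (measurable_fun_le measurableT mf mg).
Qed.

Lemma measurable_set_lt f g : measurable_fun setT f -> measurable_fun setT g ->
  measurable [set x | f x < g x].
Proof.
move=> mf mg; rewrite [X in measurable X](_ : _ = ~` [set x | g x <= f x]).
  by apply: measurableC; exact: measurable_set_le.
by apply/seteqP; split => x /=; rewrite ltNge => /negP.
Qed.

Lemma measurable_fun_norm f : measurable_fun setT f ->
  measurable_fun setT (fun x => `|f x|).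
Proof. exact: measurableT_comp. Qed.

End measurable_comparison.

Section gaussian_line_rotation.
Context {R : realType}.
Notation mu := (@lebesgue_measure R).
Notation gamma := (normal_prob (0 : R) 1).
Implicit Types (f : R -> \bar R) (a b c m t x y z : R).

(** Substitute z = a x + b y in the inner integral, exchange the integrals by Tonelli, then
    integrate out the conditional density of x given z, which has mass 1. *)
Let ge0_integral_gauss_conv a b f : 0 < b -> measurable_fun [set: R] f ->
  (forall x, 0 <= f x)%E ->
  (\int[gamma]_x (\int[gamma]_y f (a * x + b * y)%R) =
   \int[gamma]_z f (Num.sqrt (a ^+ 2 + b ^+ 2) * z)%R)%E.
Proof.
move=> b0 mf f0.
pose k (q : R * R) := (f q.2 * (normal_pdf (a * q.1) b q.2)%:E)%E.
have k0 q : (0 <= k q)%E by rewrite mule_ge0// lee_fin normal_pdf_ge0.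
have mk : measurable_fun [set: R * R] k.
  apply: emeasurable_funM; first exact: (measurableT_comp mf).
  apply/measurable_EFinP; rewrite /normal_pdf gt_eqF//=.
  apply: measurable_funM => //; apply: measurableT_comp => //.
  apply: measurable_funM => //; apply: measurableT_comp => //.
  apply: measurable_funX; apply: measurable_funB => //.
  by apply: measurable_funM.
have mphi := @measurable_normal_pdf R 0 1.
transitivity (\int[gamma]_x \int[mu]_z k (x, z))%E.
  apply: eq_integral => x _.
  apply: etrans (ge0_integral_normal (a * x) b mf f0).
  rewrite -(ge0_integral_gauss_affine (a * x) b0 mf f0).
  by apply: eq_integral => y _; rewrite addrC.
have mF : measurable_fun [set: R] (fun x => \int[mu]_z k (x, z))%E.
  exact: (@measurable_fun_fubini_tonelli_F _ _ _ _ R mu k).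
apply: etrans (ge0_integral_normal 0 1 mF _) _.
  by move=> x; exact: integral_ge0.
pose h (q : R * R) := (k q * (normal_pdf 0 1 q.1)%:E)%E.
have h0 q : (0 <= h q)%E by rewrite mule_ge0// lee_fin normal_pdf_ge0.
have mh : measurable_fun [set: R * R] h.
  apply: emeasurable_funM => //; apply/measurable_EFinP.
  exact: (measurableT_comp mphi).
transitivity (\int[mu]_x \int[mu]_z h (x, z))%E.
  apply: eq_integral => x _; rewrite -ge0_integralZr//.
  - exact: (measurableT_comp mk (measurable_pair1 x)).
  - by rewrite lee_fin normal_pdf_ge0.
rewrite (@fubini_tonelli _ _ _ _ R mu mu h mh h0).
set c := Num.sqrt _.
have c0 : 0 < c by rewrite sqrtr_gt0 ltr_wpDl ?sqr_ge0// exprn_gt0.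
transitivity (\int[mu]_z (f z * (normal_pdf 0 c z)%:E))%E.
  apply: eq_integral => z _.
  transitivity (\int[mu]_x ((f z * (normal_pdf 0 c z)%:E) *
      (normal_pdf (a * z / (a ^+ 2 + b ^+ 2)) (b / c) x)%:E))%E.
    apply: eq_integral => x _.
    by rewrite /h /k /= -muleA -EFinM normal_pdf_conv// EFinM muleA.
  rewrite ge0_integralZl//.
  - by rewrite integral_normal_pdf mule1.
  - by apply/measurable_EFinP; exact: measurable_normal_pdf.
  - by move=> x _; rewrite lee_fin normal_pdf_ge0.
  - by rewrite mule_ge0// lee_fin normal_pdf_ge0.
apply: etrans (esym (ge0_integral_normal 0 c mf f0)) _.
rewrite -(ge0_integral_gauss_affine 0 c0 mf f0).
by apply: eq_integral => y _; rewrite addr0.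
Qed.

Lemma ge0_integral_gauss_rotation a b f : measurable_fun [set: R] f ->
  (forall x, 0 <= f x)%E ->
  (\int[gamma]_x (\int[gamma]_y f (a * x + b * y)%R) =
   \int[gamma]_z f (Num.sqrt (a ^+ 2 + b ^+ 2) * z)%R)%E.
Proof.
move=> mf f0; have [->|b0] := eqVneq b 0.
  rewrite expr0n addr0 sqrtr_sqr (ge0_integral_gauss_abs a mf f0).
  apply: eq_integral => x _; under eq_integral do rewrite mul0r addr0.
  by rewrite integral_cst// [X in (_ * X)%E]probability_setT mule1.
(* The convolution formula needs a positive coefficient; the symmetry of the Gaussian law allows b
   to be replaced by its absolute value. *)
rewrite -(real_normK (num_real b)).
have b0' : 0 < `|b| by rewrite normr_gt0.
apply: etrans (ge0_integral_gauss_conv a b0' mf f0).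
apply: eq_integral => x _.
pose fx y := f (a * x + y).
have mfx : measurable_fun [set: R] fx.
  by apply: (measurableT_comp mf); exact: measurable_funD.
exact/esym/(ge0_integral_gauss_abs b mfx (fun y => f0 _)).
Qed.

(** Exponential tilting: completing the square turns h times the standard density into k times
    another normal density, whose mass is 1. It evaluates the exponential moments of x and of x^2
    alike. *)
Lemma ge0_integral_gauss_tilt (h : R -> R) k m c : 0 <= k ->
  measurable_fun [set: R] h -> (forall x, 0 <= h x) ->
  (forall x, h x * normal_pdf 0 1 x = k * normal_pdf m c x) ->
  (\int[gamma]_x (h x)%:E = k%:E)%E.
Proof.
move=> k0 mh h0 hE.
have mh' : measurable_fun [set: R] (EFin \o h) by exact/measurable_EFinP.
have h0' x : (0 <= (h x)%:E)%E by rewrite lee_fin.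
apply: etrans (ge0_integral_normal 0 1 mh' h0') _.
under eq_integral do rewrite /= -EFinM hE EFinM.
rewrite ge0_integralZl//.
- by rewrite integral_normal_pdf mule1.
- by apply/measurable_EFinP; exact: measurable_normal_pdf.
- by move=> x _; rewrite lee_fin normal_pdf_ge0.
Qed.

Lemma integral_gauss_expR t :
  (\int[gamma]_x (expR (t * x))%:E = (expR (t ^+ 2 / 2))%:E)%E.
Proof.
apply: (@ge0_integral_gauss_tilt _ _ t 1); [exact: expR_ge0| |by move=> x; exact: expR_ge0|].
  by apply: measurableT_comp => //; exact: measurable_funM.
move=> x; rewrite !normal_pdfE// /normal_fun mulrCA [RHS]mulrCA -!expRD.
by congr (_ * expR _); field.
Qed.

Lemma integral_gauss_expR_sqr t : t < 2^-1 ->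
  (\int[gamma]_x (expR (t * x ^+ 2))%:E = ((Num.sqrt (1 - 2 * t))^-1)%:E)%E.
Proof.
move=> t2; have t0 : 0 < 1 - 2 * t by lra.
set c := (Num.sqrt _)^-1; have c0 : 0 < c by rewrite invr_gt0 sqrtr_gt0.
have cE : c ^- 2 = 1 - 2 * t by rewrite -exprVn invrK sqr_sqrtr// ltW.
apply: (@ge0_integral_gauss_tilt _ _ 0 c); [exact: ltW| |by move=> x; exact: expR_ge0|].
  by apply: measurableT_comp => //; apply: measurable_funM => //; exact: measurable_funX.
move=> x; rewrite !normal_pdfE// ?gt_eqF// (normal_peakE c0) !mulrA divff ?gt_eqF// mul1r.
rewrite /normal_fun [_ * normal_peak 1]mulrC -[LHS]mulrA -expRD; congr (_ * expR _).
have -> : (c ^+ 2 *+ 2)^-1 = (1 - 2 * t) / 2 by rewrite -cE; field; rewrite gt_eqF.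
by field.
Qed.

(** Equivalent to 1 <= exp(u) (1 - x) with u = x + x^2. For x <= 0 the bound 1 + u <= exp(u)
    suffices, since (1 + u)(1 - x) = 1 - x^3. For x > 0 it falls short, and its square root version
    (1 + u/2)^2 <= exp(u) is used. *)
Lemma onem_ge_expR x : `|x| <= 4^-1 -> expR (- x - x ^+ 2) <= 1 - x.
Proof.
move=> x2; have /andP[x2l x2r] : - 4^-1 <= x <= 4^-1 by rewrite -ler_norml.
rewrite -opprD expRN -[leRHS]invrK lef_pV2 ?posrE ?invr_gt0 ?expR_gt0//; last by lra.
rewrite -[leLHS]mul1r ler_pdivrMr; last by lra.
have [x0|x0] := leP x 0.
  apply: (@le_trans _ _ ((1 + (x + x ^+ 2)) * (1 - x))); last first.
    by apply: ler_wpM2r; [lra|exact: expR_ge1Dx].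
  rewrite [leRHS](_ : _ = 1 + (- x) * x ^+ 2); last by ring.
  by rewrite lerDl mulr_ge0 ?sqr_ge0// oppr_ge0.
have u0 : 0 <= x + x ^+ 2 by nra.
apply: (@le_trans _ _ ((1 + (x + x ^+ 2) / 2) ^+ 2 * (1 - x))); last first.
  apply: ler_wpM2r; first by lra.
  rewrite [X in expR X](_ : _ = (x + x ^+ 2) / 2 * 2%:R); last by field.
  rewrite expRM_natr; apply: lerXn2r; rewrite ?nnegrE ?expR_ge0 ?expR_ge1Dx//.
  by rewrite addr_ge0// divr_ge0.
rewrite [leRHS](_ : _ = 1 + x ^+ 2 * ((1 + x) ^+ 2 * (1 - x) / 4 - x)); last by field.
rewrite lerDl mulr_ge0 ?sqr_ge0//.
nra.
Qed.

(** The exact value 1 / sqrt(1 - 2 t) is bounded through [onem_ge_expR] at 2 t, which is why |t| <=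
    1/8 is required. *)
Lemma integral_gauss_expR_sqr_le t : `|t| <= 8^-1 ->
  (\int[gamma]_x (expR (t * x ^+ 2))%:E <= (expR (t + 2 * t ^+ 2))%:E)%E.
Proof.
move=> t8; have /andP[tl tr] : - 8^-1 <= t <= 8^-1 by rewrite -ler_norml.
rewrite integral_gauss_expR_sqr; last by lra.
have t0 : 0 < 1 - 2 * t by lra.
have h : expR (- (2 * t) - (2 * t) ^+ 2) <= 1 - 2 * t.
  by apply: onem_ge_expR; rewrite ler_norml; lra.
rewrite lee_fin -[leRHS]invrK lef_pV2 ?posrE ?invr_gt0 ?expR_gt0 ?sqrtr_gt0//.
rewrite -expRN -[leLHS]ger0_norm ?expR_ge0// -sqrtr_sqr ler_sqrt; last exact: ltW.
rewrite -expRM_natr; apply: le_trans h; rewrite ler_expR.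
by rewrite le_eqVlt; apply/orP; left; apply/eqP; ring.
Qed.

Lemma gauss_tail_ub a t v : 0 <= t -> 0 < v -> a ^+ 2 <= v ->
  (\int[gamma]_x (\1_[set y | t <= `|y|] (a * x))%:E <= (2 * expR (- (t ^+ 2 / (2 * v))))%:E)%E.
Proof.
(* [th] minimizes the Chernoff exponent th^2 v / 2 - th t. Working with an upper bound v on a^2
   keeps the degenerate case a = 0. *)
move=> t0 v0 av; pose th := t / v.
have th0 : 0 <= th by rewrite divr_ge0// ltW.
have me (u : R) : measurable_fun [set: R] (fun x => (expR (u * x))%:E).
  by apply/measurable_EFinP; apply: measurableT_comp => //; exact: measurable_funM.
apply: (@le_trans _ _ (\int[gamma]_x ((expR (- (th * t)))%:E *
   ((expR (th * a * x))%:E + (expR (- (th * a) * x))%:E)))%E).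
  apply: ge0_le_integral => //.
  - apply/measurable_EFinP.
    apply: (@measurableT_comp _ _ _ _ _ _ (\1_[set y | t <= `|y|] : R -> R)); last exact: mulrl_measurable.
    by apply: measurable_indic; apply: measurable_set_le => //; exact: measurable_fun_norm.
  - by apply: emeasurable_funM; [exact: measurable_cst|apply: emeasurable_funD; exact: me].
  - move=> x _; rewrite -EFinD -EFinM lee_fin indicE.
    have e0 u : 0 <= expR u :> R by exact: expR_ge0.
    case: (boolP (_ \in _)) => [|_]; last first.
      by rewrite mulr_ge0// addr_ge0.
    rewrite inE/= => tax; rewrite mulrDr -!expRD.
    have [ax0|ax0] := leP 0 (a * x).
      rewrite ger0_norm// in tax.
      apply: (@le_trans _ _ (expR (- (th * t) + th * a * x))); last by rewrite lerDl.
      rewrite -[leLHS]expR0 ler_expR addrC subr_ge0 -[th * a * x]mulrA; exact: ler_wpM2l.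
    rewrite ltr0_norm// in tax.
    apply: (@le_trans _ _ (expR (- (th * t) + - (th * a) * x))); last by rewrite lerDr.
    rewrite -[leLHS]expR0 ler_expR addrC subr_ge0 mulNr -[th * a * x]mulrA -mulrN; exact: ler_wpM2l.
have e0 u x : (0 <= (expR (u * x))%:E :> \bar R)%E by rewrite lee_fin expR_ge0.
rewrite ge0_integralZl//; last 2 first.
- by apply: emeasurable_funD; exact: me.
- by move=> x _; rewrite adde_ge0.
rewrite ge0_integralD//; last 2 first; [exact: me|exact: me|].
rewrite !integral_gauss_expR -EFinD -EFinM lee_fin sqrrN.
set e := expR (- (th * t)); set e' := expR ((th * a) ^+ 2 / 2).
have -> : e * (e' + e') = 2 * (e * e') by ring.
rewrite /e /e' ler_wpM2l// -expRD ler_expR exprMn.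
rewrite [leRHS](_ : _ = - (th * t) + th ^+ 2 * v / 2); last first.
  by rewrite /th; field; rewrite gt_eqF.
by rewrite lerD2l ler_wpM2r ?invr_ge0// ler_wpM2l// sqr_ge0.
Qed.

(** The interval ]t, t + 1] has length 1 and the density there is at least its value at t + 1. The
    loss of t + 1 against t is absorbed in [subcritical_exponent]. *)
Lemma gauss_tail_lb t : 0 <= t ->
  ((normal_peak 1 * expR (- ((t + 1) ^+ 2 / 2)))%:E <= gamma [set x | (t < `|x|)%R])%E.
Proof.
move=> t0.
have mS : measurable [set x : R | t < `|x|].
  by apply: measurable_set_lt => //; exact: measurable_fun_norm.
apply: (@le_trans _ _ (gamma `]t, (t + 1)]%classic)); last first.
  apply: le_measure; rewrite ?inE//= => x /=; rewrite in_itv/= => /andP[tx _].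
  by rewrite gtr0_norm// (le_lt_trans t0).
rewrite [leRHS]/normal_prob.
set k := normal_peak 1 * _.
apply: (@le_trans _ _ (\int[mu]_(x in `]t, (t + 1)%R]) k%:E)%E).
  rewrite integral_cst//= lebesgue_measure_itv/= lte_fin ltrDl ltr01.
  by rewrite -EFinB addrAC subrr add0r mule1.
apply: ge0_le_integral => //.
- by move=> x _; rewrite lee_fin mulr_ge0 ?normal_peak_ge0 ?expR_ge0.
- by apply/measurable_EFinP/measurable_funTS; exact: measurable_normal_pdf.
- move=> x /=; rewrite in_itv/= => /andP[tx xt]; rewrite lee_fin normal_pdfE//.
  rewrite ler_wpM2l ?normal_peak_ge0// ler_expR subr0 expr1n mulNr lerN2.
  rewrite -[1 *+ 2]/2%:R ler_wpM2r ?invr_ge0//.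
  by rewrite lerXn2r ?nnegrE// ?addr_ge0// ltW// (le_lt_trans t0).
Qed.

Lemma gauss_small_ball a t u : 0 < a -> 0 <= t -> u <= t * a ->
  (\int[gamma]_x (\1_[set y | `|y| <= u] (a * x))%:E
   <= (1 - normal_peak 1 * expR (- ((t + 1) ^+ 2 / 2)))%:E)%E.
Proof.
move=> a0 t0 ut.
have mS : measurable [set x : R | t < `|x|].
  by apply: measurable_set_lt => //; exact: measurable_fun_norm.
have mS' : measurable [set y : R | `|y| <= u].
  by apply: measurable_set_le => //; exact: measurable_fun_norm.
apply: (@le_trans _ _ (gamma (~` [set x | t < `|x|]))); last first.
  rewrite probability_setC// EFinB leeB//; exact: gauss_tail_lb.
rewrite -(setIT (~` _)) -integral_indic//; last exact: measurableC.
apply: ge0_le_integral => //.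
- apply/measurable_EFinP.
  apply: (@measurableT_comp _ _ _ _ _ _ (\1_[set y | `|y| <= u] : R -> R)); last exact: mulrl_measurable.
  exact: measurable_indic.
- by apply/measurable_EFinP/measurable_indic; exact: measurableC.
move=> x _; rewrite lee_fin !indicE ler_nat.
case: (boolP (_ \in _)) => //; rewrite inE/= => axu.
rewrite mem_set//=; apply/negP; rewrite -leNgt.
by move: (le_trans axu ut); rewrite normrM (gtr0_norm a0) mulrC ler_pM2r.
Qed.

End gaussian_line_rotation.

(** * Decoupling of independent Gaussian families *)

Section coordinate_space.
Context {R : realType} {I : finType}.

(** Boxes are stable under intersection and are exactly the sets on which the independence
    hypothesis speaks, so two laws on [cspace] are equal as soon as they agree on boxes. *)
Definition boxes : set (set (I -> R)) :=
  [set A | exists2 B : I -> set R, (forall i, measurable (B i)) &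
    A = [set g | forall i, B i (g i)]].

Definition cspace := g_sigma_algebraType boxes.

Lemma measurable_coord i : measurable_fun [set: cspace] (fun g : cspace => g i).
Proof.
move=> _ B mB; rewrite setTI; apply: sub_sigma_algebra.
exists (fun j => if j == i then B else setT); first by move=> j; case: ifP.
apply/seteqP; split => g /=; last by move=> /(_ i); rewrite eqxx.
by move=> Bg j; case: eqP => [->|].
Qed.

Lemma measurable_to_cspace d (T : measurableType d) (F : T -> cspace) :
  (forall i, measurable_fun setT (fun w => F w i)) -> measurable_fun setT F.
Proof.
move=> mF; apply: (@measurability _ _ T cspace setT F boxes) => //.
move=> _ [_ [B mB ->] <-]; rewrite setTI.
have -> : F @^-1` [set g | forall i, B i (g i)] =
    \bigcap_(i in [set: I]) ((fun w => F w i) @^-1` B i).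
  by apply/seteqP; split => w /= h i; [move=> _; exact: h|exact: h].
apply: fin_bigcap_measurable; first exact: finite_finset.
by move=> i _; rewrite -[X in measurable X]setTI; exact: mF.
Qed.

Definition mix (J : pred I) (g g' : I -> R) : I -> R :=
  fun i => if J i then g' i else g i.

Lemma measurable_mix_r J (g : cspace) :
  measurable_fun [set: cspace] (fun g' : cspace => mix J g g' : cspace).
Proof.
apply: measurable_to_cspace => i; rewrite /mix; case: (J i); last exact: measurable_cst.
exact: measurable_coord.
Qed.

End coordinate_space.
Arguments cspace : clear implicits.

Section decoupling.
Context {d : measure_display} {T : measurableType d} {R : realType}.
Variables (P : probability T R) (I : finType) (G : I -> T -> R).
Hypothesis iidG : iid_std_gaussian P G.
Notation gamma := (normal_prob (0 : R) 1).

Definition coords (w : T) : cspace R I := fun i => G i w.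

Lemma measurable_entry i : measurable_fun setT (G i).
Proof. by case: iidG. Qed.

Lemma measurable_coords : measurable_fun setT coords.
Proof. by apply: measurable_to_cspace => i; exact: measurable_entry. Qed.

Let mixw J (q : T * T) : cspace R I := mix J (coords q.1) (coords q.2).

Let measurable_mixw J : measurable_fun setT (mixw J).
Proof.
apply: measurable_to_cspace => i; rewrite /mixw /mix /coords; case: (J i).
  exact: (measurableT_comp (measurable_entry i) measurable_snd).
exact: (measurableT_comp (measurable_entry i) measurable_fst).
Qed.

(** Resampling the coordinates in J from an independent copy does not change the joint law: by
    independence both laws give a box the product of its one-dimensional probabilities. *)
Let law_mixw J (E : set (cspace R I)) : measurable E ->
  pushforward P coords E = pushforward (P \x P)%E (mixw J) E.
Proof.
move=> mE.
pose m1 : {measure set (cspace R I) -> \bar R} := pushforward P coords.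
pose m2 : {measure set (cspace R I) -> \bar R} := pushforward (P \x P)%E (mixw J).
apply: (@measure_unique _ R (cspace R I) boxes (fun _ => setT) _ _ _ _
  (m1 measurable_coords) (m2 (measurable_mixw J))) => //.
- move=> _ _ [B mB ->] [C mC ->]; exists (fun i => B i `&` C i).
    by move=> i; exact: measurableI.
  apply/seteqP; split => g /=; first by move=> [h1 h2] i; split.
  by move=> h; split => i; have [] := h i.
- by move=> _; exists (fun=> setT) => //; apply/seteqP; split.
- exact: bigcup_const.
- move=> _ [B mB ->].
  have [_ _ ind] := iidG.
  (* The box is split into the constraints on the kept coordinates and those on the resampled ones,
     which live on different factors of the product space. *)
  pose B1 i := if J i then setT else B i.
  pose B2 i := if J i then B i else setT.
  have mB1 i : measurable (B1 i) by rewrite /B1; case: (J i).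
  have mB2 i : measurable (B2 i) by rewrite /B2; case: (J i).
  have mcap C : (forall i, measurable (C i)) ->
      measurable (\bigcap_(i in [set: I]) (G i @^-1` C i)).
    move=> mC; apply: fin_bigcap_measurable; first exact: finite_finset.
    by move=> i _; rewrite -[X in measurable X]setTI; exact: measurable_entry.
  transitivity (P (\bigcap_(i in [set: I]) (G i @^-1` B i))).
    congr (P _); apply/seteqP; split => w /= h i; [move=> _; exact: h|exact: h].
  transitivity ((P \x P)%E ((\bigcap_(i in [set: I]) (G i @^-1` B1 i)) `*`
      (\bigcap_(i in [set: I]) (G i @^-1` B2 i)))); last first.
    congr (product_measure1 P P _); apply/seteqP; split => -[w w'] /=.
      move=> [h1 h2] i; have := h1 i Logic.I; have := h2 i Logic.I.
      by rewrite /mixw /mix /B1 /B2 /=; case: (J i).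
    rewrite /mixw /mix /= => h; split => i _ /=; have := h i; rewrite /B1 /B2;
      by case: (J i).
  transitivity (P (\bigcap_(i in [set: I]) (G i @^-1` B1 i)) *
    P (\bigcap_(i in [set: I]) (G i @^-1` B2 i)))%E; last first.
    by apply/esym; apply: product_measure1E; exact: mcap.
  rewrite (ind B mB) (ind B1 mB1) (ind B2 mB2) -big_split/=; apply: eq_bigr => i _.
  rewrite /B1 /B2; case: (J i); rewrite preimage_setT probability_setT.
    by rewrite mul1e.
  by rewrite mule1.
- by move=> _; rewrite /m1 /= /pushforward preimage_setT probability_setT ltry.
Qed.

Lemma ge0_decouple J (f : cspace R I -> \bar R) : measurable_fun setT f ->
  (forall g, 0 <= f g)%E ->
  (\int[P]_w f (coords w) = \int[P]_w \int[P]_w' f (mix J (coords w) (coords w')))%E.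
Proof.
move=> mf f0.
transitivity (\int[pushforward P coords]_g f g)%E.
  by rewrite ge0_integral_pushforward//; exact: measurable_coords.
transitivity (\int[pushforward (P \x P)%E (mixw J)]_g f g)%E.
  pose m1 : {measure set (cspace R I) -> \bar R} := pushforward P coords.
  pose m2 : {measure set (cspace R I) -> \bar R} := pushforward (P \x P)%E (mixw J).
  apply: (@eq_measure_integral _ _ _ _ (m2 (measurable_mixw J)) (m1 measurable_coords)).
  by move=> A mA _; exact: law_mixw.
apply: etrans (@ge0_integral_pushforward _ _ _ _ _ _ (measurable_mixw J) (P \x P)%E
  setT f measurableT mf _) _; first by move=> g _; exact: f0.
rewrite preimage_setT.
apply: (@fubini_tonelli1 _ _ _ _ _ P P (f \o mixw J)).
  exact: (measurableT_comp mf (measurable_mixw J)).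
by move=> q; exact: f0.
Qed.

Lemma prob_decouple J (E : set (cspace R I)) : measurable E ->
  P (coords @^-1` E) =
  (\int[P]_w P [set w' | E (mix J (coords w) (coords w'))])%E.
Proof.
move=> mE.
have -> : P (coords @^-1` E) = pushforward P coords E by [].
rewrite (law_mixw J mE) /pushforward /product_measure1.
apply: eq_integral => w _ /=; congr (P _).
by rewrite xsectionE.
Qed.

(** The form in which conditioning is used: freeze w outside a bad event, bound the probability over
    the coordinates of J alone, and pay the probability of the bad event. *)
Lemma prob_decouple_le J (E : set (cspace R I)) (B : set T) (e : \bar R) :
  measurable E -> measurable B -> (0 <= e)%E ->
  (forall w, ~ B w -> (P [set w' | E (mix J (coords w) (coords w'))] <= e)%E) ->
  (P (coords @^-1` E) <= P B + e)%E.
Proof.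
move=> mE mB e0 he; rewrite (prob_decouple J mE).
have mS w : measurable [set w' | E (mix J (coords w) (coords w'))].
  have := measurableT_comp (measurable_mix_r J (coords w)) measurable_coords.
  by move=> /(_ measurableT _ mE); rewrite setTI.
apply: (@le_trans _ _ (\int[P]_w ((\1_B w)%:E + e))%E).
  apply: ge0_le_integral => //.
  (* Measurability in w of the section probability comes from Tonelli, applied to the indicator of E
     under the mixing map. *)
  - pose h (q : T * T) : \bar R := (\1_E (mixw J q))%:E.
    have mh : measurable_fun setT h.
      apply/measurable_EFinP; apply: (measurableT_comp _ (measurable_mixw J)).
      exact: measurable_indic.
    rewrite [X in measurable_fun _ X](_ : _ = fubini_F P h).
      apply: (@measurable_fun_fubini_tonelli_F _ _ _ _ R P h mh).
      by move=> q; rewrite lee_fin.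
    apply/funext => w; rewrite -(setIT [set w' | _]).
    rewrite -(integral_indic P measurableT (mS w)).
    by apply: eq_integral => w' _; rewrite /h /= !indicE; congr ((_ : bool)%:R%:E); apply/idP/idP; rewrite !inE.
  - by apply: emeasurable_funD => //; apply/measurable_EFinP; exact: measurable_indic.
  move=> w _; rewrite indicE; case: (boolP (w \in B)) => wB.
    by rewrite -[leLHS]adde0 leeD// probability_le1.
  by rewrite add0e; apply: he; move/negP: wB; rewrite inE.
rewrite ge0_integralD//; last by apply/measurable_EFinP; exact: measurable_indic.
rewrite integral_indic// setIT leeD// integral_cst//.
by rewrite [X in (_ * X)%E]probability_setT mule1.
Qed.

Lemma ge0_integral_entry i (f : R -> \bar R) : measurable_fun [set: R] f ->
  (forall x, 0 <= f x)%E -> (\int[P]_w f (G i w) = \int[gamma]_x f x)%E.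
Proof.
move=> mf f0; pose Gi : T -> measurableTypeR R := G i.
have mi : measurable_fun setT Gi := measurable_entry i.
transitivity (\int[pushforward P Gi]_x f x)%E.
  by rewrite ge0_integral_pushforward.
pose m1 : {measure set (measurableTypeR R) -> \bar R} := pushforward P Gi.
apply: (@eq_measure_integral _ _ _ _ gamma (m1 mi)) => A mA _.
by have [_ law _] := iidG; exact: law.
Qed.

(** Induction on the list of indices: decoupling one coordinate makes the inner integral a function
    h of the remaining sum, the induction hypothesis applies to h, and rotation invariance merges
    the two Gaussian variables. The induction must therefore range over all f. *)
Lemma ge0_integral_lincomb (c : I -> R) (f : R -> \bar R) :
  measurable_fun [set: R] f -> (forall x, 0 <= f x)%E ->
  (\int[P]_w f (\sum_i c i * G i w)%R =
   \int[gamma]_x f (Num.sqrt (\sum_i c i ^+ 2) * x)%R)%E.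
Proof.
move=> mf f0; move: (index_enum I) (index_enum_uniq I) => r.
elim: r f mf f0 => [|i r IH] f mf f0.
  move=> _; under eq_integral do rewrite big_nil.
  under [RHS]eq_integral do rewrite big_nil sqrtr0 mul0r.
  rewrite !integral_cst//.
  by rewrite [X in (_ * X)%E = _]probability_setT [X in _ = (_ * X)%E]probability_setT.
move=> /= /andP[ir ur].
pose F (g : cspace R I) := f (\sum_(j <- i :: r) c j * g j).
have mF : measurable_fun setT F.
  apply: (measurableT_comp mf); apply: measurable_sum => j.
  by apply: measurable_funM => //; exact: measurable_coord.
rewrite (@ge0_decouple (pred1 i) F mF); last by move=> g; exact: f0.
pose h y := (\int[gamma]_u f (y + c i * u)%R)%E.
have mh : measurable_fun [set: R] h.
  pose k (q : R * R) := f (q.1 + c i * q.2).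
  have mk : measurable_fun setT k.
    apply: (measurableT_comp mf); apply: measurable_funD => //.
    exact: measurable_funM.
  exact: (@measurable_fun_fubini_tonelli_F _ _ _ _ R gamma k mk (fun q => f0 _)).
have h0 y : (0 <= h y)%E by exact: integral_ge0.
transitivity (\int[P]_w h (\sum_(j <- r) c j * G j w)%R)%E.
  apply: eq_integral => w _; rewrite /h -(@ge0_integral_entry i)//; last first.
    apply: (measurableT_comp mf); apply: measurable_funD; first exact: measurable_cst.
    exact: mulrl_measurable.
  apply: eq_integral => w' _; rewrite /F big_cons /mix/= eqxx addrC; congr (f (_ + _)).
  rewrite big_seq [RHS]big_seq; apply: eq_bigr => j jr.
  by case: eqP => // ji; rewrite -ji jr in ir.
rewrite (IH h)// /h.
apply: etrans (ge0_integral_gauss_rotation _ _ mf f0) _.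
apply: eq_integral => x _; congr (f (Num.sqrt _ * _)).
by rewrite big_cons sqr_sqrtr ?sumr_ge0// 1?addrC// => j _; rewrite sqr_ge0.
Qed.

(** Factors depending on disjoint blocks of coordinates: resampling the block of one factor leaves
    the others unchanged, so its expectation splits off. Upper bounds on the individual expectations
    are all that the applications have. *)
Lemma ge0_integral_prod_le (A : finType) (J : A -> pred I) (F : A -> cspace R I -> R)
    (c : A -> R) :
  (forall a b i, J a i -> J b i -> a = b) ->
  (forall a, measurable_fun setT (F a)) -> (forall a g, 0 <= F a g) ->
  (forall a g g', (forall i, J a i -> g i = g' i) -> F a g = F a g') ->
  (forall a, (\int[P]_w (F a (coords w))%:E <= (c a)%:E)%E) ->
  (\int[P]_w (\prod_a F a (coords w))%:E <= (\prod_a c a)%:E)%E.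
Proof.
move=> dJ mF F0 locF hc; move: (index_enum A) (index_enum_uniq A) => r.
have mF' a : measurable_fun setT (fun w => F a (coords w)).
  exact: (measurableT_comp (mF a) measurable_coords).
have mprod (s : seq A) : measurable_fun setT (fun g : cspace R I => \prod_(a <- s) F a g).
  elim: s => [|a s IHs].
    rewrite [X in measurable_fun _ X](_ : _ = cst 1); first exact: measurable_cst.
    by apply/funext => g; rewrite big_nil.
  rewrite [X in measurable_fun _ X](_ : _ = F a \* fun g => \prod_(a <- s) F a g).
    exact: measurable_funM.
  by apply/funext => g; rewrite big_cons.
have p0 (s : seq A) g : 0 <= \prod_(a <- s) F a g by apply: prodr_ge0 => a _.
have c0 a : 0 <= c a.
  by rewrite -lee_fin (le_trans _ (hc a))// integral_ge0// => w _; rewrite lee_fin.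
elim: r => [_|a r IH /= /andP[ar ur]].
  under eq_integral do rewrite big_nil.
  by rewrite big_nil integral_cst// [X in (_ * X)%E]probability_setT mule1.
rewrite (@ge0_decouple (J a) (fun g => (\prod_(b <- a :: r) F b g)%:E)); last 2 first.
- by apply/measurable_EFinP; exact: mprod.
- by move=> g; rewrite lee_fin.
have E w w' : \prod_(b <- a :: r) F b (mix (J a) (coords w) (coords w')) =
    (\prod_(b <- r) F b (coords w)) * F a (coords w').
  rewrite big_cons mulrC; congr (_ * _); last first.
    by apply: locF => i Ji; rewrite /mix Ji.
  rewrite big_seq [RHS]big_seq; apply: eq_bigr => b br; apply: locF => i Ji.
  rewrite /mix; case: ifP => // Ja.
  by move: ar; rewrite (dJ _ _ _ Ja Ji) br.
under eq_integral => w _.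
  under eq_integral do rewrite E EFinM.
  rewrite ge0_integralZl//; last 3 first.
  - exact/measurable_EFinP.
  - by move=> w' _; rewrite lee_fin.
  - by rewrite lee_fin.
  over.
rewrite ge0_integralZr//; last 3 first.
- by apply/measurable_EFinP; exact: (measurableT_comp (mprod r) measurable_coords).
- by move=> w _; rewrite lee_fin.
- by apply: integral_ge0 => w _; rewrite lee_fin.
rewrite big_cons mulrC EFinM lee_pmul//.
- by apply: integral_ge0 => w _; rewrite lee_fin.
- by apply: integral_ge0 => w _; rewrite lee_fin.
- exact: IH.
Qed.

End decoupling.

Section gaussian_families.
Context {d : measure_display} {T : measurableType d} {R : realType}.
Variables (P : probability T R).
Notation gamma := (normal_prob (0 : R) 1).

Lemma iid_std_gaussian_inj (I I' : finType) (G : I -> T -> R) (h : I' -> I) :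
  injective h -> iid_std_gaussian P G -> iid_std_gaussian P (fun i => G (h i)).
Proof.
move=> injh [mG law ind]; split => [i|i|B mB]; [exact: mG|exact: law|].
(* A box over I' is extended to I by leaving the indices outside the image of h unconstrained; these
   contribute factors 1. *)
pose C i := if [pick k | h k == i] is Some k then B k else setT.
have Ch k : C (h k) = B k.
  rewrite /C; case: pickP => [k' /eqP/injh -> //|/(_ k)]; by rewrite eqxx.
have mC i : measurable (C i) by rewrite /C; case: pickP.
have -> : \bigcap_(k in [set: I']) (G (h k) @^-1` B k) =
    \bigcap_(i in [set: I]) (G i @^-1` C i).
  apply/seteqP; split => w /= H i _ /=; last by rewrite -Ch; exact: H.
  rewrite /C; case: pickP => [k /eqP <-|//]; exact: H.
rewrite (ind C mC) (bigID (mem (h @: predT)))/= big_imset/=; last first.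
  by move=> ? ? _ _; exact: injh.
rewrite [X in (_ * X)%E]big1; last first.
  move=> i ni; rewrite /C; case: pickP => [k /eqP hk|_].
    by case/negP: ni; rewrite -hk imset_f.
  by rewrite preimage_setT probability_setT.
by rewrite mule1; apply: eq_big => [k|k _]; rewrite ?inE// Ch.
Qed.

Section lincomb.
Variables (I : finType) (G : I -> T -> R).
Hypothesis iidG : iid_std_gaussian P G.

Lemma measurable_lincomb (c : I -> R) :
  measurable_fun setT (fun w => \sum_i c i * G i w).
Proof.
apply: measurable_sum => i; apply: measurable_funM => //.
exact: (measurable_entry iidG).
Qed.

Let prob_lincomb (c : I -> R) (S : set R) : measurable S ->
  P [set w | S (\sum_i c i * G i w)] =
  (\int[gamma]_x (\1_S (Num.sqrt (\sum_i c i ^+ 2) * x))%:E)%E.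
Proof.
move=> mS; have mS1 : measurable_fun [set: R] (fun y => (\1_S y)%:E : \bar R).
  by apply/measurable_EFinP; exact: measurable_indic.
rewrite -(ge0_integral_lincomb iidG c mS1); last by move=> x; rewrite lee_fin.
have mL : measurable [set w | S (\sum_i c i * G i w)].
  by have := measurable_lincomb c => /(_ measurableT S mS); rewrite setTI.
rewrite -(setIT [set w | _]) -(integral_indic P measurableT mL).
apply: eq_integral => w _.
by rewrite !indicE; congr ((_ : bool)%:R%:E); apply/idP/idP; rewrite !inE.
Qed.

Lemma lincomb_tail (c : I -> R) (t v : R) : 0 <= t -> 0 < v ->
  \sum_i c i ^+ 2 <= v ->
  (P [set w | (t <= `|\sum_i c i * G i w|)%R] <= (2 * expR (- (t ^+ 2 / (2 * v))))%:E)%E.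
Proof.
move=> t0 v0 cv.
rewrite (@prob_lincomb c [set y | t <= `|y|]).
  apply: gauss_tail_ub => //; rewrite sqr_sqrtr// sumr_ge0// => i _; exact: sqr_ge0.
by apply: measurable_set_le => //; exact: measurable_fun_norm.
Qed.

Lemma lincomb_small_ball (c : I -> R) (t u : R) : 0 <= t ->
  0 < \sum_i c i ^+ 2 -> u <= t * Num.sqrt (\sum_i c i ^+ 2) ->
  (P [set w | (`|\sum_i c i * G i w| <= u)%R]
   <= (1 - normal_peak 1 * expR (- ((t + 1) ^+ 2 / 2)))%:E)%E.
Proof.
move=> t0 c0 ut.
rewrite (@prob_lincomb c [set y | `|y| <= u]).
  by apply: gauss_small_ball => //; rewrite sqrtr_gt0.
by apply: measurable_set_le => //; exact: measurable_fun_norm.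
Qed.

End lincomb.

(** * Concentration of |H z|^2 for a Gaussian matrix H and a fixed vector z *)

Section chi_square.
Variables (A B : finType) (H : A * B -> T -> R).
Hypothesis iidH : iid_std_gaussian P H.
Implicit Types (z : B -> R) (t : R).

Let rowsum (g : A * B -> R) z a : R := \sum_b z b * g (a, b).

Let rowsumE (g : A * B -> R) z a :
  rowsum g z a = \sum_(i : A * B) (if i.1 == a then z i.2 else 0) * g i.
Proof.
rewrite [RHS](eq_bigr (fun i => (if i.1 == a then z i.2 else 0) * g (i.1, i.2))); last by case.
rewrite -(pair_bigA _ (fun a' b => (if a' == a then z b else 0) * g (a', b)))/=.
rewrite (bigD1 a)//= eqxx [X in _ + X]big1 ?addr0// => a' /negbTE ->.
by rewrite big1// => b _; rewrite mul0r.
Qed.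

Let measurable_rowsum z a : measurable_fun setT (fun g : cspace R (A * B)%type => rowsum g z a).
Proof.
apply: measurable_sum => b; apply: measurable_funM => //; exact: measurable_coord.
Qed.

(** The coordinates of H z use disjoint rows and each is centered Gaussian of variance v, so the
    exponential moment is a product of #|A| one-dimensional ones. *)
Lemma chi_square_mgf z t v : \sum_b z b ^+ 2 = v -> 0 < v -> `|t| <= 8^-1 ->
  (\int[P]_w (expR (t / v * (\sum_a (\sum_b z b * H (a, b) w) ^+ 2)))%:E
   <= (expR ((t + 2 * t ^+ 2) * #|A|%:R))%:E)%E.
Proof.
move=> zv v0 t8.
pose F a (g : cspace R (A * B)%type) := expR (t / v * (rowsum g z a) ^+ 2).
have -> : expR ((t + 2 * t ^+ 2) * #|A|%:R) = \prod_(a : A) expR (t + 2 * t ^+ 2).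
  by rewrite prodr_const expRM_natr cardE.
have -> : (\int[P]_w (expR (t / v * (\sum_a (\sum_b z b * H (a, b) w) ^+ 2)))%:E =
    \int[P]_w (\prod_a F a (coords H w))%:E)%E.
  by apply: eq_integral => w _; rewrite mulr_sumr expR_sum.
apply: (ge0_integral_prod_le iidH (J := fun a i => i.1 == a)).
- by move=> a b i /eqP <- /eqP.
- move=> a; apply: measurableT_comp => //; apply: measurable_funM => //.
  by apply: measurable_funX; exact: measurable_rowsum.
- by move=> a g; exact: expR_ge0.
- move=> a g g' gg'; rewrite /F /rowsum; congr (expR (_ * _ ^+ 2)).
  by apply: eq_bigr => b _; rewrite gg'/=.
- move=> a; pose f y : \bar R := (expR (t / v * y ^+ 2))%:E.
  have mf : measurable_fun [set: R] f.
    apply/measurable_EFinP; apply: measurableT_comp => //.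
    by apply: measurable_funM => //; exact: measurable_funX.
  have f0 y : (0 <= f y)%E by rewrite lee_fin expR_ge0.
  pose c (i : A * B) := if i.1 == a then z i.2 else 0.
  have -> : (\int[P]_w (F a (coords H w))%:E = \int[P]_w f (\sum_i c i * H i w)%R)%E.
    by apply: eq_integral => w _; rewrite /F rowsumE.
  rewrite (ge0_integral_lincomb iidH c mf f0).
  have -> : \sum_i c i ^+ 2 = v.
    rewrite -zv -(pair_bigA _ (fun a' b => (if a' == a then z b else 0) ^+ 2))/=.
    rewrite (bigD1 a)//= eqxx [X in _ + X]big1 ?addr0// => a' /negbTE ->.
    by rewrite big1// => b _; rewrite expr0n.
  apply: le_trans (integral_gauss_expR_sqr_le t8).
  rewrite le_eqVlt; apply/orP; left; apply/eqP; apply: eq_integral => x _.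
  rewrite /f exprMn sqr_sqrtr ?ltW// mulrA divfK ?gt_eqF//.
Qed.

Lemma chi_square_concentration z e : 0 < e -> e <= 2^-1 -> 0 < \sum_b z b ^+ 2 ->
  (P [set w | (e * (#|A|%:R * \sum_b z b ^+ 2) <
       `|\sum_a (\sum_b z b * H (a, b) w) ^+ 2 - #|A|%:R * \sum_b z b ^+ 2|)%R]
   <= (2 * expR (- (e ^+ 2 / 8 * #|A|%:R)))%:E)%E.
Proof.
move=> e0 e2; set v := \sum_b _ => v0; set n : R := #|A|%:R.
pose S w := \sum_a (\sum_b z b * H (a, b) w) ^+ 2.
have n0 : 0 <= n by rewrite ler0n.
have mS : measurable_fun setT S.
  apply: measurable_sum => a; apply: measurable_funX; apply: measurable_sum => b.
  by apply: measurable_funM => //; exact: (measurable_entry iidH).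
(* Both Chernoff exponents equal (2 t^2 - t e) times #|A|; t = e / 4 minimizes this and gives - e^2
   / 8. *)
pose t := e / 4.
pose k (u : R) w := expR (u / v * S w).
have mk u : measurable_fun setT (fun w => (k u w)%:E).
  by apply/measurable_EFinP; apply: measurableT_comp => //; exact: measurable_funM.
have mCk (C u : R) : measurable_fun setT (fun w => C%:E * (k u w)%:E)%E.
  by apply: emeasurable_funM; [exact: measurable_cst|exact: mk].
have k0 u w : (0 <= (k u w)%:E)%E by rewrite lee_fin expR_ge0.
pose C1 := expR (- (t * n) - t * e * n); pose C2 := expR (t * n - t * e * n).
have mE : measurable [set w | e * (n * v) < `|S w - n * v|].
  apply: measurable_set_lt => //; apply: measurable_fun_norm.
  exact: measurable_funB.
rewrite -(setIT [set w | _]) -(integral_indic P measurableT mE).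
apply: (@le_trans _ _ (\int[P]_w (C1%:E * (k t w)%:E + C2%:E * (k (- t) w)%:E))%E).
  apply: ge0_le_integral => //.
  - by apply/measurable_EFinP; exact: measurable_indic.
  - by apply: emeasurable_funD; exact: mCk.
  move=> w _; rewrite -!EFinM -EFinD lee_fin indicE.
  have e0' u : 0 <= expR u :> R by exact: expR_ge0.
  case: (boolP (_ \in _)) => [|_]; last by rewrite addr_ge0 ?mulr_ge0 ?expR_ge0.
  rewrite inE/= => Sw; rewrite -!expRD.
  have t0 : 0 <= t / v by rewrite divr_ge0// ?divr_ge0// ltW.
  have [nS|Sn] := leP 0 (S w - n * v).
    apply: (@le_trans _ _ (expR (- (t * n) - t * e * n + t / v * S w))); last by rewrite lerDl.
    rewrite -[leLHS]expR0 ler_expR.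
    rewrite [leRHS](_ : _ = t / v * (S w - n * v - e * (n * v))); last first.
      by field; rewrite gt_eqF.
    by rewrite mulr_ge0// subr_ge0 ltW// (lt_le_trans Sw)// ger0_norm.
  apply: (@le_trans _ _ (expR (t * n - t * e * n + - t / v * S w))); last by rewrite lerDr.
  rewrite -[leLHS]expR0 ler_expR.
  rewrite [leRHS](_ : _ = t / v * (- (S w - n * v) - e * (n * v))); last first.
    by field; rewrite gt_eqF.
  by rewrite mulr_ge0// subr_ge0 ltW// (lt_le_trans Sw)// ltr0_norm.
have C10 : (0 <= C1%:E)%E by rewrite lee_fin expR_ge0.
have C20 : (0 <= C2%:E)%E by rewrite lee_fin expR_ge0.
have Ck0 (C u : R) w : (0 <= C%:E -> 0 <= C%:E * (k u w)%:E)%E by move=> C0; exact: mule_ge0.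
rewrite (ge0_integralD P measurableT (fun w _ => Ck0 C1 t w C10) (mCk C1 t)
  (fun w _ => Ck0 C2 (- t) w C20) (mCk C2 (- t))).
rewrite (ge0_integralZl P measurableT (mk t) (fun w _ => k0 t w) C10).
rewrite (ge0_integralZl P measurableT (mk (- t)) (fun w _ => k0 (- t) w) C20).
have t8 : `|t| <= 8^-1.
  by rewrite ger0_norm /t; lra.
have t8' : `|- t| <= 8^-1 by rewrite normrN.
have h1 := chi_square_mgf erefl v0 t8.
have h2 := chi_square_mgf erefl v0 t8'.
apply: le_trans (leeD (lee_wpmul2l C10 h1) (lee_wpmul2l C20 h2)) _.
rewrite -!EFinM -EFinD lee_fin -!expRD -/n.
have -> : - (t * n) - t * e * n + (t + 2 * t ^+ 2) * n = - (e ^+ 2 / 8 * n).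
  by rewrite /t; field.
have -> : t * n - t * e * n + (- t + 2 * (- t) ^+ 2) * n = - (e ^+ 2 / 8 * n).
  by rewrite /t; field.
by rewrite -mulr2n mulr_natl.
Qed.

End chi_square.
End gaussian_families.

(** * Concentration of Gaussian Gram matrices *)

Section union_bound.
Context {d : measure_display} {T : measurableType d} {R : realType}.
Variable P : probability T R.

Lemma measurable_exists_fin (I : finType) (p : pred I) (E : I -> set T) :
  (forall i, measurable (E i)) -> measurable [set w | exists i, p i /\ E i w].
Proof.
move=> mE.
have -> : [set w | exists i, p i /\ E i w] = \bigcup_(i in [set i | p i]) E i.
  by apply/seteqP; split => w /= [i]; [move=> [pi Ei]|move=> pi Ei]; exists i.
by apply: fin_bigcup_measurable => //; exact: finite_finset.
Qed.

Lemma prob_exists_le (I : finType) (p : pred I) (E : I -> set T) :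
  (forall i, measurable (E i)) ->
  (P [set w | exists i, p i /\ E i w] <= \sum_(i | p i) P (E i))%E.
Proof.
move=> mE.
have -> : [set w | exists i, p i /\ E i w] =
    [set w | exists2 i, i \in index_enum I & p i /\ E i w].
  by apply/seteqP; split => w /= [i]; [move=> h; exists i; rewrite ?mem_index_enum|move=> _ h; exists i].
elim: (index_enum I) => [|i r IH].
  rewrite big_nil [X in P X](_ : _ = set0) ?measure0//.
  by apply/seteqP; split => w // [].
have mr : measurable [set w | exists2 i, i \in r & p i /\ E i w].
  rewrite [X in measurable X](_ : _ = [set w | exists i, ((i \in r) && p i) /\ E i w]).
    exact: measurable_exists_fin.
  apply/seteqP; split => w /= [j]; first by move=> jr [pj Ej]; exists j; rewrite jr.
  by move=> [/andP[jr pj] Ej]; exists j.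
rewrite big_cons; case: ifPn => pi.
  apply: le_trans (leeD (le_refl _) IH).
  rewrite [X in P X](_ : _ = E i `|` [set w | exists2 i, i \in r & p i /\ E i w]).
    exact: measureU2.
  apply/seteqP; split => w /=.
    by move=> [j]; rewrite inE => /orP[/eqP ->|jr] [pj Ej]; [left|right; exists j].
  move=> [Ei|[j jr h]]; first by exists i; rewrite ?inE ?eqxx.
  by exists j => //; rewrite inE jr orbT.
rewrite [X in P X](_ : _ = [set w | exists2 i, i \in r & p i /\ E i w])//.
apply/seteqP; split => w /= [j].
  by rewrite inE => /orP[/eqP ->|jr] [pj Ej]; [rewrite pj in pi|exists j].
by move=> jr h; exists j => //; rewrite inE jr orbT.
Qed.

Lemma prob_exists_le_const (I : finType) (p : pred I) (E : I -> set T) (N e : R) :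
  (forall i, measurable (E i)) -> (forall i, p i -> (P (E i) <= e%:E)%E) -> 0 <= e ->
  (\sum_(i | p i) 1 <= N)%R ->
  (P [set w | exists i, p i /\ E i w] <= (N * e)%:E)%E.
Proof.
move=> mE he e0 hN; apply: le_trans (prob_exists_le p mE) _.
apply: (@le_trans _ _ (\sum_(i | p i) e%:E)%E); first exact: lee_sum.
rewrite sumEFin lee_fin.
rewrite (eq_bigr (fun=> 1 * e)); last by move=> i _; rewrite mul1r.
by rewrite -mulr_suml ler_wpM2r.
Qed.

End union_bound.

(** * Integer points of bounded l1 norm *)

Section integer_grid.
Context {R : realType} {B : finType}.
Implicit Types (v w : B -> R).

(* (magnitude, sign) encoding of the integer points with coordinates of size at most 4 #|B| *)
Definition grid := {ffun B -> 'I_(4 * #|B|).+1 * bool}.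

(** The constraint on the sum of the magnitudes is what keeps the count exponential in #|B|;
    bounding each coordinate by 4 #|B| alone would leave about #|B| ^ #|B| points. *)
Definition grid_small (f : grid) : bool := (\sum_b (f b).1 <= 4 * #|B|)%N.

Definition gridval (f : grid) (b : B) : R := (-1) ^+ (f b).2 * (f b).1%:R.

Let geometric_half (n : nat) : \sum_(i < n) (2^-1 : R) ^+ i <= 2.
Proof.
suff -> : \sum_(i < n) (2^-1 : R) ^+ i = 2 - 2 * 2^-1 ^+ n.
  by rewrite gerBl mulr_ge0// exprn_ge0.
elim: n => [|n IH]; first by rewrite big_ord0 expr0; ring.
by rewrite big_ord_recr/= IH exprS; field.
Qed.

(* Weighting each point by [2 ^ (4 #|B| - sum of magnitudes)] factorizes the count. *)
Lemma card_grid_small : (\sum_(f | grid_small f) 1 <= 64 ^+ #|B| :> R)%R.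
Proof.
pose c (x : 'I_(4 * #|B|).+1 * bool) : R := 2^-1 ^+ x.1.
apply: (@le_trans _ _ (\sum_(f : grid) 2 ^+ (4 * #|B|) * \prod_b c (f b))).
  rewrite [leRHS](bigID grid_small)/= -[leLHS]addr0 lerD//; last first.
    apply: sumr_ge0 => f _; rewrite mulr_ge0 ?exprn_ge0//.
    by apply: prodr_ge0 => b _; rewrite exprn_ge0.
  apply: ler_sum => f; rewrite /grid_small => fs.
  rewrite /c prodrXr exprVn -[leLHS](divff (x := 2 ^+ (\sum_b (f b).1))) ?expf_neq0//.
  by rewrite ler_pM2r ?invr_gt0 ?exprn_gt0// ler_eXn2l// ltr1n.
rewrite -mulr_sumr -(bigA_distr_bigA (fun (_ : B) x => c x))/= prodr_const.
(* Per coordinate, 2^4 comes from the weight, and 4 bounds the geometric series of ratio 1/2 counted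
   for both signs. *)
have -> : (64 : R) ^+ #|B| = 2 ^+ (4 * #|B|) * 4 ^+ #|B|.
  by rewrite exprM -exprMn; congr (_ ^+ _); ring.
rewrite ler_wpM2l ?exprn_ge0// lerXn2r ?nnegrE//.
  by apply: sumr_ge0 => x _; rewrite exprn_ge0.
rewrite -(pair_bigA _ (fun (x : 'I_(4 * #|B|).+1) (y : bool) => 2^-1 ^+ x))/=.
rewrite (eq_bigr (fun x : 'I_(4 * #|B|).+1 => 2 * (2^-1 : R) ^+ x)); last first.
  by move=> x _; rewrite sumr_const card_bool mulr_natl.
by rewrite -mulr_sumr (_ : 4 = 2 * 2 :> R) ?ler_pM2l ?geometric_half//; ring.
Qed.

Lemma norm1_le_norm2 v :
  \sum_b `|v b| <= Num.sqrt #|B|%:R * Num.sqrt (\sum_b v b ^+ 2).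
Proof.
rewrite -sqrtrM ?ler0n// -[leLHS]ger0_norm ?sumr_ge0// -sqrtr_sqr ler_sqrt; last first.
  by rewrite mulr_ge0// sumr_ge0// => b _; rewrite sqr_ge0.
set s := \sum_b `|v b|; set q := \sum_b v b ^+ 2.
have [B0|B0] := eqVneq #|B| 0%N.
  rewrite B0 mul0r /s big1 ?expr0n// => b _; by have := fintype0 b B0.
have n0 : 0 < #|B|%:R :> R by rewrite ltr0n lt0n.
have : 0 <= \sum_b (#|B|%:R * `|v b| - s) ^+ 2 by apply: sumr_ge0 => b _; exact: sqr_ge0.
rewrite (eq_bigr (fun b => #|B|%:R ^+ 2 * v b ^+ 2 - 2 * #|B|%:R * s * `|v b| + s ^+ 2)); last first.
  by move=> b _; rewrite -(real_normK (num_real (v b))); ring.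
rewrite big_split/= sumr_const -[X in _ + X]mulr_natl sumrB -!mulr_sumr -/s -/q.
rewrite [X in 0 <= X](_ : _ = #|B|%:R * (#|B|%:R * q - s ^+ 2)); last by ring.
by rewrite pmulr_rge0// subr_ge0.
Qed.

End integer_grid.
Arguments grid B : clear implicits.

Section grid_control.
Context {R : realType} {A B : finType}.
Variables (M : A -> B -> R) (e : R).
Notation n := (#|A|%:R : R).

(** The quadratic form of M^T M - n I; bounding it by a multiple of |v|^2 controls all eigenvalues
    of the Gram matrix at once. *)
Definition gram_defect (v : B -> R) : R :=
  \sum_a (\sum_b v b * M a b) ^+ 2 - n * \sum_b v b ^+ 2.

Hypothesis grid_defect : forall f : grid B, grid_small f ->
  `|gram_defect (gridval f)| <= e * (n * \sum_b gridval f b ^+ 2).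
Hypothesis e0 : 0 <= e.

Let defectZ k v : gram_defect (fun b => k * v b) = k ^+ 2 * gram_defect v.
Proof.
rewrite /gram_defect mulrBr [X in _ = X - _]mulr_sumr; congr (_ - _).
  apply: eq_bigr => a _; rewrite -exprMn mulr_sumr; congr (_ ^+ 2).
  by apply: eq_bigr => b _; rewrite mulrA.
rewrite [RHS]mulrCA; congr (_ * _); rewrite mulr_sumr.
by apply: eq_bigr => b _; rewrite exprMn.
Qed.

(* polarization of the symmetric bilinear form at [2 (v - w)] and [(v + w) / 2] *)
Let defect_polar v w :
  4 * (gram_defect v - gram_defect w) =
  gram_defect (fun b => 5 / 2 * v b - 3 / 2 * w b) -
  gram_defect (fun b => 3 / 2 * v b - 5 / 2 * w b).
Proof.
have lin (k l : R) a : \sum_b (k * v b - l * w b) * M a b =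
    k * (\sum_b v b * M a b) - l * (\sum_b w b * M a b).
  rewrite !mulr_sumr -sumrB; apply: eq_bigr => b _; ring.
rewrite /gram_defect.
under [X in _ = (X - _) - _]eq_bigr do rewrite lin.
under [X in _ = _ - (X - _)]eq_bigr do rewrite lin.
have E (I : finType) (x y : I -> R) :
    4 * (\sum_i x i ^+ 2 - \sum_i y i ^+ 2) =
    \sum_i (5 / 2 * x i - 3 / 2 * y i) ^+ 2 - \sum_i (3 / 2 * x i - 5 / 2 * y i) ^+ 2.
  by rewrite -!sumrB mulr_sumr; apply: eq_bigr => i _; field.
have h1 := E A (fun a => \sum_b v b * M a b) (fun a => \sum_b w b * M a b).
have h2 := E B v w.
rewrite /= in h1 h2.
set sv := \sum_a (\sum_b v b * M a b) ^+ 2 in h1 *.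
set sw := \sum_a (\sum_b w b * M a b) ^+ 2 in h1 *.
set qv := \sum_b v b ^+ 2 in h2 *; set qw := \sum_b w b ^+ 2 in h2 *.
transitivity (4 * (sv - sw) - n * (4 * (qv - qw))); first by ring.
rewrite h1 h2; ring.
Qed.

(** Rounding toward zero keeps |w| <= |v|. The last sum is the total squared norm of the two vectors
    in [defect_polar]: with |v - w| <= |v| / 4 and |v + w| <= 2 |v| it is at most (1/2 + 2)
    |v|^2. *)
Let grid_approx v : 0 < \sum_b v b ^+ 2 ->
  exists f : grid B, exists k : R, let w b := k * gridval f b in
  [/\ grid_small f, \sum_b w b ^+ 2 <= \sum_b v b ^+ 2 &
     \sum_b (8 * (v b - w b) ^+ 2 + 2^-1 * (v b + w b) ^+ 2) <= 5 / 2 * \sum_b v b ^+ 2].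
Proof.
set q := \sum_b _ => q0.
have [B0|B0] := eqVneq #|B| 0%N.
  by move: q0; rewrite /q big1 ?ltxx// => b _; have := fintype0 b B0.
have s0 : 0 < #|B|%:R :> R by rewrite ltr0n lt0n.
pose r := Num.sqrt #|B|%:R : R; have r0 : 0 < r by rewrite sqrtr_gt0.
pose N := Num.sqrt q; have N0 : 0 < N by rewrite sqrtr_gt0.
have NE : N ^+ 2 = q by rewrite sqr_sqrtr// ltW.
have rE : r ^+ 2 = #|B|%:R by rewrite sqr_sqrtr// ltW.
(* With this mesh the magnitudes sum to at most |v|_1 / k <= r N / k = 4 #|B|, the bound defining
   the grid, and the rounding error has squared norm at most #|B| k^2 = N^2 / 16. *)
pose k := N / (4 * r).
have k0 : 0 < k by rewrite divr_gt0// mulr_gt0.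
pose m b := Num.truncn (`|v b| / k).
have vk0 b : 0 <= `|v b| / k by rewrite divr_ge0// ltW.
have mle b : (m b)%:R <= `|v b| / k by rewrite truncn_le.
have mgt b : `|v b| / k < (m b)%:R + 1 by rewrite natr1; exact: truncnS_gt.
have ms : (\sum_b m b <= 4 * #|B|)%N.
  rewrite -(ler_nat R) natr_sum.
  apply: (@le_trans _ _ (\sum_b `|v b| / k)); first exact: ler_sum.
  rewrite -mulr_suml ler_pdivrMr//; apply: le_trans (norm1_le_norm2 v) _.
  rewrite -/q -/N -/r natrM -rE /k le_eqVlt; apply/orP; left; apply/eqP.
  by field; rewrite gt_eqF.
have mb b : (m b <= 4 * #|B|)%N.
  by apply: leq_trans ms; rewrite (bigD1 b)//= leq_addr.
pose f : grid B := [ffun b => (inord (m b), v b < 0)].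
have fE b : k * gridval f b = (-1) ^+ (v b < 0)%R * (k * (m b)%:R).
  by rewrite /gridval ffunE/= inordK ?ltnS// mulrCA.
exists f, k => w.
have wE b : w b = (-1) ^+ (v b < 0)%R * (k * (m b)%:R) by exact: fE.
have vE b : v b = (-1) ^+ (v b < 0)%R * `|v b| by rewrite -numEsign.
have kml b : k * (m b)%:R <= `|v b| by rewrite mulrC -ler_pdivlMr.
have kmg b : `|v b| < k * (m b)%:R + k.
  by rewrite -[X in _ + X]mulr1 -mulrDr mulrC -ltr_pdivrMr.
have km0 b : 0 <= k * (m b)%:R by rewrite mulr_ge0// ltW.
have sgE (x : bool) (y : R) : ((-1) ^+ x * y) ^+ 2 = y ^+ 2.
  by rewrite exprMn sqrr_sign mul1r.
have v2 b : v b ^+ 2 = `|v b| ^+ 2 by rewrite [in LHS]vE sgE.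
split.
- rewrite /grid_small; under eq_bigr do rewrite ffunE/= inordK ?ltnS//.
  exact: ms.
- apply: ler_sum => b _; rewrite wE sgE v2 lerXn2r ?nnegrE//.
- apply: (@le_trans _ _ (\sum_b (8 * k ^+ 2 + 2 * v b ^+ 2))).
    apply: ler_sum => b _.
    have -> : v b - w b = (-1) ^+ (v b < 0)%R * (`|v b| - k * (m b)%:R).
      by rewrite mulrBr -vE wE.
    have -> : v b + w b = (-1) ^+ (v b < 0)%R * (`|v b| + k * (m b)%:R).
      by rewrite mulrDr -vE wE.
    rewrite !sgE v2; apply: lerD.
      rewrite ler_wpM2l// lerXn2r ?nnegrE ?subr_ge0// ?(ltW k0)//.
      by rewrite lerBlDr addrC ltW.
    rewrite [leRHS](_ : _ = 2^-1 * (`|v b| + `|v b|) ^+ 2); last by field.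
    by rewrite ler_wpM2l// lerXn2r ?nnegrE ?addr_ge0// lerD2l.
  rewrite big_split/= sumr_const -[X in X + _]mulr_natl -mulr_sumr -/q.
  rewrite -rE /k -NE le_eqVlt; apply/orP; left; apply/eqP.
  by field; rewrite gt_eqF.
Qed.

(** Passing through the nearby grid point turns a global bound L into e n + 5/8 L. The unequal
    weights 2 and 1/2 in the polarization exploit that v - w is much shorter than v + w; with equal
    weights the estimate would not be a contraction. *)
Let defect_step (L : R) : 0 <= L ->
  (forall v, `|gram_defect v| <= L * \sum_b v b ^+ 2) ->
  forall v, `|gram_defect v| <= (e * n + 5 / 8 * L) * \sum_b v b ^+ 2.
Proof.
move=> L0 hL v.
have q0 : 0 <= \sum_b v b ^+ 2 by apply: sumr_ge0 => b _; exact: sqr_ge0.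
have [q0'|q0'] := eqVneq (\sum_b v b ^+ 2) 0.
  by apply: le_trans (hL v) _; rewrite q0' !mulr0.
have [|f [k [fs wv hvw]]] := @grid_approx v; first by rewrite lt_def q0'.
set w := fun b => k * gridval f b in wv hvw *.
have hw : `|gram_defect w| <= e * n * \sum_b v b ^+ 2.
  rewrite defectZ normrM ger0_norm ?sqr_ge0//.
  apply: (@le_trans _ _ (k ^+ 2 * (e * (n * \sum_b gridval f b ^+ 2)))).
    by rewrite ler_wpM2l ?sqr_ge0//; exact: grid_defect.
  rewrite [leLHS](_ : _ = e * n * \sum_b w b ^+ 2); last first.
    have -> : \sum_b w b ^+ 2 = k ^+ 2 * \sum_b gridval f b ^+ 2.
      by rewrite mulr_sumr; apply: eq_bigr => b _; rewrite /w exprMn.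
    by ring.
  by rewrite ler_wpM2l// mulr_ge0.
have hd : `|gram_defect v - gram_defect w| <= 5 / 8 * L * \sum_b v b ^+ 2.
  have p4 : 0 < 4 :> R by [].
  rewrite -(ler_pM2l p4) -[X in X * `|_|]ger0_norm// -normrM defect_polar.
  apply: le_trans (ler_normB _ _) _.
  apply: le_trans (lerD (hL _) (hL _)) _.
  rewrite -mulrDr -big_split/=.
  rewrite (eq_bigr (fun b => 8 * (v b - w b) ^+ 2 + 2^-1 * (v b + w b) ^+ 2)); last first.
    by move=> b _; field.
  apply: le_trans (ler_wpM2l L0 hvw) _.
  by rewrite le_eqVlt; apply/orP; left; apply/eqP; field.
rewrite mulrDl -[gram_defect v](subrK (gram_defect w)) addrC.
by apply: le_trans (ler_normD _ _) _; exact: lerD.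
Qed.

Let defect_bound0 : exists2 L : R, 0 <= L &
  forall v, `|gram_defect v| <= L * \sum_b v b ^+ 2.
Proof.
pose K a := \sum_b M a b ^+ 2.
have K0 a : 0 <= K a by apply: sumr_ge0 => b _; exact: sqr_ge0.
exists (\sum_a K a * #|B|%:R + n) => [|v].
  by rewrite addr_ge0// sumr_ge0// => a _; rewrite mulr_ge0.
have q0 : 0 <= \sum_b v b ^+ 2 by apply: sumr_ge0 => b _; exact: sqr_ge0.
apply: le_trans (ler_normB _ _) _; rewrite mulrDl; apply: lerD; last first.
  by rewrite ger0_norm// mulr_ge0.
rewrite ger0_norm; last by apply: sumr_ge0 => a _; exact: sqr_ge0.
rewrite mulr_suml; apply: ler_sum => a _.
have := @norm1_le_norm2 R B (fun b => v b * M a b).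
move=> h; rewrite -(real_normK (num_real (\sum_b _))).
apply: (@le_trans _ _ ((\sum_b `|v b * M a b|) ^+ 2)).
  by rewrite lerXn2r ?nnegrE ?sumr_ge0// ler_norm_sum.
apply: (@le_trans _ _ (#|B|%:R * \sum_b (v b * M a b) ^+ 2)).
  have s0 : 0 <= \sum_b (v b * M a b) ^+ 2 by apply: sumr_ge0 => b _; exact: sqr_ge0.
  apply: (@le_trans _ _ ((Num.sqrt #|B|%:R * Num.sqrt (\sum_b (v b * M a b) ^+ 2)) ^+ 2)).
    by rewrite lerXn2r ?nnegrE ?sumr_ge0// mulr_ge0.
  by rewrite exprMn !sqr_sqrtr.
rewrite -mulrA mulrCA ler_wpM2l//.
rewrite mulr_sumr; apply: ler_sum => b _; rewrite exprMn mulrC ler_wpM2r ?sqr_ge0//.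
by rewrite /K (bigD1 b)//= lerDl sumr_ge0// => b' _; exact: sqr_ge0.
Qed.

(** Iterating [defect_step] from any finite bound contracts toward its fixed point (8/3) e n,
    rounded up here to 3 e n; the remainder (5/8)^k L tends to 0. *)
Lemma gram_defect_bound v : `|gram_defect v| <= 3 * e * n * \sum_b v b ^+ 2.
Proof.
have [L L0 hL] := defect_bound0.
have en0 : 0 <= e * n by rewrite mulr_ge0.
have hk k : forall v, `|gram_defect v| <= (3 * e * n + (5 / 8) ^+ k * L) * \sum_b v b ^+ 2.
  elim: k => [|k IH] u.
    apply: le_trans (hL u) _; rewrite expr0 mul1r ler_wpM2r//.
      by apply: sumr_ge0 => b _; exact: sqr_ge0.
    by rewrite lerDr -mulrA mulr_ge0.
  have c0 : 0 <= 3 * e * n + (5 / 8) ^+ k * L.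
    by rewrite addr_ge0 ?mulr_ge0// -?mulrA ?mulr_ge0// exprn_ge0//.
  apply: le_trans (defect_step c0 IH u) _; rewrite ler_wpM2r//.
    by apply: sumr_ge0 => b _; exact: sqr_ge0.
  rewrite exprS; set z := _ ^+ k; nra.
set q := \sum_b v b ^+ 2.
have cv : (3 * e * n + (5 / 8) ^+ k * L) * q @[k --> \oo] --> (3 * e * n + 0 * L) * q.
  apply: cvgMl; apply: cvgD; first exact: cvg_cst.
  by apply: cvgMl; apply: cvg_expr; rewrite ger0_norm; lra.
have -> : 3 * e * n * q = (3 * e * n + 0 * L) * q by rewrite mul0r addr0.
apply: (cvgr_to_ge cv).
by near=> k; exact: hk.
Unshelve. all: by end_near. Qed.

End grid_control.

Section gram_concentration.
Context {d : measure_display} {T : measurableType d} {R : realType}.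
Variables (P : probability T R) (A B : finType).

(** Stated over the finite grid, so that the event is a finite union: measurable at sight and open
    to a union bound. *)
Definition gram_bad (e : R) (M : A -> B -> R) : Prop :=
  exists f : grid B, grid_small f /\
    e * (#|A|%:R * \sum_b gridval f b ^+ 2) < `|gram_defect M (gridval f)|.

Lemma gram_defect_good e M v : 0 <= e -> ~ gram_bad e M ->
  `|gram_defect M v| <= 3 * e * #|A|%:R * \sum_b v b ^+ 2.
Proof.
move=> e0 good; apply: gram_defect_bound => // f fs.
by rewrite leNgt; apply/negP => bad; apply: good; exists f.
Qed.

Variable H : A * B -> T -> R.
Hypothesis iidH : iid_std_gaussian P H.

Let measurable_gram_bad1 e (f : grid B) :
  measurable [set w | (e * (#|A|%:R * \sum_b gridval f b ^+ 2) <
    `|gram_defect (fun a b => H (a, b) w) (gridval f)|)%R].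
Proof.
apply: measurable_set_lt => //; apply: measurable_fun_norm; apply: measurable_funB => //.
apply: measurable_sum => a; apply: measurable_funX; apply: measurable_sum => b.
by apply: measurable_funM => //; exact: (measurable_entry iidH).
Qed.

Lemma measurable_gram_bad e : measurable [set w | gram_bad e (fun a b => H (a, b) w)].
Proof. exact: (measurable_exists_fin (@grid_small B) (measurable_gram_bad1 e)). Qed.

Lemma prob_gram_bad e : 0 < e -> e <= 2^-1 ->
  (P [set w | gram_bad e (fun a b => H (a, b) w)] <=
   (64 ^+ #|B| * (2 * expR (- (e ^+ 2 / 8 * #|A|%:R))))%:E)%E.
Proof.
move=> e0 e2.
apply: (prob_exists_le_const (measurable_gram_bad1 e)); last 2 first.
- by rewrite mulr_ge0// expR_ge0.
- exact: card_grid_small.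
move=> f _.
have q0 : 0 <= \sum_b gridval f b ^+ 2 :> R by apply: sumr_ge0 => b _; exact: sqr_ge0.
(* The grid contains the zero vector, excluded from the concentration bound; its defect is 0, so its
   bad event is empty. *)
have [q0'|q0'] := eqVneq (\sum_b gridval f b ^+ 2 : R) 0; last first.
  by apply: chi_square_concentration => //; rewrite lt_def q0'.
have z0 b : gridval f b = 0 :> R.
  move/eqP: q0'; rewrite psumr_eq0 => [|b' _]; last exact: sqr_ge0.
  by move=> /allP /(_ b); rewrite mem_index_enum sqrf_eq0 => /(_ isT) /eqP.
rewrite [X in P X](_ : _ = set0); first by rewrite measure0 lee_fin mulr_ge0// expR_ge0.
apply/seteqP; split => w //=; rewrite /gram_defect q0' !mulr0 subr0 big1 ?normr0 ?ltxx//.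
by move=> a _; rewrite big1 ?expr0n// => b _; rewrite z0 mul0r.
Qed.

End gram_concentration.

(** * Optimality conditions and the recovery event *)

Section kkt.
Context {R : realType}.

(** First-order condition without derivatives: a negative slope k would beat the quadratic term at a
    small enough t. *)
Let small_step (a k r : R) : 0 <= a -> 0 < r ->
  (forall t, 0 < t -> t <= r -> 0 <= a * t ^+ 2 + k * t) -> 0 <= k.
Proof.
move=> a0 r0 h; rewrite leNgt; apply/negP => k0.
(* The summand - k / r ensures t <= r, and D > a ensures a t + k < 0. *)
pose D := a + 1 + (- k) / r.
have kr : 0 < - k / r by rewrite divr_gt0// oppr_gt0.
have D0 : 0 < D by rewrite /D; lra.
pose t := - k / D.
have t0 : 0 < t by rewrite divr_gt0// oppr_gt0.
have tr : t <= r.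
  rewrite ler_pdivrMr// /D mulrDr [X in _ + X]mulrC divfK ?gt_eqF//.
  by rewrite lerDr mulr_ge0// ?ltW// ltr_wpDl.
have := h t t0 tr; apply/negP; rewrite -ltNge.
rewrite [ltLHS](_ : _ = t * (a * t + k)); last by ring.
rewrite pmulr_rlt0// -ltrBrDr sub0r mulrC /t mulrAC ltr_pdivrMr// ltr_pM2l ?oppr_gt0//.
rewrite /D; lra.
Qed.

Let norm_shift (x t : R) : `|t| <= `|x| -> `|x + t| - `|x| = Num.sg x * t.
Proof.
move=> tx; have [x0|x0|x0] := ltgtP 0 x.
- rewrite gtr0_sg// mul1r (gtr0_norm x0) ger0_norm; first by ring.
  by move: tx; rewrite (gtr0_norm x0) ler_norml => /andP[]; lra.
- rewrite ltr0_sg// (ltr0_norm x0) ler0_norm; first by ring.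
  by move: tx; rewrite (ltr0_norm x0) ler_norml => /andP[]; lra.
- have : t = 0 by move: tx; rewrite -x0 normr0 normr_le0 => /eqP.
  by move=> ->; rewrite addr0 subrr mulr0.
Qed.

Lemma coord_stationary (a c l x : R) : 0 <= a ->
  (forall t, 0 <= a * t ^+ 2 - c * t + l * (`|x + t| - `|x|)) ->
  (x != 0 -> c = l * Num.sg x) /\ (x = 0 -> `|c| <= l).
Proof.
move=> a0 h; split => [x0|x0].
  have r0 : 0 < `|x| by rewrite normr_gt0.
  apply/eqP; rewrite eq_le -subr_ge0 -[X in _ && X]subr_ge0; apply/andP; split.
    apply: (small_step a0 r0) => t t0 tr.
    have := h t; rewrite norm_shift; last by rewrite gtr0_norm.
    by congr (0 <= _); ring.
  apply: (small_step a0 r0) => t t0 tr.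
  have := h (- t); rewrite norm_shift; last by rewrite normrN gtr0_norm.
  by congr (0 <= _); ring.
rewrite x0 in h; have r0 : 0 < 1 :> R by [].
rewrite ler_norml -subr_ge0 -[X in _ && X]subr_ge0; apply/andP; split.
  apply: (small_step a0 r0) => t t0 tr.
  have := h (- t); rewrite add0r normr0 subr0 normrN gtr0_norm//.
  by congr (0 <= _); ring.
apply: (small_step a0 r0) => t t0 tr.
have := h t; rewrite add0r normr0 subr0 gtr0_norm//.
by congr (0 <= _); ring.
Qed.

Variables (n p : nat).
Implicit Types (X : 'M[R]_(n, p)) (Y : 'cV[R]_n) (b : 'cV[R]_p).

Definition lasso_kkt X Y (lam : R) b : Prop := forall j,
  let c := \sum_i X i j * (Y - X *m b) i 0 in
  (b j 0 != 0 -> c = n%:R * lam * Num.sg (b j 0)) /\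
  (b j 0 = 0 -> `|c| <= n%:R * lam).

Lemma lasso_setP X Y lam b : (0 < n)%N -> 0 < lam ->
  lasso_set X Y lam b <-> lasso_kkt X Y lam b.
Proof.
move=> n0 lam0; have n0' : 0 < n%:R :> R by rewrite ltr0n.
set r := Y - X *m b; split => [opt j|kkt b'].
  (* Moving coordinate j by t changes the objective by exactly a t^2 - c t + lam (|b_j + t| -
     |b_j|), which reduces optimality to [coord_stationary]. *)
  pose a := (2 * n%:R)^-1 * \sum_i X i j ^+ 2.
  pose c := n%:R^-1 * \sum_i X i j * r i 0.
  have a0 : 0 <= a.
    by rewrite mulr_ge0 ?invr_ge0 ?mulr_ge0 ?sumr_ge0// => i _; exact: sqr_ge0.
  have [|h1 h2] := @coord_stationary a c lam (b j 0) a0.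
    move=> t; have := opt (b + t *: delta_mx j 0); rewrite -subr_ge0.
    congr (0 <= _); rewrite /lasso_obj.
    have rE i : (Y - X *m (b + t *: delta_mx j 0)) i 0 = r i 0 - t * X i j.
      rewrite mulmxDr -scalemxAr -colE opprD addrA -/r.
      by rewrite [LHS]mxE; congr (_ + _); rewrite !mxE.
    under eq_bigr do rewrite rE.
    rewrite (eq_bigr (fun i => r i 0 ^+ 2 + (t ^+ 2 * X i j ^+ 2 - 2 * t * (X i j * r i 0)))); last first.
      by move=> i _; ring.
    rewrite big_split/= sumrB -!mulr_sumr.
    rewrite [\sum_(k < p) `|(b + _) k 0|](bigD1 j)//= [\sum_(k < p) `|b k 0|](bigD1 j)//=.
    rewrite (eq_bigr (fun k => `|b k 0|)); last first.
      by move=> k kj; rewrite !mxE (negbTE kj) mulr0 addr0.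
    rewrite !mxE eqxx mulr1 /a /c -/r.
    by field; rewrite gt_eqF.
  have cE : \sum_i X i j * r i 0 = n%:R * c by rewrite /c mulrA divff ?gt_eqF// mul1r.
  split => [bj|bj]; rewrite -/r cE; first by rewrite h1// mulrA.
  by rewrite normrM gtr0_norm// ler_pM2l// h2.
rewrite -subr_ge0.
pose u := b' - b.
have rE i : (Y - X *m b') i 0 = r i 0 - (X *m u) i 0.
  have -> : Y - X *m b' = r - X *m u by rewrite /r /u mulmxBr opprB addrA subrK.
  by rewrite [LHS]mxE; congr (_ + _); rewrite !mxE.
have crossE : \sum_i r i 0 * (X *m u) i 0 = \sum_j (\sum_i X i j * r i 0) * u j 0.
  rewrite (eq_bigr (fun i => \sum_j X i j * r i 0 * u j 0)).
    by rewrite exchange_big/=; apply: eq_bigr => j _; rewrite mulr_suml.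
  by move=> i _; rewrite [(X *m u) i 0]mxE mulr_sumr; apply: eq_bigr => j _; ring.
rewrite /lasso_obj; under eq_bigr do rewrite rE.
rewrite (eq_bigr (fun i => r i 0 ^+ 2 + ((X *m u) i 0 ^+ 2 - 2 * (r i 0 * (X *m u) i 0)))); last first.
  by move=> i _; ring.
rewrite big_split/= sumrB -mulr_sumr crossE -/r.
set S := \sum_i r i 0 ^+ 2; set Q := \sum_i (X *m u) i 0 ^+ 2.
have Q0 : 0 <= Q by apply: sumr_ge0 => i _; exact: sqr_ge0.
set C := \sum_j _ * u j 0.
(* Sufficiency is convexity: the objective gap is a nonnegative quadratic term plus the gap in this
   inequality, which says that the correlations divided by n lam form a subgradient of the l1 norm
   at b. *)
suff hC : C <= n%:R * lam * (\sum_j `|b' j 0| - \sum_j `|b j 0|).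
  set L' := \sum_j `|b' j 0| in hC *; set L := \sum_j `|b j 0| in hC *.
  rewrite [leRHS](_ : _ = (2 * n%:R)^-1 * Q + n%:R^-1 * (n%:R * lam * (L' - L) - C)); last first.
    by field; rewrite gt_eqF.
  rewrite addr_ge0 ?mulr_ge0 ?invr_ge0 ?mulr_ge0// ?subr_ge0//.
rewrite -sumrB mulr_sumr; apply: ler_sum => j _.
have [h1 h2] := kkt j; have -> : u j 0 = b' j 0 - b j 0 by rewrite !mxE.
have nl0 : 0 <= n%:R * lam by rewrite mulr_ge0// ltW.
have [bj|bj] := eqVneq (b j 0) 0.
  rewrite bj normr0 !subr0; apply: le_trans (ler_norm _) _.
  by rewrite normrM ler_wpM2r// h2.
rewrite h1// -mulrA ler_wpM2l// mulrBr; apply: lerB.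
  apply: le_trans (ler_norm _) _; rewrite normrM normr_sg bj mul1r//.
by rewrite -normrEsg.
Qed.

End kkt.

(** * Measurability of the recovery event *)

Section recovery_event.
Context {R : realType}.
Variables (n p : nat) (sd : 'I_n -> R) (beta : 'I_p -> R) (lam : R).
Notation I := ('I_n * 'I_p + 'I_n)%type.
Implicit Types (g : I -> R) (b : 'I_p -> R).

(** The residual Y - X b, written as Z - X (b - beta) in the raw Gaussian coordinates so that the
    event lives on [cspace]. *)
Definition resid g b i : R :=
  sd i * g (inr i) - \sum_j g (inl (i, j)) * (b j - beta j).

Definition corr g b j : R := \sum_i g (inl (i, j)) * resid g b i.

Definition recov g : Prop := exists b, forall j,
  [/\ Num.sg (b j) = Num.sg (beta j),
      beta j != 0 -> corr g b j = n%:R * lam * Num.sg (beta j) &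
      beta j = 0 -> `|corr g b j| <= n%:R * lam].

(** A nonnegative defect of the optimality condition at j, continuous in b and measurable in g; |y|
    + y is twice the positive part of y and encodes the inequality off the support. *)
Let violation g b j : R :=
  if beta j == 0 then `| `|corr g b j| - n%:R * lam| + (`|corr g b j| - n%:R * lam)
  else `|corr g b j - n%:R * lam * Num.sg (beta j)|.

Let violation_ge0 g b j : 0 <= violation g b j.
Proof.
have h (y : R) : 0 <= `|y| + y by rewrite -lerBlDr sub0r -normrN ler_norm.
by rewrite /violation; case: ifP.
Qed.

Let violation_eq0 g b j : violation g b j = 0 <->
  (beta j != 0 -> corr g b j = n%:R * lam * Num.sg (beta j)) /\
  (beta j = 0 -> `|corr g b j| <= n%:R * lam).
Proof.
rewrite /violation; case: eqVneq => bj; split => [h|[h1 h2]].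
- split => // _; move/eqP: h; rewrite addr_eq0 => /eqP h.
  by rewrite -subr_le0 -oppr_ge0 -h.
- by rewrite ler0_norm ?subr_le0 ?h2// opprB -opprB addNr.
- split; last by move=> bj0; rewrite bj0 eqxx in bj.
  by move=> _; move/eqP: h; rewrite normr_eq0 subr_eq0 => /eqP.
- by rewrite h1// subrr normr0.
Qed.

Let penalty g b := \sum_j violation g b j.

Let penalty_le0 g b : penalty g b <= 0 -> forall j, violation g b j = 0.
Proof.
move=> h j; apply/eqP; rewrite eq_le violation_ge0 andbT; apply: le_trans h.
rewrite /penalty (bigD1 j)//= lerDl; exact: sumr_ge0.
Qed.

(* compact subsets exhausting the orthant with the sign pattern of beta *)
Let slab (m : nat) j : set R :=
  if beta j == 0 then [set 0]
  else if 0 < beta j then `[m.+1%:R^-1, m.+1%:R]%classic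
  else `[- m.+1%:R, - m.+1%:R^-1]%classic.

Let slab_sg m j x : slab m j x -> Num.sg x = Num.sg (beta j).
Proof.
have m0 : 0 < m.+1%:R^-1 :> R by rewrite invr_gt0.
rewrite /slab; have [b0|b0|b0] := ltgtP 0 (beta j).
- by rewrite /= in_itv/= => /andP[h _]; rewrite !gtr0_sg// (lt_le_trans m0).
- rewrite /= in_itv/= => /andP[_ h]; rewrite !ltr0_sg//.
  by apply: le_lt_trans h _; rewrite oppr_lt0.
- by rewrite /= -b0 => ->.
Qed.

Let orthant (m : nat) : set 'rV[R]_p := [set v | forall j, slab m j (v ord0 j)].

Let orthant_compact m : compact (orthant m).
Proof.
apply: rV_compact => j; rewrite /slab; case: ifP => _; first exact: compact_set1.
by case: ifP => _; exact: segment_compact.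
Qed.

Let continuous_sum_fun (V : topologicalType) (K : finType) (f : K -> V -> R) :
  (forall k, continuous (f k)) -> continuous (fun v => \sum_k f k v).
Proof.
move=> cf v; elim: (index_enum K) => [|k r IH].
  rewrite (_ : (fun v => _) = cst 0); first exact: cvg_cst.
  by apply/funext => u; rewrite big_nil.
rewrite (_ : (fun v => _) = (fun u => f k u + \sum_(k <- r) f k u)); last first.
  by apply/funext => u; rewrite big_cons.
by apply: cvgD => //; exact: cf.
Qed.

Let continuous_cstM (V : topologicalType) (c : R) (f : V -> R) :
  continuous f -> continuous (fun v => c * f v).
Proof. by move=> cf v; apply: (@cvgM _ _ _ _ (cst c) f c); [exact: cvg_cst|exact: cf]. Qed.

Let continuous_subr (V : topologicalType) (f h : V -> R) :
  continuous f -> continuous h -> continuous (fun v => f v - h v).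
Proof. by move=> cf ch v; apply: (@cvgB _ _ _ _ _ f h); [exact: cf|exact: ch]. Qed.

Let continuous_addr (V : topologicalType) (f h : V -> R) :
  continuous f -> continuous h -> continuous (fun v => f v + h v).
Proof. by move=> cf ch v; apply: (@cvgD _ _ _ _ _ f h); [exact: cf|exact: ch]. Qed.

Let continuous_normr (V : topologicalType) (f : V -> R) :
  continuous f -> continuous (fun v => `|f v|).
Proof. by move=> cf v; apply: (@cvg_norm _ _ _ _ _ f); exact: cf. Qed.

Let continuous_cstr (V : topologicalType) (c : R) : continuous (fun _ : V => c).
Proof. by move=> v; exact: cvg_cst. Qed.

Let continuous_penalty g : continuous (fun v : 'rV[R]_p => penalty g (v ord0)).
Proof.
have ccorr j : continuous (fun v : 'rV[R]_p => corr g (v ord0) j).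
  apply: continuous_sum_fun => i; apply: continuous_cstM.
  apply: continuous_subr; first exact: continuous_cstr.
  apply: continuous_sum_fun => k; apply: continuous_cstM.
  apply: continuous_subr; [exact: coord_continuous|exact: continuous_cstr].
apply: continuous_sum_fun => j; rewrite /violation; case: (beta j == 0); last first.
  by apply: continuous_normr; apply: continuous_subr => //; exact: continuous_cstr.
have c1 : continuous (fun v : 'rV[R]_p => `|corr g (v ord0) j| - n%:R * lam).
  by apply: continuous_subr; [exact: continuous_normr|exact: continuous_cstr].
by apply: continuous_addr => //; exact: continuous_normr.
Qed.

Let qvec (q : {ffun 'I_p -> rat}) : 'I_p -> R := fun j => ratr (q j).

Let approx_set m k (q : {ffun 'I_p -> rat}) : set (cspace R I) :=
  [set g | (forall j, slab m j (qvec q j)) /\ penalty g (qvec q) < k.+1%:R^-1].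

Let measurable_approx m k q : measurable (approx_set m k q).
Proof.
have [h|h] := pselect (forall j, slab m j (qvec q j)); last first.
  rewrite (_ : approx_set _ _ _ = set0)//; apply/seteqP; split => g // [].
  by move=> /h.
rewrite (_ : approx_set _ _ _ = [set g : cspace R I | penalty g (qvec q) < k.+1%:R^-1]).
  apply: measurable_set_lt => //; apply: measurable_sum => j.
  have mcorr : measurable_fun setT (fun g : cspace R I => corr g (qvec q) j).
    apply: measurable_sum => i; apply: measurable_funM; first exact: measurable_coord.
    apply: measurable_funB.
      by apply: measurable_funM => //; exact: measurable_coord.
    apply: measurable_sum => k'; apply: measurable_funM => //; exact: measurable_coord.
  rewrite /violation; case: (beta j == 0).
    apply: measurable_funD; first apply: measurable_fun_norm;
      by apply: measurable_funB => //; exact: measurable_fun_norm.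
  by apply: measurable_fun_norm; exact: measurable_funB.
by apply/seteqP; split => g; [case|split].
Qed.

(** From left to right, a solution lies inside some slab and is approximated there by rational
    points of small penalty. From right to left, the continuous penalty attains its minimum on the
    compact [orthant m]; rational points force that minimum to be 0. This needs m fixed before k
    varies, hence the order of the union and the intersection. *)
Let recov_approx (g : I -> R) : recov g <->
  (\bigcup_m \bigcap_k \bigcup_(q in [set: {ffun 'I_p -> rat}]) approx_set m k q) g.
Proof.
split=> [[b hb]|[m _ h]]; last first.
  have {}h k : (\bigcup_(q in [set: {ffun 'I_p -> rat}]) approx_set m k q) g by exact: h.
  have [q0 _ [sq0 _]] := h 0%N.
  have O0 : orthant m !=set0 by exists (\row_j qvec q0 j) => j; rewrite mxE.
  have [|c cO cmin] := @compact_EVT_min _ R (fun v : 'rV[R]_p => penalty g (v ord0)) _ O0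
    (@orthant_compact m).
    by apply: continuous_subspaceT; exact: continuous_penalty.
  have c0 : penalty g (c ord0) <= 0.
    apply/ler_addgt0Pr => e e0; rewrite add0r.
    have [k ke] : exists k : nat, k.+1%:R^-1 < e.
      have := near_infty_natSinv_lt (PosNum e0) => -[k _ /(_ k (leqnn k))] /= hk.
      by exists k.
    have [q _ [sq pq]] := h k.
    apply: le_trans (ltW (lt_trans pq ke)).
    have -> : penalty g (qvec q) = penalty g ((\row_j qvec q j) ord0).
      by congr (penalty g _); apply/funext => j; rewrite mxE.
    by apply: cmin; rewrite inE => j; rewrite mxE.
  exists (c ord0) => j; have /violation_eq0[h1 h2] := penalty_le0 c0 j.
  by split => //; apply: (@slab_sg m); move: cO; rewrite inE; exact.
have pen0 : penalty g b = 0.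
  by apply: big1 => j _; apply/violation_eq0; have [] := hb j.
(* Strict inequalities leave room around each nonzero b j for a rational in the same slab. *)
have [m hm] : exists m : nat, forall j, beta j != 0 -> m.+1%:R^-1 < `|b j| < m.+1%:R.
  pose m := (\sum_j (Num.truncn `|b j| + Num.truncn `|b j|^-1))%N.
  exists m.+1 => j bj0; have bj : 0 < `|b j|.
    by rewrite normr_gt0 -sgr_eq0; have [-> _ _] := hb j; rewrite sgr_eq0.
  have mj : (Num.truncn `|b j| + Num.truncn `|b j|^-1 <= m)%N.
    by rewrite /m (bigD1 j)//= leq_addr.
  apply/andP; split.
    rewrite invf_plt ?posrE//; apply: lt_le_trans (truncnS_gt _) _.
    by rewrite ler_nat ltnS (leq_trans _ (leqW mj))// leq_addl.
  apply: lt_le_trans (truncnS_gt _) _.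
  by rewrite ler_nat ltnS (leq_trans _ (leqW mj))// leq_addr.
exists m => // k _.
have k0 : 0 < k.+1%:R^-1 :> R by rewrite invr_gt0.
have : penalty g (v ord0) @[v --> (\row_j b j : 'rV[R]_p)] --> (0 : R).
  rewrite [X in _ --> X](_ : _ = (fun v : 'rV[R]_p => penalty g (v ord0)) (\row_j b j)).
    exact: continuous_penalty.
  by rewrite -pen0; congr (penalty g _); apply/funext => j; rewrite mxE.
move=> /cvgr_lt /(_ _ k0) /nbhs_ballP[e /= e0 he].
have hq j : exists q : rat, slab m j (ratr q) /\ `|b j - ratr q| < e.
  rewrite /slab; have [bj|bj|bj] := ltgtP 0 (beta j).
  - have bj' : 0 < b j by rewrite -sgr_gt0; have [-> _ _] := hb j; rewrite sgr_gt0.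
    have := hm j; rewrite gt_eqF// gtr0_norm// => /(_ isT) /andP[h1 h2].
    have /rat_in_itvoo[q] : Num.max m.+1%:R^-1 (b j - e) < b j.
      by rewrite gt_max h1 gtrBl.
    rewrite in_itv/= gt_max => /andP[/andP[q1 q2] q3]; exists q; split.
      by rewrite /= in_itv/= (ltW q1)// ltW// (lt_trans q3).
    by rewrite gtr0_norm ?subr_gt0// ltrBlDr -ltrBlDl.
  - have bj' : b j < 0 by rewrite -sgr_lt0; have [-> _ _] := hb j; rewrite sgr_lt0.
    have := hm j; rewrite lt_eqF// ltr0_norm// => /(_ isT) /andP[h1 h2].
    have /rat_in_itvoo[q] : b j < Num.min (- m.+1%:R^-1) (b j + e).
      by rewrite lt_min ltrNr h1 ltrDl.
    rewrite in_itv/= lt_min => /andP[q3 /andP[q1 q2]]; exists q; split.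
      by rewrite /= in_itv/= (ltW q1) andbT ltW// (lt_trans _ q3)// ltrNl.
    by rewrite ltr0_norm ?subr_lt0// opprB ltrBlDl.
  (* Off the support the slab is the single point 0, which is rational, so zero coordinates are kept
     exactly. *)
  - exists 0; rewrite /= rmorph0; split => //.
    have bj' : b j = 0 by apply/eqP; rewrite -sgr_eq0; have [-> _ _] := hb j; rewrite -bj sgr0.
    by rewrite bj' subr0 normr0.
pose q : {ffun 'I_p -> rat} := [ffun j => sval (cid (hq j))].
exists q => //.
have qE j : slab m j (qvec q j) /\ `|b j - qvec q j| < e.
  by rewrite /qvec ffunE; exact: svalP (cid (hq j)).
split; first by move=> j; case: (qE j).
have -> : penalty g (qvec q) = penalty g ((\row_j qvec q j) ord0).
  by congr (penalty g _); apply/funext => j; rewrite mxE.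
apply: he; split => // i j; rewrite !mxE /ball/=; by case: (qE j).
Qed.

Lemma measurable_recov : measurable (recov : set (cspace R I)).
Proof.
rewrite (_ : recov = \bigcup_m \bigcap_k
  \bigcup_(q in [set: {ffun 'I_p -> rat}]) approx_set m k q).
  apply: bigcupT_measurable => m; apply: bigcapT_measurable => k.
  apply: countable_bigcupT_measurable; first exact: countableP.
  by move=> q; exact: measurable_approx.
by apply/seteqP; split => g /recov_approx.
Qed.

End recovery_event.

Section recovery_recov.
Context {R : realType}.

Definition noise_sd (n1 n2 : nat) (s1 s2 : R) (i : 'I_(n1 + n2)) : R :=
  match fintype.split i with inl _ => s1 | inr _ => s2 end.

Lemma recoveryE (n1 n2 p : nat) (s1 s2 lam : R) (X : 'M[R]_(n1 + n2, p))
    (beta : 'cV[R]_p) (W : 'cV[R]_(n1 + n2)) (g : 'I_(n1 + n2) * 'I_p + 'I_(n1 + n2) -> R) :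
  (0 < n1 + n2)%N -> 0 < lam ->
  (forall i j, g (inl (i, j)) = X i j) -> (forall i, g (inr i) = W i 0) ->
  recovery X beta (hetero_noise s1 s2 W) lam <->
  recov (noise_sd s1 s2) (fun j => beta j 0) lam g.
Proof.
move=> n0 lam0 gX gW; set Z := hetero_noise _ _ _.
have rE b i : (X *m beta + Z - X *m b) i 0 =
    resid (noise_sd s1 s2) (fun j => beta j 0) g (fun j => b j 0) i.
  have -> : X *m beta + Z - X *m b = Z - X *m (b - beta).
    by rewrite mulmxBr opprB addrCA addrA.
  rewrite [LHS]mxE; congr (_ + _).
    rewrite /Z /hetero_noise !mxE /noise_sd gW; case: splitP => k ik; rewrite !mxE;
      congr (_ * W _ _); exact: val_inj.
  rewrite mxE [in LHS]mxE; congr (- _); apply: eq_bigr => j _.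
  by rewrite gX !mxE.
have cE b j : \sum_i X i j * (X *m beta + Z - X *m b) i 0 =
    corr (noise_sd s1 s2) (fun j => beta j 0) g (fun j => b j 0) j.
  by apply: eq_bigr => i _; rewrite gX rE.
have sgz (x y : R) : Num.sg x = Num.sg y -> (x == 0) = (y == 0).
  by move=> xy; rewrite -(sgr_eq0 x) xy sgr_eq0.
split=> [[b /(lasso_setP _ _ _ n0 lam0) kkt sgb]|[b hb]].
  exists (fun j => b j 0) => j; have := kkt j; rewrite /= cE => -[h1 h2].
  have sgj : Num.sg (b j 0) = Num.sg (beta j 0).
    by move/matrixP: sgb => /(_ j 0); rewrite !mxE.
  split => // bj; first by rewrite h1 ?sgj// (sgz _ _ sgj).
  by apply: h2; apply/eqP; rewrite (sgz _ _ sgj) bj.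
exists (\col_j b j); last first.
  by apply/matrixP => j k; rewrite !mxE (ord1 k); have [] := hb j.
apply/(lasso_setP _ _ _ n0 lam0) => j /=; rewrite cE.
have -> : (fun j => (\col_j b j) j 0) = b by apply/funext => k; rewrite mxE.
have [sgj h1 h2] := hb j; rewrite mxE sgj; split => bj.
  by apply: h1; rewrite -(sgz _ _ sgj).
by apply: h2; apply/eqP; rewrite -(sgz _ _ sgj) bj.
Qed.

End recovery_recov.

(** * Recovery probability in fixed dimension *)

Lemma sum_cauchy_schwarz (R : realType) (K : finType) (a b : K -> R) :
  (\sum_k a k * b k) ^+ 2 <= (\sum_k a k ^+ 2) * (\sum_k b k ^+ 2).
Proof.
set C := \sum_k a k * b k; set A := \sum_k a k ^+ 2; set B := \sum_k b k ^+ 2.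
have B0 : 0 <= B by apply: sumr_ge0 => k _; exact: sqr_ge0.
have [B0'|B0'] := eqVneq B 0.
  have b0 k : b k = 0.
    move/eqP: B0'; rewrite psumr_eq0 => [|k' _]; last exact: sqr_ge0.
    by move=> /allP /(_ k); rewrite mem_index_enum sqrf_eq0 => /(_ isT) /eqP.
  rewrite B0' mulr0 /C big1 ?expr0n// => k _; by rewrite b0 mulr0.
have Bp : 0 < B by rewrite lt_def B0'.
have : 0 <= \sum_k (B * a k - C * b k) ^+ 2 by apply: sumr_ge0 => k _; exact: sqr_ge0.
rewrite (eq_bigr (fun k => B ^+ 2 * a k ^+ 2 + (C ^+ 2 * b k ^+ 2 - 2 * B * C * (a k * b k)))); last first.
  by move=> k _; ring.
rewrite big_split/= sumrB -!mulr_sumr -/A -/B -/C.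
rewrite [X in 0 <= X](_ : _ = B * (A * B - C ^+ 2)); last by ring.
by rewrite pmulr_rge0// subr_ge0.
Qed.

Section coefficients.
Context {R : realType} {n p : nat}.
Notation I := ('I_n * 'I_p + 'I_n)%type.
Implicit Types (r : 'I_n -> R) (g : I -> R).

(** Coefficients, over all Gaussian coordinates, of the linear form r . X_j, so that the results on
    linear combinations apply verbatim. *)
Definition col_coef r (j : 'I_p) (k : I) : R :=
  if k is inl ij then (if ij.2 == j then r ij.1 else 0) else 0.

Definition noise_coef r (k : I) : R := if k is inr i then r i else 0.

Lemma sum_col_coef g r j : \sum_k col_coef r j k * g k = \sum_i r i * g (inl (i, j)).
Proof.
rewrite big_sumType/= [X in _ + X]big1 ?addr0; last by move=> i _; rewrite mul0r.
rewrite (eq_bigr (fun k => (fun i j' => (if j' == j then r i else 0) * g (inl (i, j'))) k.1 k.2)); last by case.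
rewrite -(pair_bigA _ (fun i j' => (if j' == j then r i else 0) * g (inl (i, j'))))/=.
apply: eq_bigr => i _; rewrite (bigD1 j)//= eqxx big1 ?addr0// => j' /negbTE ->.
by rewrite mul0r.
Qed.

Lemma col_coef_sqr r j : \sum_k col_coef r j k ^+ 2 = \sum_i r i ^+ 2.
Proof.
rewrite big_sumType/= [X in _ + X]big1 ?addr0; last by move=> i _; rewrite expr0n.
rewrite -(pair_bigA _ (fun i j' => (if j' == j then r i else 0) ^+ 2))/=.
apply: eq_bigr => i _; rewrite (bigD1 j)//= eqxx big1 ?addr0// => j' /negbTE ->.
by rewrite expr0n.
Qed.

Lemma sum_noise_coef g r : \sum_k noise_coef r k * g k = \sum_i r i * g (inr i).
Proof.
by rewrite big_sumType/= [X in X + _]big1 ?add0r// => k _; rewrite mul0r.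
Qed.

Lemma noise_coef_sqr r : \sum_k noise_coef r k ^+ 2 = \sum_i r i ^+ 2.
Proof.
by rewrite big_sumType/= [X in X + _]big1 ?add0r// => k _; rewrite expr0n.
Qed.

End coefficients.

Section recovery_probability.
Context {d : measure_display} {T : measurableType d} {R : realType}.
Variables (P : probability T R) (n p : nat) (sd : 'I_n -> R) (beta : 'I_p -> R) (lam : R).
Notation I := ('I_n * 'I_p + 'I_n)%type.
Variable G : I -> T -> R.
Hypothesis iidG : iid_std_gaussian P G.
Notation s := #|[pred j | beta j != 0]|.
Notation m := #|[pred j | beta j == 0]|.
Notation eta j := (Num.sg (beta j)).
Hypotheses (lam0 : 0 < lam) (n0 : (0 < n)%N).

Lemma sum_sg_sqr : \sum_j eta j ^+ 2 = s%:R.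
Proof.
rewrite (bigID (fun j => beta j != 0))/= [X in _ + X]big1 ?addr0; last first.
  by move=> j; rewrite negbK => /eqP ->; rewrite sgr0 expr0n.
rewrite (eq_bigr (fun=> 1)) ?sumr_const//.
by move=> j bj; rewrite sqr_sg bj.
Qed.

Definition offsupp (k : I) : bool := if k is inl ij then beta ij.2 == 0 else false.

(* Two coefficient vectors giving the same on-support correlations have the same
   residual, so the residual is a function of the on-support data alone. *)
Let resid_unique (g g' : I -> R) b b' :
  (forall i j, beta j != 0 -> g (inl (i, j)) = g' (inl (i, j))) ->
  (forall i, g (inr i) = g' (inr i)) ->
  (forall j, beta j = 0 -> b j = 0) -> (forall j, beta j = 0 -> b' j = 0) ->
  (forall j, beta j != 0 -> corr sd beta g b j = corr sd beta g' b' j) ->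
  forall i, resid sd beta g b i = resid sd beta g' b' i.
Proof.
move=> gX gW b0 b0' hc.
pose dr i := resid sd beta g b i - resid sd beta g' b' i.
have drE i : dr i = \sum_j g (inl (i, j)) * (b' j - b j).
  transitivity (\sum_j g' (inl (i, j)) * (b' j - beta j) -
      \sum_j g (inl (i, j)) * (b j - beta j)); first by rewrite /dr /resid gW; ring.
  rewrite -sumrB; apply: eq_bigr => j _.
  have [bj|bj] := eqVneq (beta j) 0; last by rewrite -gX//; ring.
  by rewrite bj b0// b0'// !subrr !mulr0 subrr.
(* The difference of residuals lies in the span of the on-support columns and is orthogonal to each
   of them. *)
have : \sum_i dr i ^+ 2 = 0.
  rewrite (eq_bigr (fun i => \sum_j (b' j - b j) * (g (inl (i, j)) * dr i))); last first.
    move=> i _; rewrite expr2 {1}drE mulr_suml; apply: eq_bigr => j _; ring.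
  rewrite exchange_big/= big1// => j _; rewrite -mulr_sumr.
  have [bj|bj] := eqVneq (beta j) 0; first by rewrite b0// b0'// subrr mul0r.
  rewrite (_ : \sum_i _ = 0) ?mulr0//.
  rewrite /dr (eq_bigr (fun i => g (inl (i, j)) * resid sd beta g b i -
     g' (inl (i, j)) * resid sd beta g' b' i)); last by move=> i _; rewrite gX//; ring.
  by rewrite sumrB; apply/eqP; rewrite subr_eq0; apply/eqP; exact: hc.
move=> /eqP; rewrite psumr_eq0 => [/allP h i|i _]; last exact: sqr_ge0.
have := h i; rewrite mem_index_enum sqrf_eq0 subr_eq0 => /(_ isT) /eqP; exact.
Qed.

(** For a fixed r the m correlations use disjoint columns, and each stays below n lam with
    probability at most 1 - q; then (1 - q)^m <= exp(- m q). On-support columns enter the product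
    with the factor 1. *)
Let offsupp_columns_small (r : 'I_n -> R) (t : R) : 0 <= t ->
  0 < \sum_i r i ^+ 2 -> n%:R * lam <= t * Num.sqrt (\sum_i r i ^+ 2) ->
  (P [set w | (forall j, beta j = 0 -> `|\sum_i r i * G (inl (i, j)) w| <= n%:R * lam)%R]
   <= (expR (- (m%:R * (normal_peak 1 * expR (- ((t + 1) ^+ 2 / 2))))))%:E)%E.
Proof.
move=> t0 r0 hr; set q := normal_peak 1 * _.
pose E j : set (cspace R I) := [set g | `|\sum_i r i * g (inl (i, j))| <= n%:R * lam].
have mE j : measurable (E j).
  apply: measurable_set_le => //; apply: measurable_fun_norm; apply: measurable_sum => i.
  by apply: measurable_funM => //; exact: measurable_coord.
pose F j (g : cspace R I) : R := if beta j == 0 then \1_(E j) g else 1.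
have mF j : measurable_fun setT (F j).
  by rewrite /F; case: (beta j == 0); [exact: measurable_indic|exact: measurable_cst].
have F0 j g : 0 <= F j g by rewrite /F; case: ifP.
have [q0 q1] : 0 <= q /\ q <= 1.
  split; first by rewrite mulr_ge0 ?normal_peak_ge0 ?expR_ge0.
  rewrite -lee_fin; apply: le_trans (gauss_tail_lb t0) _.
  apply: probability_le1; apply: measurable_set_lt => //; exact: measurable_fun_norm.
have mS : measurable [set w | forall j, beta j = 0 -> (`|\sum_i r i * G (inl (i, j)) w| <= n%:R * lam)%R].
  rewrite (_ : [set w | _] = \bigcap_(j in [set j | beta j = 0]) (coords G @^-1` E j)).
    apply: fin_bigcap_measurable; first exact: finite_finset.
    move=> j _; rewrite -[X in measurable X]setTI; exact: (measurable_coords iidG measurableT (mE j)).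
  by apply/seteqP; split.
rewrite -(setIT [set w | _]) -(integral_indic P measurableT mS).
apply: (@le_trans _ _ (\int[P]_w (\prod_j F j (coords G w))%:E)%E).
  apply: ge0_le_integral => //.
  - by apply/measurable_EFinP; exact: measurable_indic.
  - apply/measurable_EFinP; apply: measurable_prod => j _.
    exact: (measurableT_comp (mF j) (measurable_coords iidG)).
  move=> w _; rewrite lee_fin indicE; case: (boolP (_ \in _)) => [|_]; last exact: prodr_ge0.
  rewrite inE/= => h; rewrite big1// => j _; rewrite /F; case: eqP => // bj.
  by rewrite indicE mem_set// /E/=; exact: h.
have : (\int[P]_w (\prod_j F j (coords G w))%:E <= (\prod_j (if beta j == 0 then 1 - q else 1))%R%:E)%E.
  apply: (ge0_integral_prod_le iidG (J := fun j k => if k is inl ij then ij.2 == j else false)) => //.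
  - by move=> j j' [[i j'']|i]//= /eqP -> /eqP.
  - move=> j g g' gg'; rewrite /F; case: (beta j == 0) => //.
    have gE : \sum_i r i * g (inl (i, j)) = \sum_i r i * g' (inl (i, j)).
      by apply: eq_bigr => i _; rewrite gg'/=.
    by rewrite !indicE; congr ((_ : bool)%:R); apply/idP/idP; rewrite !inE /E/= gE.
  - move=> j; rewrite /F; case: (beta j == 0); last first.
      by rewrite integral_cst// [X in (_ * X)%E]probability_setT mule1.
    have mcE : measurable (coords G @^-1` E j).
      rewrite -[X in measurable X]setTI; exact: (measurable_coords iidG measurableT (mE j)).
    have -> : (\int[P]_w (\1_(E j) (coords G w))%:E = P (coords G @^-1` E j))%E.
      rewrite -(setIT (coords G @^-1` E j)) -(integral_indic P measurableT mcE).
      by apply: eq_integral => w _; rewrite !indicE; congr ((_ : bool)%:R%:E);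
        apply/idP/idP; rewrite !inE.
    rewrite (_ : _ @^-1` _ = [set w | `|\sum_k col_coef r j k * G k w| <= n%:R * lam]); last first.
      by apply/seteqP; split => w /=; rewrite /E/= -(sum_col_coef (coords G w)).
    by apply: (lincomb_small_ball iidG t0); rewrite col_coef_sqr.
move=> h; apply: le_trans h _; rewrite lee_fin.
rewrite (bigID (fun j => beta j == 0))/= [X in _ * X]big1 ?mulr1; last by move=> j /negbTE ->.
rewrite (eq_bigr (fun=> 1 - q)); last by move=> j ->.
have -> : expR (- (m%:R * q)) = expR (- q) ^+ m.
  by rewrite -expRM_natr; congr expR; ring.
rewrite prodr_const lerXn2r ?nnegrE ?expR_ge0 ?subr_ge0//.
by apply: le_trans (expR_ge1Dx _); rewrite addrC.
Qed.

Lemma recov_prob_small (e t : R) : 0 < e -> e <= 2^-1 -> (0 < s)%N ->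
  t = Num.sqrt ((1 + e) * n%:R / s%:R) ->
  (P [set w | recov sd beta lam (coords G w)] <=
   (2 * expR (- (e ^+ 2 / 8 * n%:R)) +
    expR (- (m%:R * (normal_peak 1 * expR (- ((t + 1) ^+ 2 / 2))))))%:E)%E.
Proof.
move=> e0 e2 s0 tE.
have s0' : 0 < s%:R :> R by rewrite ltr0n.
have n0' : 0 < n%:R :> R by rewrite ltr0n.
pose H (k : 'I_n * 'I_p) := G (inl k).
have iidH : iid_std_gaussian P H.
  by apply: (iid_std_gaussian_inj (h := inl)) iidG => x y [].
pose B := [set w | (e * (#|'I_n|%:R * \sum_j eta j ^+ 2) <
  `|\sum_i (\sum_j eta j * H (i, j) w) ^+ 2 - #|'I_n|%:R * \sum_j eta j ^+ 2|)%R].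
have mB : measurable B.
  apply: measurable_set_lt => //; apply: measurable_fun_norm; apply: measurable_funB => //.
  apply: measurable_sum => i; apply: measurable_funX; apply: measurable_sum => j.
  by apply: measurable_funM => //; exact: (measurable_entry iidH).
have PB : (P B <= (2 * expR (- (e ^+ 2 / 8 * n%:R)))%:E)%E.
  have := @chi_square_concentration _ _ _ P _ _ H iidH (fun j => eta j) e e0 e2.
  by rewrite /B sum_sg_sqr card_ord => /(_ s0').
rewrite EFinD; set q := normal_peak 1 * _.
have q0 : (0 <= (expR (- (m%:R * q)))%:E)%E by rewrite lee_fin expR_ge0.
apply: le_trans (leeD PB (le_refl _)).
have := prob_decouple_le iidG (J := offsupp) (measurable_recov sd beta lam) mB q0.
apply=> w wB.
set S := [set w' | _].
(* If the section is nonempty, the residual of one arbitrary success serves as r; by [resid_unique]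
   every other success in the section has the same residual, so r needs no formula. *)
have [[w0 Sw0]|nS] := pselect (S !=set0); last first.
  rewrite (_ : S = set0) ?measure0//; apply/seteqP; split => w' // Sw'.
  by case: nS; exists w'.
have sgb (b : 'I_p -> R) : (forall j, Num.sg (b j) = eta j) -> forall j, beta j = 0 -> b j = 0.
  by move=> hb j bj; apply/eqP; rewrite -sgr_eq0 hb bj sgr0.
case: Sw0; set g0 := mix _ _ _ => b0 hb0.
have b00 := sgb _ (fun j => let: And3 h _ _ := hb0 j in h).
pose r := resid sd beta g0 b0.
have x0 i j : beta j != 0 -> g0 (inl (i, j)) = G (inl (i, j)) w.
  by move=> bj; rewrite /g0 /mix /offsupp/= (negbTE bj).
have corr0 j : beta j != 0 -> \sum_i G (inl (i, j)) w * r i = n%:R * lam * eta j.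
  move=> bj; have [_ h _] := hb0 j; rewrite -h// /corr; apply: eq_bigr => i _.
  by rewrite x0.
have dot : \sum_i r i * (\sum_j eta j * H (i, j) w) = n%:R * lam * s%:R.
  rewrite (eq_bigr (fun i => \sum_j eta j * (G (inl (i, j)) w * r i))); last first.
    by move=> i _; rewrite mulr_sumr; apply: eq_bigr => j _; rewrite /H; ring.
  rewrite exchange_big/= -sum_sg_sqr mulr_sumr; apply: eq_bigr => j _.
  rewrite -mulr_sumr; have [bj|bj] := eqVneq (beta j) 0.
    by rewrite bj sgr0 mul0r expr0n mulr0.
  by rewrite corr0//; ring.
have Xeta : \sum_i (\sum_j eta j * H (i, j) w) ^+ 2 <= (1 + e) * (n%:R * s%:R).
  have : ~ B w by []. 
  rewrite /B/= card_ord sum_sg_sqr => /negP; rewrite -leNgt ler_norml => /andP[_].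
  by rewrite lerBlDr mulrDl mul1r addrC.
have nls : 0 < n%:R * lam * s%:R by rewrite !mulr_gt0.
have cs : (n%:R * lam * s%:R) ^+ 2 <= (\sum_i r i ^+ 2) * ((1 + e) * (n%:R * s%:R)).
  rewrite -dot; apply: le_trans (sum_cauchy_schwarz _ _) _.
  by rewrite ler_wpM2l// sumr_ge0// => i _; exact: sqr_ge0.
have r20 : 0 <= \sum_i r i ^+ 2 by apply: sumr_ge0 => i _; exact: sqr_ge0.
have r2 : 0 < \sum_i r i ^+ 2.
  rewrite lt_def r20 andbT; apply/eqP => r2; move: cs; rewrite r2 mul0r.
  by apply/negP; rewrite -ltNge exprn_gt0.
have tn0 : 0 <= (1 + e) * n%:R / s%:R.
  by rewrite divr_ge0 ?mulr_ge0// addr_ge0// ltW.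
(* The value of t is chosen for this: Cauchy-Schwarz and |X eta|^2 <= (1 + e) n s give (n lam)^2 <=
   |r|^2 (1 + e) n / s. *)
have ht : n%:R * lam <= t * Num.sqrt (\sum_i r i ^+ 2).
  rewrite tE -sqrtrM// -[leLHS]ger0_norm; last by rewrite mulr_ge0// ltW.
  rewrite -sqrtr_sqr ler_sqrt; last by rewrite mulr_ge0.
  rewrite -(ler_pM2r (_ : 0 < s%:R ^+ 2)) ?exprn_gt0// -exprMn.
  apply: le_trans cs _; rewrite le_eqVlt; apply/orP; left; apply/eqP.
  by field; rewrite gt_eqF.
have t0 : 0 <= t by rewrite tE sqrtr_ge0.
apply: le_trans (offsupp_columns_small t0 r2 ht).
have mS : measurable S.
  have := measurableT_comp (measurable_mix_r offsupp (coords G w)) (measurable_coords iidG).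
  by move=> /(_ measurableT _ (measurable_recov sd beta lam)); rewrite setTI.
apply: le_measure; rewrite ?inE//.
  rewrite (_ : [set w | _] = \bigcap_(j in [set j | beta j = 0])
      [set w | `|\sum_i r i * G (inl (i, j)) w| <= n%:R * lam]).
    apply: fin_bigcap_measurable; first exact: finite_finset.
    move=> j _; apply: measurable_set_le => //; apply: measurable_fun_norm.
    by apply: measurable_sum => i; apply: measurable_funM => //; exact: (measurable_entry iidG).
  by apply/seteqP; split.
move=> w' [b hb] j bj; have b0' := sgb _ (fun j => let: And3 h _ _ := hb j in h).
have rE i : resid sd beta (mix offsupp (coords G w) (coords G w')) b i = r i.
  apply: resid_unique => //.
  - by move=> i' j' bj'; rewrite x0// /mix /offsupp/= (negbTE bj').
  - move=> j' bj'; have [_ -> // _] := hb j'; by have [_ -> //] := hb0 j'.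
have [_ _ h] := hb j; have := h bj; rewrite /corr.
rewrite (eq_bigr (fun i => r i * G (inl (i, j)) w'))//.
by move=> i _; rewrite rE mulrC /mix /offsupp/= bj eqxx.
Qed.

End recovery_probability.

(** * Least squares restricted to a set of columns *)

Section least_squares.
Context {R : realType}.
Variables (n p : nat) (x : 'I_n -> 'I_p -> R) (S : pred 'I_p) (c : R).
Implicit Types (v y a : 'I_p -> R).
Hypothesis c0 : 0 < c.
Hypothesis coercive : forall v, (forall j, ~~ S j -> v j = 0) ->
  c * \sum_j v j ^+ 2 <= \sum_i (\sum_j x i j * v j) ^+ 2.

(** The Gram matrix of the columns in S, completed by the identity off S: it stays p by p, and its
    inverse maps vectors supported on S to vectors supported on S. *)
Let gram : 'M[R]_p :=
  \matrix_(j, k) (if S j && S k then \sum_i x i j * x i k else (j == k)%:R).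

Let gram_on v j : S j -> (forall k, ~~ S k -> v k = 0) ->
  \sum_k gram j k * v k = \sum_i x i j * (\sum_k x i k * v k).
Proof.
move=> Sj v0.
rewrite (eq_bigr (fun k => \sum_i x i j * (x i k * v k))); last first.
  move=> k _; rewrite mxE Sj/=; case: (boolP (S k)) => Sk.
    by rewrite mulr_suml; apply: eq_bigr => i _; rewrite mulrA.
  by rewrite v0// mulr0 big1// => i _; rewrite !mulr0.
by rewrite exchange_big/=; apply: eq_bigr => i _; rewrite mulr_sumr.
Qed.

Let gram_off v j : ~~ S j -> \sum_k gram j k * v k = v j.
Proof.
move=> Sj; rewrite (bigD1 j)//= [X in _ + X]big1 ?addr0; last first.
  by move=> k kj; rewrite mxE (negbTE Sj)/= eq_sym (negbTE kj) mul0r.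
by rewrite mxE (negbTE Sj)/= eqxx mul1r.
Qed.

Let gram_sym : gram^T = gram.
Proof.
apply/matrixP => j k; rewrite !mxE andbC eq_sym; case: ifP => // _.
by apply: eq_bigr => i _; rewrite mulrC.
Qed.

Let dot_gram v a : \sum_j v j * (\sum_i x i j * (\sum_k x i k * a k)) =
  \sum_i (\sum_j x i j * v j) * (\sum_k x i k * a k).
Proof.
rewrite (eq_bigr (fun j => \sum_i x i j * v j * (\sum_k x i k * a k))); last first.
  by move=> j _; rewrite mulr_sumr; apply: eq_bigr => i _; ring.
by rewrite exchange_big/=; apply: eq_bigr => i _; rewrite mulr_suml.
Qed.

Let gram_unit : gram \in unitmx.
Proof.
rewrite -row_free_unit; apply: inj_row_free => u uA.
have {}uA j : \sum_k gram j k * u 0 k = 0.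
  transitivity ((u *m gram) 0 j); last by rewrite uA mxE.
  rewrite [RHS]mxE; apply: eq_bigr => k _; rewrite mulrC; congr (_ * _).
  by rewrite -{1}gram_sym [LHS]mxE.
have u0 j : ~~ S j -> u 0 j = 0 by move=> Sj; rewrite -(@gram_off (u 0)).
have : c * \sum_j u 0 j ^+ 2 <= 0.
  apply: le_trans (coercive u0) _.
  rewrite (eq_bigr (fun i => (\sum_j x i j * u 0 j) * (\sum_j x i j * u 0 j))); last first.
    by move=> i _; rewrite expr2.
  rewrite -dot_gram big1// => j _; case: (boolP (S j)) => Sj; last by rewrite u0// mul0r.
  by rewrite -gram_on// uA mulr0.
rewrite pmulr_rle0// => h.
have : \sum_j u 0 j ^+ 2 == 0.
  by rewrite eq_le h sumr_ge0// => j _; exact: sqr_ge0.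
rewrite psumr_eq0 => [/allP hu|j _]; last exact: sqr_ge0.
apply/matrixP => i j; rewrite (ord1 i) mxE.
by have := hu j; rewrite mem_index_enum sqrf_eq0 => /(_ isT) /eqP.
Qed.

Lemma normal_equation y : exists a, (forall j, ~~ S j -> a j = 0) /\
  (forall j, S j -> \sum_i x i j * (\sum_k x i k * a k) = y j).
Proof.
pose yS : 'cV[R]_p := \col_j (if S j then y j else 0).
pose u := invmx gram *m yS.
have gu j : \sum_k gram j k * u k 0 = if S j then y j else 0.
  have : gram *m u = yS by rewrite mulmxA mulmxV// mul1mx.
  by move/matrixP => /(_ j 0); rewrite !mxE.
have u0 j : ~~ S j -> u j 0 = 0.
  by move=> Sj; rewrite -(@gram_off (fun k => u k 0))// gu (negbTE Sj).
exists (fun j => u j 0); split => // j Sj.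
by rewrite -gram_on// gu Sj.
Qed.

Lemma normal_energy a y : (forall j, ~~ S j -> a j = 0) ->
  (forall j, S j -> \sum_i x i j * (\sum_k x i k * a k) = y j) ->
  \sum_i (\sum_j x i j * a j) ^+ 2 = \sum_j a j * y j.
Proof.
move=> a0 ha.
rewrite (eq_bigr (fun i => (\sum_j x i j * a j) * (\sum_j x i j * a j))); last first.
  by move=> i _; rewrite expr2.
rewrite -dot_gram; apply: eq_bigr => j _; case: (boolP (S j)) => Sj; first by rewrite ha.
by rewrite a0// !mul0r.
Qed.

(** With D = a . y the energy, coercivity gives c |a|^2 <= D and Cauchy-Schwarz gives D^2 <= |a|^2
    |y|^2; together c D <= |y|^2, and both bounds follow. *)
Lemma normal_energy_le a y : (forall j, ~~ S j -> a j = 0) ->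
  (forall j, S j -> \sum_i x i j * (\sum_k x i k * a k) = y j) ->
  \sum_i (\sum_j x i j * a j) ^+ 2 <= (\sum_j y j ^+ 2) / c /\
  \sum_j a j ^+ 2 <= (\sum_j y j ^+ 2) / c ^+ 2.
Proof.
move=> a0 ha; have coer := coercive a0; rewrite (normal_energy a0 ha) in coer *.
set D := \sum_j a j * y j in coer *; set N := \sum_j a j ^+ 2 in coer *.
set Y := \sum_j y j ^+ 2.
have cs : D ^+ 2 <= N * Y by exact: sum_cauchy_schwarz.
have N0 : 0 <= N by apply: sumr_ge0 => j _; exact: sqr_ge0.
have Y0 : 0 <= Y by apply: sumr_ge0 => j _; exact: sqr_ge0.
have D0 : 0 <= D by apply: le_trans coer; rewrite mulr_ge0// ltW.
have DY : c * D <= Y.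
  have [->|Dn] := eqVneq D 0; first by rewrite mulr0.
  have Dp : 0 < D by rewrite lt_def Dn.
  rewrite -(ler_pM2r Dp) -mulrA -expr2.
  apply: le_trans (ler_wpM2l (ltW c0) cs) _.
  by rewrite mulrA mulrC ler_wpM2l.
split; first by rewrite ler_pdivlMr// mulrC.
rewrite ler_pdivlMr ?exprn_gt0// mulrC expr2 -mulrA.
by apply: le_trans DY; rewrite ler_pM2l.
Qed.

(** By symmetry of the Gram matrix, the k-th least-squares coefficient is a linear form in z whose
    coefficients X ak depend on the design only. With the design frozen, it is therefore Gaussian in
    the noise. *)
Lemma normal_equation_dual a y z k ak : (forall j, ~~ S j -> a j = 0) ->
  (forall j, S j -> \sum_i x i j * (\sum_k x i k * a k) = \sum_i x i j * z i) ->
  (forall j, ~~ S j -> ak j = 0) ->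
  (forall j, S j -> \sum_i x i j * (\sum_k x i k * ak k) = y j) ->
  S k -> (forall j, y j = (j == k)%:R) ->
  a k = \sum_i z i * (\sum_j x i j * ak j).
Proof.
move=> a0 ha ak0 hak Sk yE.
have -> : a k = \sum_j a j * (\sum_i x i j * (\sum_k x i k * ak k)).
  rewrite (bigD1 k)//= hak// yE eqxx mulr1 big1 ?addr0// => j jk.
  case: (boolP (S j)) => Sj; last by rewrite a0// mul0r.
  by rewrite hak// yE (negbTE jk) mulr0.
rewrite dot_gram.
have -> : \sum_i (\sum_j x i j * a j) * (\sum_k x i k * ak k) =
    \sum_j ak j * (\sum_i x i j * (\sum_k x i k * a k)).
  by rewrite dot_gram; apply: eq_bigr => i _; rewrite mulrC.
rewrite (eq_bigr (fun j => \sum_i z i * (x i j * ak j))); last first.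
  move=> j _; case: (boolP (S j)) => Sj; last first.
    by rewrite ak0// mul0r big1// => i _; rewrite !mulr0.
  by rewrite ha// mulr_sumr; apply: eq_bigr => i _; ring.
by rewrite exchange_big/=; apply: eq_bigr => i _; rewrite mulr_sumr.
Qed.

(** Pythagoras twice: z - X a is the projection of z orthogonal to the columns in S, so it is
    orthogonal to X h and no longer than z. *)
Lemma residual_energy a h z : (forall j, ~~ S j -> a j = 0) ->
  (forall j, S j -> \sum_i x i j * (\sum_k x i k * a k) = \sum_i x i j * z i) ->
  (forall j, ~~ S j -> h j = 0) ->
  \sum_i (z i - \sum_j x i j * a j + \sum_j x i j * h j) ^+ 2 <=
  \sum_i z i ^+ 2 + \sum_i (\sum_j x i j * h j) ^+ 2.
Proof.
move=> a0 ha h0.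
pose q i := z i - \sum_j x i j * a j.
have ortho v : (forall j, ~~ S j -> v j = 0) -> \sum_i q i * (\sum_j x i j * v j) = 0.
  move=> v0.
  rewrite (eq_bigr (fun i => \sum_j v j * (x i j * q i))); last first.
    by move=> i _; rewrite mulr_sumr; apply: eq_bigr => j _; ring.
  rewrite exchange_big/= big1// => j _; rewrite -mulr_sumr.
  case: (boolP (S j)) => Sj; last by rewrite v0// mul0r.
  rewrite (_ : \sum_i _ = 0) ?mulr0//.
  rewrite (eq_bigr (fun i => x i j * z i - x i j * (\sum_k x i k * a k))); last first.
    by move=> i _; rewrite /q; ring.
  by rewrite sumrB ha// subrr.
have expand (u v : 'I_n -> R) : \sum_i u i * v i = 0 ->
    \sum_i (u i + v i) ^+ 2 = \sum_i u i ^+ 2 + \sum_i v i ^+ 2.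
  move=> uv; rewrite (eq_bigr (fun i => u i ^+ 2 + (v i ^+ 2 + 2 * (u i * v i)))); last first.
    by move=> i _; ring.
  by rewrite !big_split/= -mulr_sumr uv mulr0 addr0.
rewrite (expand q)// ?ortho// lerD2r.
have -> : \sum_i z i ^+ 2 = \sum_i (q i + \sum_j x i j * a j) ^+ 2.
  by apply: eq_bigr => i _; rewrite /q subrK.
by rewrite (expand q (fun i => \sum_j x i j * a j)) ?ortho// lerDl sumr_ge0// => i _; exact: sqr_ge0.
Qed.

End least_squares.

(** * Success probability: an explicit candidate and its failure events *)

Section recovery_success.
Context {d : measure_display} {T : measurableType d} {R : realType}.
Variables (P : probability T R) (n1 n2 p : nat).
Variables (s1 s2 lam rho : R) (beta : 'I_p -> R).
Notation n := (n1 + n2)%N.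
Notation I := ('I_n * 'I_p + 'I_n)%type.
Variable G : I -> T -> R.
Hypothesis iidG : iid_std_gaussian P G.
Notation s := #|[pred j | beta j != 0]|.
Notation m := #|[pred j | beta j == 0]|.
Notation eta j := (Num.sg (beta j)).
Notation sd := (noise_sd (n1 := n1) (n2 := n2) s1 s2).
Notation var := (n1%:R * s1 ^+ 2 + n2%:R * s2 ^+ 2).
Hypotheses (lam0 : 0 < lam) (n0 : (0 < n)%N) (rho0 : 0 < rho).
Hypothesis rho_le : forall j, beta j != 0 -> rho <= `|beta j|.

Let sgr_close (u v : R) : `|u - v| < `|v| -> Num.sg u = Num.sg v.
Proof.
rewrite ltr_norml => /andP[h1 h2]; have [v0|v0|v0] := ltgtP 0 v.
- by rewrite !gtr0_sg//; move: h1; rewrite gtr0_norm//; lra.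
- by rewrite !ltr0_sg//; move: h2; rewrite ltr0_norm//; lra.
- by move: h1 h2; rewrite -v0 normr0; lra.
Qed.

(** The candidate is beta + e - h: e is the least-squares response to the noise and h the shrinkage
    caused by the penalty. The on-support equations then hold by construction, and the signs survive
    because each part costs at most rho / 2, the first strictly less. *)
Let recov_sufficient (g : I -> R) (e h : 'I_p -> R) :
  let x i j := g (inl (i, j)) in
  let r i := sd i * g (inr i) - \sum_j x i j * e j + \sum_j x i j * h j in
  (forall j, beta j = 0 -> e j = 0) -> (forall j, beta j = 0 -> h j = 0) ->
  (forall j, beta j != 0 ->
    \sum_i x i j * (\sum_k x i k * e k) = \sum_i x i j * (sd i * g (inr i))) ->
  (forall j, beta j != 0 ->
    \sum_i x i j * (\sum_k x i k * h k) = n%:R * lam * eta j) ->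
  (forall j, beta j != 0 -> `|e j| < rho / 2) ->
  (forall j, beta j != 0 -> `|h j| <= rho / 2) ->
  (forall j, beta j = 0 -> `|\sum_i r i * x i j| <= n%:R * lam) ->
  recov sd beta lam g.
Proof.
move=> x r e0 h0 he hh se sh off; exists (fun j => beta j + (e j - h j)).
have rE i : resid sd beta g (fun j => beta j + (e j - h j)) i = r i.
  rewrite /resid /r -addrA; congr (_ + _).
  rewrite -sumrN -sumrN -big_split/=; apply: eq_bigr => j _; rewrite /x; ring.
have cE j : corr sd beta g (fun j => beta j + (e j - h j)) j = \sum_i r i * x i j.
  by apply: eq_bigr => i _; rewrite rE mulrC.
move=> j; rewrite cE; split => [|bj|bj]; last exact: off.
- have [bj|bj] := eqVneq (beta j) 0; first by rewrite e0// h0// subrr addr0.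
  apply: sgr_close; rewrite addrAC subrr add0r; apply: lt_le_trans (rho_le bj).
  apply: le_lt_trans (ler_normB _ _) _; have := se j bj; have := sh j bj; lra.
- rewrite (eq_bigr (fun i => x i j * (sd i * g (inr i)) -
      x i j * (\sum_k x i k * e k) + x i j * (\sum_k x i k * h k))); last first.
    by move=> i _; rewrite /r; ring.
  by rewrite big_split/= sumrB he// hh// subrr add0r.
Qed.

Lemma noise_sd_sum (f1 : 'I_n1 -> R) (f2 : 'I_n2 -> R) (f : 'I_n -> R) :
  (forall a, f (lshift n2 a) = f1 a) -> (forall a, f (rshift n1 a) = f2 a) ->
  \sum_i sd i ^+ 2 * f i = s1 ^+ 2 * \sum_a f1 a + s2 ^+ 2 * \sum_a f2 a.
Proof.
move=> h1 h2; rewrite big_split_ord/= !mulr_sumr; congr (_ + _); apply: eq_bigr => a _.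
  by rewrite /noise_sd h1 -[lshift n2 a]/(unsplit (inl a)) unsplitK.
by rewrite /noise_sd h2 -[rshift n1 a]/(unsplit (inr a)) unsplitK.
Qed.

(** Markov's inequality. The second moment is bounded through y^2 <= 8 exp(y^2 / 8), reusing the
    exponential moment already available; this costs the constant 8 e. *)
Let noise_energy_tail (K : R) : 0 < K ->
  (P [set w | (K <= \sum_i (sd i * G (inr i) w) ^+ 2)%R] <= (8 * expR 1 * var / K)%:E)%E.
Proof.
move=> K0.
pose f i w : \bar R := (8 * sd i ^+ 2 / K * expR (8^-1 * G (inr i) w ^+ 2))%:E.
have c0 i : 0 <= 8 * sd i ^+ 2 / K.
  by apply: divr_ge0; [apply: mulr_ge0 => //; exact: sqr_ge0|exact: ltW].
have f0 i w : (0 <= f i w)%E by rewrite lee_fin mulr_ge0 ?expR_ge0.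
have mf i : measurable_fun setT (f i).
  apply/measurable_EFinP; apply: measurable_funM => //; apply: measurableT_comp => //.
  apply: measurable_funM => //; apply: measurable_funX; exact: (measurable_entry iidG).
have mE : measurable [set w | K <= \sum_i (sd i * G (inr i) w) ^+ 2].
  apply: measurable_set_le => //; apply: measurable_sum => i; apply: measurable_funX.
  by apply: measurable_funM => //; exact: (measurable_entry iidG).
rewrite -(setIT [set w | _]) -(integral_indic P measurableT mE).
apply: (@le_trans _ _ (\int[P]_w \sum_i f i w)%E).
  apply: ge0_le_integral => //.
  - by apply/measurable_EFinP; exact: measurable_indic.
  - exact: emeasurable_sum.
  move=> w _; rewrite indicE; case: (boolP (_ \in _)) => [|_]; last by apply: sume_ge0.
  rewrite inE/= => h; rewrite sumEFin lee_fin.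
  rewrite -[leLHS](divff (lt0r_neq0 K0)) ler_pdivrMr// mulr_suml.
  apply: le_trans h _; apply: ler_sum => i _.
  rewrite [leRHS](_ : _ = sd i ^+ 2 * (8 * expR (8^-1 * G (inr i) w ^+ 2))); last first.
    by field; rewrite gt_eqF.
  rewrite exprMn ler_wpM2l ?sqr_ge0//.
  have := expR_ge1Dx (8^-1 * G (inr i) w ^+ 2); lra.
rewrite ge0_integral_sum//.
apply: (@le_trans _ _ (\sum_i (8 * sd i ^+ 2 / K * expR 1)%:E)%E).
  apply: lee_sum => i _; rewrite /f.
  under eq_integral do rewrite EFinM.
  have me : measurable_fun setT (fun w => (expR (8^-1 * G (inr i) w ^+ 2))%:E).
    apply/measurable_EFinP; apply: measurableT_comp => //; apply: measurable_funM => //.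
    apply: measurable_funX; exact: (measurable_entry iidG).
  rewrite (ge0_integralZl P measurableT me); last 2 first.
  - by move=> w _; rewrite lee_fin expR_ge0.
  - by rewrite lee_fin.
  rewrite [leRHS]EFinM; apply: lee_wpmul2l; first by rewrite lee_fin.
  pose h y : \bar R := (expR (8^-1 * y ^+ 2))%:E.
  have mh : measurable_fun [set: R] h.
    apply/measurable_EFinP; apply: measurableT_comp => //.
    by apply: measurable_funM; [exact: measurable_cst|exact: measurable_funX].
  rewrite (@ge0_integral_entry _ _ _ P _ G iidG (inr i) h mh); last first.
    by move=> y; rewrite lee_fin expR_ge0.
  apply: le_trans (integral_gauss_expR_sqr_le _) _; first by rewrite ger0_norm; lra.
  by rewrite lee_fin ler_expR; lra.
rewrite sumEFin lee_fin.
rewrite (eq_bigr (fun i => 8 * expR 1 / K * (sd i ^+ 2 * 1))); last first.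
  by move=> i _; field; rewrite gt_eqF.
rewrite -mulr_sumr (@noise_sd_sum (fun=> 1) (fun=> 1))//.
rewrite !sumr_const !card_ord le_eqVlt; apply/orP; left; apply/eqP.
by field; rewrite gt_eqF.
Qed.

Let offsupp_columns_tail (r : 'I_n -> R) (V : R) : 0 < V -> \sum_i r i ^+ 2 <= V ->
  (P [set w | (exists j, beta j == 0 /\ n%:R * lam <= `|\sum_i r i * G (inl (i, j)) w|)%R]
   <= (m%:R * (2 * expR (- ((n%:R * lam) ^+ 2 / (2 * V)))))%:E)%E.
Proof.
move=> V0 rV.
have E j : [set w | n%:R * lam <= `|\sum_i r i * G (inl (i, j)) w|] =
    [set w | n%:R * lam <= `|\sum_k col_coef r j k * G k w|].
  by apply/seteqP; split => w /=; rewrite (sum_col_coef (coords G w)).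
apply: (@prob_exists_le_const _ _ _ P _ (fun j => beta j == 0)
  (fun j => [set w | n%:R * lam <= `|\sum_i r i * G (inl (i, j)) w|])).
- move=> j; rewrite E; apply: measurable_set_le => //; apply: measurable_fun_norm.
  exact: (measurable_lincomb iidG).
- move=> j _; rewrite E; apply: (lincomb_tail iidG) => //.
    by rewrite mulr_ge0// ltW.
  by rewrite col_coef_sqr.
- by rewrite mulr_ge0// expR_ge0.
- by rewrite sumr_const.
Qed.

Let noise_coords_tail (a : 'I_p -> 'I_n -> R) (V : R) : 0 < V ->
  (forall k, beta k != 0 -> \sum_i (sd i * a k i) ^+ 2 <= V) ->
  (P [set w | (exists k, beta k != 0 /\
       rho / 2 <= `|\sum_i (sd i * a k i) * G (inr i) w|)%R]
   <= (s%:R * (2 * expR (- ((rho / 2) ^+ 2 / (2 * V)))))%:E)%E.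
Proof.
move=> V0 aV.
have E k : [set w | rho / 2 <= `|\sum_i (sd i * a k i) * G (inr i) w|] =
    [set w | rho / 2 <= `|\sum_l noise_coef (fun i => sd i * a k i) l * G l w|].
  by apply/seteqP; split => w /=; rewrite (sum_noise_coef (coords G w)).
apply: (@prob_exists_le_const _ _ _ P _ (fun k => beta k != 0)
  (fun k => [set w | rho / 2 <= `|\sum_i (sd i * a k i) * G (inr i) w|])).
- move=> k; rewrite E; apply: measurable_set_le => //; apply: measurable_fun_norm.
  exact: (measurable_lincomb iidG).
- move=> k bk; rewrite E; apply: (lincomb_tail iidG) => //.
    by rewrite divr_ge0// ltW.
  by rewrite noise_coef_sqr; exact: aV.
- by rewrite mulr_ge0// expR_ge0.
- by rewrite sumr_const.
Qed.

(** The support as a type of its own, so that the grid count is exponential in s and not in p. *)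
Notation B := {j : 'I_p | j \in [pred j | beta j != 0]}.

Let sum_supp (F : 'I_p -> R) : (forall j, beta j = 0 -> F j = 0) ->
  \sum_j F j = \sum_(b : B) F (val b).
Proof.
move=> F0; rewrite -big_sub (bigID (fun j => beta j != 0))/= [X in _ + X]big1 ?addr0//.
by move=> j; rewrite negbK => /eqP; exact: F0.
Qed.

Let H1 (k : 'I_n1 * B) := G (inl (lshift n2 k.1, val k.2)).
Let H2 (k : 'I_n2 * B) := G (inl (rshift n1 k.1, val k.2)).

Let iidH1 : iid_std_gaussian P H1.
Proof.
apply: (iid_std_gaussian_inj (h := fun k => inl (lshift n2 k.1, val k.2))) iidG.
move=> [a b] [a' b'] /= E.
have [E1 E2] : lshift n2 a = lshift n2 a' /\ val b = val b'.
  by split; [exact: (congr1 (fun u => if u is inl k then k.1 else lshift n2 a) E)|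
             exact: (congr1 (fun u => if u is inl k then k.2 else val b) E)].
by rewrite (lshift_inj E1) (val_inj E2).
Qed.

Let iidH2 : iid_std_gaussian P H2.
Proof.
apply: (iid_std_gaussian_inj (h := fun k => inl (rshift n1 k.1, val k.2))) iidG.
move=> [a b] [a' b'] /= E.
have [E1 E2] : rshift n1 a = rshift n1 a' /\ val b = val b'.
  by split; [exact: (congr1 (fun u => if u is inl k then k.1 else rshift n1 a) E)|
             exact: (congr1 (fun u => if u is inl k then k.2 else val b) E)].
by rewrite (rshift_inj E1) (val_inj E2).
Qed.

(** One summand per failure: the Gram matrices of the two row blocks, the noise energy exceeding K,
    some on-support error reaching rho / 2, and some off-support correlation reaching n lam. The
    bound e <= 1/6 keeps 1 - 3 e at least 1/2. *)
Lemma recov_prob_large (e K : R) : 0 < e -> e <= 6^-1 -> 0 < K -> 0 < var ->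
  lam * Num.sqrt s%:R / (1 - 3 * e) <= rho / 2 ->
  (P (~` [set w | recov sd beta lam (coords G w)]) <=
   (64 ^+ s * (2 * expR (- (e ^+ 2 / 8 * n1%:R))) +
    64 ^+ s * (2 * expR (- (e ^+ 2 / 8 * n2%:R))) +
    (8 * expR 1 * var / K +
     s%:R * (2 * expR (- ((rho / 2) ^+ 2 / (2 * ((1 + 3 * e) * var / ((1 - 3 * e) * n%:R) ^+ 2))))) +
     m%:R * (2 * expR (- ((n%:R * lam) ^+ 2 /
       (2 * (K + (n%:R * lam) ^+ 2 * (s%:R / ((1 - 3 * e) * n%:R)))))))))%:E)%E.
Proof.
move=> e0 e6 K0 var0 hrho.
set V1 := (1 + 3 * e) * var / _; set V2 := K + _.
have n0' : 0 < n%:R :> R by rewrite ltr0n.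
pose c : R := (1 - 3 * e) * n%:R.
have de0 : 0 < 1 - 3 * e by lra.
have c0 : 0 < c by rewrite mulr_gt0.
have nl0 : 0 < n%:R * lam by rewrite mulr_gt0.
have V10 : 0 < V1 by rewrite divr_gt0 ?exprn_gt0// mulr_gt0//; lra.
have V20 : 0 < V2.
  by rewrite ltr_pwDl// mulr_ge0 ?sqr_ge0// divr_ge0// ltW.
have cardB : #|{: B}| = s by rewrite card_sig; apply: eq_card => j; rewrite !inE.
pose B1 := [set w | gram_bad e (fun a b => H1 (a, b) w)].
pose B2 := [set w | gram_bad e (fun a b => H2 (a, b) w)].
have mB1 : measurable B1 := measurable_gram_bad iidH1 e.
have mB2 : measurable B2 := measurable_gram_bad iidH2 e.
have e2 : e <= 2^-1 by lra.
have PB1 := prob_gram_bad iidH1 e0 e2; rewrite cardB card_ord in PB1.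
have PB2 := prob_gram_bad iidH2 e0 e2; rewrite cardB card_ord in PB2.
pose E := ~` (recov sd beta lam : set (cspace R I)).
have mE : measurable E by apply: measurableC; exact: measurable_recov.
set t3 := 8 * expR 1 * var / K; set t4 := s%:R * _; set t5 := m%:R * _.
have t50 : 0 <= t5 by rewrite !mulr_ge0// expR_ge0.
have t40 : 0 <= t4 by rewrite !mulr_ge0// expR_ge0.
have t30 : 0 <= t3 by rewrite divr_ge0 ?ltW// !mulr_gt0// expR_gt0.
apply: (@le_trans _ _ (P (B1 `|` B2) + (t3 + t4 + t5)%:E)%E); last first.
  rewrite [leRHS]EFinD; apply: leeD => //; rewrite EFinD.
  by apply: le_trans (leeD PB1 PB2); exact: measureU2.
rewrite (_ : ~` _ = coords G @^-1` E)//.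
(* First of two nested decouplings: only the on-support columns stay frozen, while the noise and the
   off-support columns are redrawn. *)
pose J1 (k : I) := if k is inl ij then beta ij.2 == 0 else true.
apply: (prob_decouple_le iidG (J := J1)) => //.
- exact: measurableU.
- by rewrite lee_fin !addr_ge0.
move=> w; rewrite not_orP => -[good1 good2].
pose x i j := G (inl (i, j)) w.
have gram1 (v : 'I_p -> R) : (forall j, beta j = 0 -> v j = 0) ->
  `|\sum_a (\sum_j x (lshift n2 a) j * v j) ^+ 2 - n1%:R * \sum_j v j ^+ 2|
    <= 3 * e * n1%:R * \sum_j v j ^+ 2.
  move=> v0; have := gram_defect_good (fun b : B => v (val b)) (ltW e0) good1.
  rewrite /gram_defect card_ord -(@sum_supp (fun j => v j ^+ 2)); last first.
    by move=> j /v0 ->; rewrite expr0n.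
  rewrite (eq_bigr (fun a => (\sum_j x (lshift n2 a) j * v j) ^+ 2))// => a _.
  congr (_ ^+ 2); rewrite (@sum_supp (fun j => x (lshift n2 a) j * v j)).
    by apply: eq_bigr => b _; rewrite mulrC.
  by move=> j /v0 ->; rewrite mulr0.
have gram2 (v : 'I_p -> R) : (forall j, beta j = 0 -> v j = 0) ->
  `|\sum_a (\sum_j x (rshift n1 a) j * v j) ^+ 2 - n2%:R * \sum_j v j ^+ 2|
    <= 3 * e * n2%:R * \sum_j v j ^+ 2.
  move=> v0; have := gram_defect_good (fun b : B => v (val b)) (ltW e0) good2.
  rewrite /gram_defect card_ord -(@sum_supp (fun j => v j ^+ 2)); last first.
    by move=> j /v0 ->; rewrite expr0n.
  rewrite (eq_bigr (fun a => (\sum_j x (rshift n1 a) j * v j) ^+ 2))// => a _.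
  congr (_ ^+ 2); rewrite (@sum_supp (fun j => x (rshift n1 a) j * v j)).
    by apply: eq_bigr => b _; rewrite mulrC.
  by move=> j /v0 ->; rewrite mulr0.
have coer (v : 'I_p -> R) : (forall j, ~~ (beta j != 0) -> v j = 0) ->
    c * \sum_j v j ^+ 2 <= \sum_i (\sum_j x i j * v j) ^+ 2.
  move=> v0; have v0' j : beta j = 0 -> v j = 0 by move=> bj; apply: v0; rewrite bj eqxx.
  have := gram1 v v0'; have := gram2 v v0'; rewrite big_split_ord/= !ler_norml.
  move=> /andP[h2 _] /andP[h1 _]; rewrite /c natrD; lra.
have supp0 (v : 'I_p -> R) : (forall j, ~~ (beta j != 0) -> v j = 0) ->
    forall j, beta j = 0 -> v j = 0 by move=> v0 j bj; apply: v0; rewrite bj eqxx.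
(* The dual vectors [ak] and the shrinkage direction [dd] are fixed here, where only on-support
   columns are known; hence they are constants for the noise drawn later. *)
have /choice[ak hak] := fun k => normal_equation c0 coer (fun j => (j == k)%:R).
have [dd [d0 hd]] := normal_equation c0 coer (fun j => eta j).
have akV k : \sum_i (sd i * (\sum_j x i j * ak k j)) ^+ 2 <= V1.
  have [a0 ha] := hak k; have [_ hN] := normal_energy_le c0 coer a0 ha.
  have y1 : \sum_j ((j == k)%:R : R) ^+ 2 = 1.
    by rewrite (bigD1 k)//= eqxx expr1n big1 ?addr0// => j /negbTE ->; rewrite expr0n.
  rewrite y1 in hN.
  rewrite (eq_bigr (fun i => sd i ^+ 2 * (\sum_j x i j * ak k j) ^+ 2)); last first.
    by move=> i _; rewrite exprMn.
  rewrite (noise_sd_sum (f1 := fun a => (\sum_j x (lshift n2 a) j * ak k j) ^+ 2)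
    (f2 := fun a => (\sum_j x (rshift n1 a) j * ak k j) ^+ 2))//.
  have := gram1 _ (supp0 _ a0); have := gram2 _ (supp0 _ a0); rewrite !ler_norml.
  set S1 := \sum_(a : 'I_n1) _; set S2 := \sum_(a : 'I_n2) _; set N := \sum_j ak k j ^+ 2.
  move=> /andP[_ h2] /andP[_ h1].
  (* Separate bounds for the row blocks recombine into a multiple of [var]; control of S1 + S2 alone
     would only give n times the larger variance. *)
  have S1le : S1 <= (1 + 3 * e) * n1%:R * N by lra.
  have S2le : S2 <= (1 + 3 * e) * n2%:R * N by lra.
  apply: (@le_trans _ _ ((1 + 3 * e) * var * N)).
    apply: le_trans (lerD (ler_wpM2l (sqr_ge0 s1) S1le) (ler_wpM2l (sqr_ge0 s2) S2le)) _.
    by rewrite le_eqVlt; apply/orP; left; apply/eqP; ring.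
  rewrite /V1 -/c ler_wpM2l//; last by move: hN; rewrite mul1r.
  by rewrite mulr_ge0 ?ltW//; lra.
have eta2 : \sum_j eta j ^+ 2 = s%:R := sum_sg_sqr beta.
have [hdX hdN] := normal_energy_le c0 coer d0 hd; rewrite eta2 in hdX hdN.
pose h j := n%:R * lam * dd j.
have h0 j : ~~ (beta j != 0) -> h j = 0 by move=> bj; rewrite /h d0// mulr0.
have hX i : \sum_j x i j * h j = n%:R * lam * \sum_j x i j * dd j.
  by rewrite mulr_sumr; apply: eq_bigr => j _; rewrite /h; ring.
have hsmall j : `|h j| <= rho / 2.
  apply: le_trans hrho; rewrite /h normrM gtr0_norm//.
  have : `|dd j| <= Num.sqrt s%:R / c.
    rewrite -sqrtr_sqr -[leRHS]ger0_norm; last by rewrite divr_ge0// ltW.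
    rewrite -[leRHS]sqrtr_sqr ler_sqrt ?sqr_ge0// expr_div_n sqr_sqrtr//.
    apply: le_trans hdN; rewrite (bigD1 j)//= lerDl sumr_ge0// => k _; exact: sqr_ge0.
  move=> hj; apply: le_trans (ler_wpM2l (ltW nl0) hj) _.
  rewrite /c le_eqVlt; apply/orP; left; apply/eqP.
  move: (n%:R : R) n0' => N N0; field.
  by apply/andP; split; rewrite gt_eqF.
pose C1 := [set w' | K <= \sum_i (sd i * G (inr i) w') ^+ 2].
pose C2 := [set w' | exists k, beta k != 0 /\
  (rho / 2 <= `|\sum_i (sd i * (\sum_j x i j * ak k j)) * G (inr i) w'|)%R].
have PC1 : (P C1 <= t3%:E)%E := noise_energy_tail K0.
have PC2 : (P C2 <= t4%:E)%E := noise_coords_tail V10 (fun k _ => akV k).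
have mC1 : measurable C1.
  apply: measurable_set_le => //; apply: measurable_sum => i; apply: measurable_funX.
  by apply: measurable_funM => //; exact: (measurable_entry iidG).
have mC2 : measurable C2.
  apply: (@measurable_exists_fin _ _ _ (fun k => beta k != 0)
    (fun k => [set w' | rho / 2 <= `|\sum_i (sd i * (\sum_j x i j * ak k j)) * G (inr i) w'|])) => k.
  apply: measurable_set_le => //; apply: measurable_fun_norm; apply: measurable_sum => i.
  by apply: measurable_funM => //; exact: (measurable_entry iidG).
apply: (@le_trans _ _ (P (C1 `|` C2) + t5%:E)%E); last first.
  rewrite [leRHS]EFinD; apply: leeD => //; rewrite EFinD.
  by apply: le_trans (leeD PC1 PC2); exact: measureU2.
pose E1 : set (cspace R I) := [set g | E (mix J1 (coords G w) g)].
have mE1 : measurable E1.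
  by have := measurable_mix_r J1 (coords G w) measurableT mE; rewrite setTI.
(* Second decoupling: with the noise frozen as well, the candidate residual is a constant and only
   the off-support columns are redrawn. *)
apply: (prob_decouple_le iidG (J := offsupp beta) (E := E1)) => //; first exact: measurableU.
move=> w'; rewrite not_orP => -[nC1 nC2].
pose z i := sd i * G (inr i) w'.
have [ee [ee0 hee]] := normal_equation c0 coer (fun j => \sum_i x i j * z i).
have eeE k : beta k != 0 -> ee k = \sum_i (sd i * (\sum_j x i j * ak k j)) * G (inr i) w'.
  move=> bk; have [a0 ha] := hak k.
  rewrite (normal_equation_dual ee0 hee a0 ha)//.
  by apply: eq_bigr => i _; rewrite /z; ring.
pose r i := z i - \sum_j x i j * ee j + \sum_j x i j * h j.
have rV : \sum_i r i ^+ 2 <= V2.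
  apply: le_trans (residual_energy ee0 hee h0) _; rewrite /V2; apply: lerD.
    by move/negP: nC1; rewrite -ltNge => /ltW.
  under eq_bigr do rewrite hX exprMn.
  by rewrite -mulr_sumr ler_wpM2l ?sqr_ge0.
apply: le_trans (offsupp_columns_tail V20 rV).
have mS : measurable [set w'' | E1 (mix (offsupp beta) (coords G w') (coords G w''))].
  have := measurableT_comp (measurable_mix_r (offsupp beta) (coords G w')) (measurable_coords iidG).
  by move=> /(_ measurableT _ mE1); rewrite setTI.
apply: le_measure; rewrite ?inE//.
  apply: (@measurable_exists_fin _ _ _ (fun j => beta j == 0)
    (fun j => [set w'' | n%:R * lam <= `|\sum_i r i * G (inl (i, j)) w''|])) => j.
  apply: measurable_set_le => //; apply: measurable_fun_norm; apply: measurable_sum => i.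
  by apply: measurable_funM => //; exact: (measurable_entry iidG).
move=> w'' /= nrec.
apply: contrapT => nex; apply: nrec.
set g := mix _ _ _.
have gx i j : beta j != 0 -> g (inl (i, j)) = x i j.
  by move=> bj; rewrite /g /mix /J1/= (negbTE bj).
have goff i j : beta j = 0 -> g (inl (i, j)) = G (inl (i, j)) w''.
  by move=> bj; rewrite /g /mix /J1 /offsupp/= bj eqxx.
have gz i : g (inr i) = G (inr i) w' by rewrite /g /mix /J1 /offsupp/=.
have gsum (v : 'I_p -> R) i : (forall j, ~~ (beta j != 0) -> v j = 0) ->
    \sum_j g (inl (i, j)) * v j = \sum_j x i j * v j.
  move=> v0; apply: eq_bigr => j _; case: (boolP (beta j != 0)) => bj; first by rewrite gx.
  by rewrite v0// !mulr0.
apply: (@recov_sufficient g ee h).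
- exact: supp0.
- exact: supp0.
- move=> j bj; rewrite (eq_bigr (fun i => x i j * (\sum_k x i k * ee k))); last first.
    by move=> i _; rewrite gx// gsum.
  by rewrite hee//; apply: eq_bigr => i _; rewrite gx// gz.
- move=> j bj; rewrite (eq_bigr (fun i => n%:R * lam * (x i j * (\sum_k x i k * dd k)))); last first.
    by move=> i _; rewrite gx// gsum// hX; ring.
  by rewrite -mulr_sumr hd.
- move=> j bj; rewrite eeE// ltNge; apply/negP => hj; apply: nC2; by exists j.
- by move=> j _; exact: hsmall.
- move=> j bj; rewrite leNgt; apply/negP => hj; apply: nex; exists j; split; first by rewrite bj.
  rewrite (eq_bigr (fun i => r i * G (inl (i, j)) w'')) in hj; first exact: ltW.
  by move=> i _; rewrite goff// gz !gsum.
Qed.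

End recovery_success.

(** * Asymptotics *)

Section exponents.
Context {R : realType}.
Implicit Types (e L n s t lam k : R).

(** The left side diverges with L, so exp(L) columns, each violating its constraint with probability
    of order exp(-(t + 1)^2 / 2), produce a violation. The factor 1 - e pays for the factor 1 + e/2
    in t^2 and, by Young's inequality, for the cross term 2 t; s >= 1 bounds s + 1 by 2 s. *)
Lemma subcritical_exponent e L n s : 0 < e -> e <= 2^-1 -> 1 <= s -> 0 <= L -> 0 <= n ->
  n < (1 - e) * (2 * s * L + s + 1) ->
  e / 4 * L - (2 + 2 / e) <= L - (Num.sqrt ((1 + e / 2) * n / s) + 1) ^+ 2 / 2.
Proof.
move=> e0 e2 s1 L0 n0 hn; set t := Num.sqrt _.
have s0 : 0 < s by lra.
have t2 : t ^+ 2 = (1 + e / 2) * n / s.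
  by rewrite sqr_sqrtr// divr_ge0 ?mulr_ge0//; lra.
have ns : n / s <= (1 - e) * (2 * L + 2).
  by rewrite ler_pdivrMr//; nra.
have t2le : t ^+ 2 <= (1 - e / 2) * (2 * L + 2).
  rewrite t2 -mulrA; apply: (@le_trans _ _ ((1 + e / 2) * ((1 - e) * (2 * L + 2)))).
    by rewrite ler_wpM2l//; lra.
  rewrite mulrA ler_wpM2r//; first by lra.
  by nra.
(* Young: [2 t <= (e / 4) t^2 + 4 / e] *)
have young : 2 * t <= e / 4 * t ^+ 2 + 4 / e.
  have : 0 <= e^-1 * (e * t / 2 - 2) ^+ 2 by rewrite mulr_ge0 ?invr_ge0 ?sqr_ge0// ltW.
  rewrite (_ : e^-1 * _ = e / 4 * t ^+ 2 - 2 * t + 4 / e); first by lra.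
  by field; rewrite gt_eqF.
have e42 : 4 / e = 2 * (2 / e) by field; rewrite gt_eqF.
have h : (1 + e / 4) * t ^+ 2 <= (1 + e / 4) * ((1 - e / 2) * (2 * L + 2)).
  by rewrite ler_wpM2l//; lra.
have h' : (1 + e / 4) * ((1 - e / 2) * (2 * L + 2)) <= (1 - e / 4) * (2 * L + 2).
  rewrite mulrA ler_wpM2r//; first by lra.
  by nra.
have -> : (t + 1) ^+ 2 = t ^+ 2 + 2 * t + 1 by ring.
have hh := le_trans h h'.
move: (t ^+ 2) (2 / e) e42 young hh => u v -> young hh.
nra.
Qed.

(** The exponent exceeds L by a margin e L / 2, enough for a union bound over exp(L) columns. By
    definition of k the noise term var sqrt(k) equals (n lam)^2 / (sqrt(k) L), so (n lam)^2 cancels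
    and what remains is (1 + e/2)(2 / sqrt(k) + 2 L q) <= 1. *)
Lemma supercritical_exponent e L n s lam var k : 0 < e -> e <= 1 -> 0 < L -> 0 < s ->
  0 < lam -> 0 < var -> 0 < n -> (1 + e) * (2 * s * L + s + 1) < n ->
  k = n * lam ^+ 2 / (var / n * L) -> 24 / e <= Num.sqrt k ->
  (1 + e / 2) * L <= (n * lam) ^+ 2 /
    (2 * (var * Num.sqrt k + (n * lam) ^+ 2 * (s / ((1 - 3 * (e / 24)) * n)))).
Proof.
move=> e0 e1 L0 s0 lam0 var0 n0 hn kE; set u := Num.sqrt k => hu.
have k0 : 0 < k by rewrite kE divr_gt0 ?mulr_gt0 ?exprn_gt0 ?invr_gt0.
have u0 : 0 < u by rewrite sqrtr_gt0.
have uk : u ^+ 2 = k by rewrite sqr_sqrtr// ltW.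
have nl0 : 0 < (n * lam) ^+ 2 by rewrite exprn_gt0// mulr_gt0.
have varE : var * u = (n * lam) ^+ 2 / (u * L).
  have : u ^+ 2 * (var * L) = (n * lam) ^+ 2.
    by rewrite uk kE; field; rewrite !gt_eqF.
  by move=> <-; field; rewrite !gt_eqF.
have d0 : 0 < 1 - 3 * (e / 24) by lra.
set q := s / _; have q0 : 0 < q by rewrite divr_gt0// mulr_gt0.
rewrite varE.
have -> : (n * lam) ^+ 2 / (u * L) + (n * lam) ^+ 2 * q = (n * lam) ^+ 2 * ((u * L)^-1 + q).
  by rewrite mulrDr.
have z0 : 0 < (u * L)^-1 + q by rewrite addr_gt0// invr_gt0 mulr_gt0.
rewrite ler_pdivlMr; last by rewrite !mulr_gt0.
have -> : (1 + e / 2) * L * (2 * ((n * lam) ^+ 2 * ((u * L)^-1 + q))) =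
    (n * lam) ^+ 2 * ((1 + e / 2) * (2 / u + 2 * L * q)).
  by field; rewrite !gt_eqF.
rewrite -[leRHS]mulr1 ler_wpM2l ?(ltW nl0)//.
have hu' : 2 / u <= e / 12.
  rewrite ler_pdivrMr//; move: hu; rewrite ler_pdivrMr//; lra.
(* From 2 s L <= n / (1 + e) and (1 + e)(1 - e/8) >= 1 + 3 e / 4, which holds for e <= 1. *)
have hq : 2 * L * q <= (1 + 3 / 4 * e)^-1.
  have p0 : 0 < 1 + 3 / 4 * e by lra.
  rewrite -[leRHS]mul1r ler_pdivlMr// /q mulrA mulrAC ler_pdivrMr ?mulr_gt0// mul1r.
  have h1 : 2 * s * L <= n / (1 + e).
    rewrite ler_pdivlMr; last by lra.
    by have := mulr_ge0 (ltW s0) (ltW L0); nra.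
  apply: (@le_trans _ _ (n / (1 + e) * (1 + 3 / 4 * e))).
    by rewrite ler_wpM2r ?(ltW p0)//; move: h1; lra.
  rewrite mulrAC ler_pdivrMr; last by lra.
  have h2 : 0 <= n * (e * (1 - e)) by rewrite !mulr_ge0 ?subr_ge0// ltW.
  nra.
have hinv : (1 + e / 2) * (1 + 3 / 4 * e)^-1 <= 1 - (1 + e / 2) * (e / 12).
  rewrite ler_pdivrMr; last by lra.
  nra.
apply: (@le_trans _ _ ((1 + e / 2) * (e / 12 + (1 + 3 / 4 * e)^-1))).
  by rewrite ler_wpM2l ?lerD//; lra.
by rewrite mulrDr; lra.
Qed.

(** An exponent of 2 ln s leaves 2 / s after a union bound over s coordinates. The constant 1/6
    works since (rho / 6)^2 * 9 = (rho / 2)^2, and 9 dominates the constants coming from the Gram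
    distortion. *)
Lemma noise_exponent e rho n s var sig : 0 < e -> e <= 1 -> 0 < rho -> 1 <= s ->
  0 < var -> 0 < n -> sig = var / n ->
  rho^-1 * Num.sqrt (sig * ln s / n) <= 6^-1 ->
  2 * ln s <= (rho / 2) ^+ 2 /
    (2 * ((1 + 3 * (e / 24)) * var / ((1 - 3 * (e / 24)) * n) ^+ 2)).
Proof.
move=> e0 e1 rho0 s1 var0 n0 -> h.
have ls0 : 0 <= ln s by rewrite ln_ge0.
have a0 : 0 <= var / n * ln s / n by rewrite !mulr_ge0 ?invr_ge0 ?(ltW n0) ?(ltW var0).
have h2 : var / n * ln s / n <= (rho / 6) ^+ 2.
  rewrite -[leLHS]sqr_sqrtr// lerXn2r ?nnegrE ?sqrtr_ge0 ?divr_ge0// ?(ltW rho0)//.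
  by move: h; rewrite [leLHS]mulrC ler_pdivrMr// [leRHS]mulrC.
have d0 : 0 < 1 - 3 * (e / 24) by lra.
have d1 : 0 < 1 + 3 * (e / 24) by lra.
rewrite ler_pdivlMr; last by rewrite !mulr_gt0// invr_gt0 exprn_gt0// mulr_gt0.
have -> : 2 * ln s * (2 * ((1 + 3 * (e / 24)) * var / ((1 - 3 * (e / 24)) * n) ^+ 2)) =
    (var / n * ln s / n) * (4 * (1 + 3 * (e / 24)) / (1 - 3 * (e / 24)) ^+ 2).
  move: (1 - 3 * (e / 24)) d0 (1 + 3 * (e / 24)) => D D0 U.
  by field; rewrite !gt_eqF.
apply: (@le_trans _ _ ((rho / 6) ^+ 2 * 9)); last by rewrite le_eqVlt; apply/orP; left; apply/eqP; field.
apply: ler_pM => //.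
  by rewrite divr_ge0 ?exprn_ge0 ?mulr_ge0// ltW.
by rewrite ler_pdivrMr ?exprn_gt0//; nra.
Qed.

End exponents.

Section limits.
Context {R : realType}.
Implicit Types (u v : nat -> R).

Lemma cvg_expRN u : u @ \oo --> +oo -> (fun k => expR (- u k)) @ \oo --> (0 : R).
Proof. by move=> uy; apply: (cvg_comp u (fun x => expR (- x)) uy); exact: cvgr_expR. Qed.

Lemma cvgy_affine_minorant u v (c C : R) : 0 < c -> u @ \oo --> +oo ->
  (\forall k \near \oo, c * u k - C <= v k) -> v @ \oo --> +oo.
Proof.
move=> c0 /cvgryPge uy uv; apply/cvgryPge => A.
near=> k; have h1 : c * u k - C <= v k by near: k.
have h2 : (A + C) / c <= u k by near: k; exact: uy.
by apply: le_trans h1; move: h2; rewrite ler_pdivrMr// mulrC; lra.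
Unshelve. all: by end_near. Qed.

Lemma cvge_squeeze0 (f : nat -> \bar R) v : (forall k, 0 <= f k)%E ->
  (\forall k \near \oo, (f k <= (v k)%:E)%E) -> v @ \oo --> (0 : R) ->
  f @ \oo --> 0%E.
Proof.
move=> f0 fv v0; apply: (@squeeze_cvge _ _ _ _ (cst 0%E) f (EFin \o v)).
- by apply: filterS fv => k ->; rewrite f0.
- exact: cvg_cst.
- by apply: cvg_EFin; [exact: nearW|exact: v0].
Qed.

End limits.

Section fixed_dimension.
Context {d : measure_display} {T : measurableType d} {R : realType}.
Variables (P : probability T R) (n1 n2 p : nat) (s1 s2 lam : R).
Variables (beta : 'cV[R]_p) (X : T -> 'M[R]_(n1 + n2, p)) (W : T -> 'cV[R]_(n1 + n2)).
Hypothesis iidXW : iid_std_gaussian P (entries_family X W).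
Hypotheses (n0 : (0 < n1 + n2)%N) (lam0 : 0 < lam).

Lemma support_sizeE : #|[pred j | beta j 0 != 0]| = support_size beta.
Proof. by apply: eq_card => j; apply/idP/idP; rewrite !inE. Qed.

Lemma support_size_compl :
  #|[pred j | beta j 0 == 0]|%:R = p%:R - (support_size beta)%:R :> R.
Proof.
apply/eqP; rewrite eq_sym subr_eq -natrD; apply/eqP; congr (_%:R).
have := cardC [pred j | beta j 0 == 0]; rewrite card_ord => h; apply: etrans (esym h) _; congr (_ + _)%N.
by rewrite -support_sizeE; apply: eq_card => j.
Qed.

Lemma recovery_setE :
  [set w | recovery (X w) beta (hetero_noise s1 s2 (W w)) lam] =
  [set w | recov (noise_sd s1 s2) (fun j => beta j 0) lam (coords (entries_family X W) w)].
Proof.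
have h w := @recoveryE R n1 n2 p s1 s2 lam (X w) beta (W w)
  (coords (entries_family X W) w) n0 lam0 (fun i j => erefl) (fun i => erefl).
by apply/seteqP; split => w /=; case: (h w).
Qed.

Lemma measurable_recovery :
  measurable [set w | recovery (X w) beta (hetero_noise s1 s2 (W w)) lam].
Proof.
rewrite recovery_setE; have := measurable_coords iidXW.
move=> /(_ measurableT _ (measurable_recov (noise_sd s1 s2) (fun j => beta j 0) lam)).
by rewrite setTI.
Qed.

End fixed_dimension.

Section asymptotics.
Context {R : realType} {d : measure_display} {T : measurableType d}.
Variables (P : probability T R) (s n1 n2 : nat -> nat) (sigma1 sigma2 rho : nat -> R).
Variables (beta : forall p : nat, 'cV[R]_p)
  (X : forall p : nat, T -> 'M[R]_(n1 p + n2 p, p))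
  (W : forall p : nat, T -> 'cV[R]_(n1 p + n2 p)).
Hypothesis sigma_gt0 : forall p, 0 < sigma1 p ^+ 2 /\ sigma1 p ^+ 2 < sigma2 p ^+ 2.
Hypothesis rho_gt0 : forall p, 0 < rho p.
Hypothesis supp : forall p, support_size (beta p) = s p.
Hypothesis rho_le : forall p (i : 'I_p), beta p i 0 != 0 -> rho p <= `|beta p i 0|.
Hypothesis iidXW : forall p, iid_std_gaussian P (entries_family (X p) (W p)).
Hypothesis s_y : (fun p => (s p)%:R : R) @ \oo --> +oo.
Hypothesis s_p : (fun p => (s p)%:R / p%:R : R) @ \oo --> 0.
Hypothesis n1_s : (fun p => (n1 p)%:R / (s p)%:R : R) @ \oo --> +oo.
Hypothesis n2_s : (fun p => (n2 p)%:R / (s p)%:R : R) @ \oo --> +oo.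

Let n p := (n1 p + n2 p)%N.
Let L p : R := ln (p%:R - (s p)%:R).
Let var p : R := (n1 p)%:R * sigma1 p ^+ 2 + (n2 p)%:R * sigma2 p ^+ 2.
Let rec_event (lam : nat -> R) p : set T :=
  [set w | recovery (X p w) (beta p) (hetero_noise (sigma1 p) (sigma2 p) (W p w)) (lam p)].

Let s_ge (A : R) : \forall p \near \oo, A <= (s p)%:R.
Proof. by move/cvgryPge: s_y => /(_ A). Qed.

Let half_p : \forall p \near \oo, (s p)%:R <= p%:R - (s p)%:R :> R.
Proof.
have h : \forall p \near \oo, (s p)%:R / p%:R < 2^-1 :> R.
  by apply: (cvgr_lt (0 : R)) => //; rewrite invr_gt0.
near=> p.
have p0 : 0 < p%:R :> R by rewrite ltr0n; near: p; exact: nbhs_infty_gt.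
have : (s p)%:R / p%:R < 2^-1 :> R by near: p.
by rewrite ltr_pdivrMr//; lra.
Unshelve. all: by end_near. Qed.

Let compl_y : (fun p => p%:R - (s p)%:R : R) @ \oo --> +oo.
Proof.
apply: (@cvgy_affine_minorant _ _ _ 1 0 ltr01 s_y).
by apply: filterS half_p => p; rewrite mul1r subr0.
Qed.

Let L_y : L @ \oo --> +oo.
Proof.
apply/cvgryPge => A; move/cvgryPge: compl_y => /(_ (expR A)).
apply: filterS => p h; rewrite -ler_expR lnK// posrE.
exact: lt_le_trans (expR_gt0 A) h.
Qed.

Let nk_large (nk : nat -> nat) : (fun p => (nk p)%:R / (s p)%:R : R) @ \oo --> +oo ->
  forall A : R, \forall p \near \oo, A * (s p)%:R <= (nk p)%:R.
Proof.
move=> /cvgryPge h A; near=> p.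
have s0 : 0 < (s p)%:R :> R by apply: lt_le_trans ltr01 _; near: p.
have : A <= (nk p)%:R / (s p)%:R by near: p; exact: h.
by rewrite ler_pdivlMr.
Unshelve. all: by end_near. Qed.

Let n_y : (fun p => (n p)%:R : R) @ \oo --> +oo.
Proof.
apply: (@cvgy_affine_minorant _ _ _ 1 0 ltr01 s_y).
apply: filterS (nk_large n1_s 1) => p; rewrite subr0 => /le_trans; apply.
by rewrite ler_nat leq_addr.
Qed.

Let compl_expR p : 0 < p%:R - (s p)%:R :> R ->
  #|[pred j | beta p j 0 == 0]|%:R = expR (L p).
Proof. by move=> h; rewrite support_size_compl supp lnK. Qed.

Let card_supp p : #|[pred j | beta p j 0 != 0]| = s p.
Proof. by rewrite support_sizeE supp. Qed.

Lemma recovery_subcritical (eps : R) (lam : nat -> R) : 0 < eps ->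
  (\forall p \near \oo, (n p)%:R < (1 - eps) * (2 * (s p)%:R * L p + (s p)%:R + 1)) ->
  (forall p, 0 < lam p) ->
  P (rec_event lam p) @[p --> \oo] --> 0%E.
Proof.
move=> eps0 hn lam0.
pose e := Num.min eps 2^-1.
have e0 : 0 < e by rewrite lt_min eps0/= invr_gt0 ltr0n.
have e2 : e <= 2^-1 by rewrite ge_min lexx orbT.
have ee : e <= eps by rewrite ge_min lexx.
pose k : R := normal_peak 1; have k0 : 0 < k by apply: normal_peak_gt0; exact: oner_neq0.
pose v p : R := 2 * expR (- ((e / 2) ^+ 2 / 8 * (n p)%:R)) +
  expR (- (k * (e / 4 * L p - (2 + 2 / e)))).
apply: (@cvge_squeeze0 _ _ v).
- by move=> p; exact: (measure_ge0 P (rec_event lam p)).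
- near=> p.
  have s1 : 1 <= (s p)%:R :> R by near: p.
  have c0 : 0 < p%:R - (s p)%:R :> R.
    by apply: lt_le_trans ltr01 _; near: p; move/cvgryPge: compl_y; exact.
  have L0 : 0 <= L p by near: p; move/cvgryPge: L_y; exact.
  have n0 : (0 < n p)%N.
    rewrite -(ltr0n R); apply: lt_le_trans ltr01 _.
    by near: p; move/cvgryPge: n_y; exact.
  have hnp : (n p)%:R < (1 - e) * (2 * (s p)%:R * L p + (s p)%:R + 1).
    apply: (@lt_le_trans _ _ ((1 - eps) * (2 * (s p)%:R * L p + (s p)%:R + 1))); first by near: p.
    rewrite ler_wpM2r//; last by lra.
    by rewrite !addr_ge0// mulr_ge0.
  rewrite /rec_event recovery_setE//.
  (* Half of the margin e goes to the concentration of |X_S eta|^2, matching the factor 1 + e/2 in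
     [subcritical_exponent]. *)
  have eh0 : 0 < e / 2 by rewrite divr_gt0.
  have eh2 : e / 2 <= 2^-1 by lra.
  apply: le_trans (recov_prob_small (noise_sd (sigma1 p) (sigma2 p)) (iidXW p) (lam0 p) n0 eh0 eh2 _ erefl) _.
    by rewrite card_supp -(ltr0n R) (lt_le_trans ltr01).
  rewrite lee_fin /v lerD2l ler_expR lerN2 card_supp compl_expR//.
  rewrite mulrCA ler_pM2l// -expRD.
  (* The failure bound is a double exponential in L; 1 + x <= exp(x) weakens it to a single one,
     which is enough to tend to 0. *)
  apply: le_trans (expR_ge1Dx _); apply: ler_wpDl => //.
  exact: subcritical_exponent.
- rewrite -[X in _ --> X]addr0 -[X in _ --> X + _](mulr0 (2 : R)).
  apply: cvgD.
    apply: cvgM; first exact: cvg_cst.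
    apply: cvg_expRN; apply: (@cvgy_affine_minorant _ _ _ ((e / 2) ^+ 2 / 8) 0 _ n_y).
      by rewrite divr_gt0// exprn_gt0// divr_gt0.
    by apply: nearW => p; rewrite subr0.
  apply: cvg_expRN; apply: (@cvgy_affine_minorant _ _ _ (k * (e / 4)) (k * (2 + 2 / e)) _ L_y).
    by rewrite mulr_gt0// divr_gt0.
  by apply: nearW => p; rewrite mulrBr [in leRHS]mulrA.
Unshelve. all: by end_near. Qed.

Lemma recovery_supercritical (eps : R) (lam : nat -> R) : 0 < eps ->
  (\forall p \near \oo, (1 + eps) * (2 * (s p)%:R * L p + (s p)%:R + 1) < (n p)%:R) ->
  (forall p, 0 < lam p) ->
  (fun p => (n p)%:R * lam p ^+ 2 / (var p / (n p)%:R * L p)) @ \oo --> +oo ->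
  (fun p => (rho p)^-1 * (lam p * Num.sqrt ((s p)%:R)
          + Num.sqrt (var p / (n p)%:R * ln ((s p)%:R) / (n p)%:R))) @ \oo --> 0 ->
  P (rec_event lam p) @[p --> \oo] --> 1%E.
Proof.
move=> eps0 hn lam0.
pose kap p := (n p)%:R * lam p ^+ 2 / (var p / (n p)%:R * L p).
pose gap p := (rho p)^-1 * (lam p * Num.sqrt ((s p)%:R)
  + Num.sqrt (var p / (n p)%:R * ln ((s p)%:R) / (n p)%:R)).
rewrite -/kap -/gap => kap_y gap0.
pose e := Num.min eps 1.
have e0 : 0 < e by rewrite lt_min eps0 ltr01.
have e1 : e <= 1 by rewrite ge_min lexx orbT.
have ee : e <= eps by rewrite ge_min lexx.
pose v p : R := 4 * expR (- (s p)%:R) + 8 * expR 1 / Num.sqrt (kap p) +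
  2 / (s p)%:R + 2 * expR (- (e / 2 * L p)).
have sqrt_kap_y : (fun p => Num.sqrt (kap p)) @ \oo --> +oo.
  apply/cvgryPge => A; move/cvgryPge: kap_y => /(_ (A ^+ 2)); apply: filterS => p h.
  apply: le_trans (ler_norm A) _; rewrite -sqrtr_sqr ler_wsqrtr//.
have v0 : v @ \oo --> (0 : R).
  have inv0 (u : nat -> R) (c : R) : u @ \oo --> +oo -> (fun p => c / u p) @ \oo --> (0 : R).
    move=> uy; rewrite -[X in _ --> X](mulr0 c); apply: cvgM; first exact: cvg_cst.
    apply/gtr0_cvgV0; first by near=> p; near: p; move/cvgryPgt: uy; exact.
    by [].
  have exp0 (u : nat -> R) (c : R) : u @ \oo --> +oo -> (fun p => c * expR (- u p)) @ \oo --> (0 : R).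
    move=> uy; rewrite -[X in _ --> X](mulr0 c); apply: cvgM; first exact: cvg_cst.
    exact: cvg_expRN.
  have -> : (0 : R) = 0 + 0 + 0 + 0 by rewrite !addr0.
  apply: cvgD; [apply: cvgD; [apply: cvgD|]|].
  - exact: exp0.
  - exact: inv0.
  - exact: inv0.
  - apply: exp0; apply: (@cvgy_affine_minorant _ _ _ (e / 2) 0 _ L_y); first by rewrite divr_gt0.
    by apply: nearW => p; rewrite subr0.
(* The Gram distortion 3 e' is then e / 8, the value expected by the exponent estimates. *)
pose e' : R := e / 24.
have e'0 : 0 < e' by rewrite divr_gt0.
have e'6 : e' <= 6^-1 by rewrite /e'; lra.
pose c8 := e' ^+ 2 / 8.
have c80 : 0 < c8 by rewrite divr_gt0// exprn_gt0.
have fail0 : P (~` rec_event lam p) @[p --> \oo] --> 0%E.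
  apply: (@cvge_squeeze0 _ _ v) => //; near=> p.
  have s1 : 1 <= (s p)%:R :> R by near: p.
  have s0 : 0 < (s p)%:R :> R by apply: lt_le_trans s1.
  have c0 : 0 < p%:R - (s p)%:R :> R.
    by apply: lt_le_trans ltr01 _; near: p; move/cvgryPge: compl_y; exact.
  have L0 : 0 < L p by near: p; move/cvgryPgt: L_y; exact.
  have n0' : 0 < (n p)%:R :> R by near: p; move/cvgryPgt: n_y; exact.
  have n0 : (0 < n p)%N by rewrite -(ltr0n R).
  have hnp : (1 + e) * (2 * (s p)%:R * L p + (s p)%:R + 1) < (n p)%:R.
    apply: (@le_lt_trans _ _ ((1 + eps) * (2 * (s p)%:R * L p + (s p)%:R + 1))); last by near: p.
    rewrite ler_wpM2r//; last by lra.
    by rewrite !addr_ge0// mulr_ge0// ltW.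
  (* Here 64 ^ s is bounded by exp(64 s), so an exponent c8 n_k >= 65 s leaves exp(- s) after the
     union bound over the grid. *)
  have hn1 : (1 + 64) / c8 * (s p)%:R <= (n1 p)%:R by near: p; exact: nk_large.
  have hn2 : (1 + 64) / c8 * (s p)%:R <= (n2 p)%:R by near: p; exact: nk_large.
  have kap24 : 24 / e <= Num.sqrt (kap p) by near: p; move/cvgryPge: sqrt_kap_y; exact.
  have gap6 : gap p < 6^-1.
    by near: p; apply: (cvgr_lt (0 : R)) => //; rewrite invr_gt0.
  have n2p : 0 < (n2 p)%:R :> R.
    by apply: lt_le_trans hn2; rewrite mulr_gt0// divr_gt0//; lra.
  have [sg1 sg12] := sigma_gt0 p.
  have var0 : 0 < var p.
    apply: ltr_wpDl; first by apply: mulr_ge0 => //; exact: ltW.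
    by apply: mulr_gt0 => //; exact: lt_trans sg12.
  have sq0 : 0 < Num.sqrt (kap p) by apply: lt_le_trans kap24; rewrite divr_gt0.
  (* The choice of K balances two needs: sqrt(kap) -> +oo makes the Markov bound 8 e / sqrt(kap)
     vanish, and K is still smaller than (n lam)^2 / L by the factor sqrt(kap). *)
  have K0 : 0 < var p * Num.sqrt (kap p) by rewrite mulr_gt0.
  have ls0 : 0 <= lam p * Num.sqrt (s p)%:R by rewrite mulr_ge0// ltW.
  have q0 : 0 <= Num.sqrt (var p / (n p)%:R * ln ((s p)%:R) / (n p)%:R) by [].
  have rho0 := rho_gt0 p.
  have gapE : lam p * Num.sqrt (s p)%:R +
      Num.sqrt (var p / (n p)%:R * ln ((s p)%:R) / (n p)%:R) < rho p / 6.
    by move: gap6; rewrite /gap mulrC ltr_pdivrMr// [X in _ < X]mulrC.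
  have hrho : lam p * Num.sqrt (s p)%:R / (1 - 3 * e') <= rho p / 2.
    rewrite ler_pdivrMr; last by rewrite /e'; lra.
    have : 6^-1 * rho p <= rho p / 2 * (1 - 3 * e').
      rewrite [leRHS](_ : _ = (1 - 3 * e') / 2 * rho p); last by field.
      by rewrite ler_pM2r// /e'; lra.
    by lra.
  rewrite /rec_event recovery_setE//.
  have hs : lam p * Num.sqrt #|[pred j | beta p j 0 != 0]|%:R / (1 - 3 * e') <= rho p / 2.
    by rewrite card_supp.
  apply: le_trans (recov_prob_large (iidXW p) (lam0 p) n0 rho0 (@rho_le p) e'0 e'6 K0 var0 hs) _.
  rewrite lee_fin card_supp compl_expR// /v.
  have block (nk : nat) : (1 + 64) / c8 * (s p)%:R <= nk%:R ->
      64 ^+ s p * (2 * expR (- (c8 * nk%:R))) <= 2 * expR (- (s p)%:R).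
    move=> hk; have h64 : (64 : R) <= expR 64 by apply: le_trans (expR_ge1Dx _); lra.
    apply: (@le_trans _ _ (expR (64 * (s p)%:R) * (2 * expR (- (c8 * nk%:R))))).
      rewrite ler_wpM2r ?mulr_ge0 ?expR_ge0// expRM_natr lerXn2r ?nnegrE ?expR_ge0//.
    rewrite mulrCA ler_pM2l// -expRD ler_expR.
    move: hk; rewrite mulrAC ler_pdivrMr//; lra.
  have h1 := block _ hn1; have h2 := block _ hn2.
  have h3 : 8 * expR 1 * var p / (var p * Num.sqrt (kap p)) = 8 * expR 1 / Num.sqrt (kap p).
    by field; rewrite !gt_eqF.
  have h4 : (s p)%:R * (2 * expR (- ((rho p / 2) ^+ 2 /
      (2 * ((1 + 3 * e') * var p / ((1 - 3 * e') * (n p)%:R) ^+ 2))))) <= 2 / (s p)%:R.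
    have h : 2 * ln (s p)%:R <= (rho p / 2) ^+ 2 /
      (2 * ((1 + 3 * e') * var p / ((1 - 3 * e') * (n p)%:R) ^+ 2)).
      apply: (noise_exponent (sig := var p / (n p)%:R)) => //.
      rewrite mulrC ler_pdivrMr// [leRHS]mulrC; lra.
    rewrite mulrCA ler_pM2l// -[X in X * expR _](lnK (x := (s p)%:R)) ?posrE//.
    rewrite -[X in _ <= X^-1](lnK (x := (s p)%:R)) ?posrE// -expRN -expRD ler_expR; lra.
  have h5 : expR (L p) * (2 * expR (- (((n p)%:R * lam p) ^+ 2 /
      (2 * (var p * Num.sqrt (kap p) + ((n p)%:R * lam p) ^+ 2 *
        ((s p)%:R / ((1 - 3 * e') * (n p)%:R))))))) <= 2 * expR (- (e / 2 * L p)).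
    have h := supercritical_exponent e0 e1 L0 s0 (lam0 p) var0 n0' hnp (erefl (kap p)) kap24.
    rewrite mulrCA ler_pM2l// -expRD ler_expR; move: h; rewrite -/e'; lra.
  rewrite -[leRHS]addrA -[leRHS]addrA; apply: lerD; last first.
    by rewrite h3 -addrA; apply: lerD => //; exact: lerD.
  by lra.
have cv : (fun p => 1 - P (~` rec_event lam p))%E @ \oo --> (1 - 0 : \bar R)%E.
  by apply: cvgeB => //; exact: cvg_cst.
rewrite sube0 in cv; apply: cvg_trans cv; apply: near_eq_cvg; near=> p.
(* Passing to the complement needs the event to be measurable, which is known once n > 0; the
   equality with 1 - P is therefore only eventual. *)
have n0 : (0 < n p)%N by rewrite -(ltr0n R); near: p; move/cvgryPgt: n_y; exact.
have mrec : measurable (rec_event lam p) by exact: measurable_recovery.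
by rewrite -probability_setC ?setCK//; exact: measurableC.
Unshelve. all: by end_near. Qed.

End asymptotics.

Theorem theorem3 (R : realType) (d : measure_display) (T : measurableType d)
  (P : probability T R)
  (s n1 n2 : nat -> nat) (sigma1 sigma2 rho : nat -> R)
  (beta : forall p : nat, 'cV[R]_p)
  (X : forall p : nat, T -> 'M[R]_(n1 p + n2 p, p))
  (W : forall p : nat, T -> 'cV[R]_(n1 p + n2 p)) :
  (* standing assumptions, for every p *)
  (forall p, 0 < sigma1 p ^+ 2 /\ sigma1 p ^+ 2 < sigma2 p ^+ 2) ->
  (forall p, 0 < rho p) ->
  (forall p, support_size (beta p) = s p) ->
  (forall p (i : 'I_p), beta p i 0 != 0 -> rho p <= `|beta p i 0|) ->
  (forall p, iid_std_gaussian P (entries_family (X p) (W p))) ->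
  (* asymptotic regime *)
  ((fun p => (s p)%:R : R) @ \oo --> +oo) ->
  ((fun p => (s p)%:R / p%:R : R) @ \oo --> 0) ->
  ((fun p => (n1 p)%:R / (s p)%:R : R) @ \oo --> +oo) ->
  ((fun p => (n2 p)%:R / (s p)%:R : R) @ \oo --> +oo) ->
  let n := fun p => (n1 p + n2 p)%N in
  let n_ALG := fun p => 2 * (s p)%:R * ln (p%:R - (s p)%:R) + (s p)%:R + 1 in
  let sigma_avg2 := fun p =>
    ((n1 p)%:R * sigma1 p ^+ 2 + (n2 p)%:R * sigma2 p ^+ 2) / (n p)%:R in
  let prob_rec := fun (lam : nat -> R) p =>
    P [set w | recovery (X p w) (beta p)
                 (hetero_noise (sigma1 p) (sigma2 p) (W p w)) (lam p)] in
  (* (i) *)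
  ((exists2 eps : R, 0 < eps &
      \forall p \near \oo, (n p)%:R < (1 - eps) * n_ALG p) ->
    forall lam : nat -> R, (forall p, 0 < lam p) ->
    (exists2 l : \bar R, (0 <= l)%E &
       (fun p => (((n1 p)%:R * sigma1 p ^+ 2 + (n2 p)%:R * sigma2 p ^+ 2)
                   / (lam p ^+ 2 * (n p)%:R ^+ 2))%:E) @ \oo --> l) ->
    prob_rec lam @ \oo --> 0%E)
  /\
  (* (ii) *)
  ((exists2 eps : R, 0 < eps &
      \forall p \near \oo, (1 + eps) * n_ALG p < (n p)%:R) ->
    forall lam : nat -> R, (forall p, 0 < lam p) ->
    (lam @ \oo --> 0) ->
    ((fun p => (n p)%:R * lam p ^+ 2
               / (sigma_avg2 p * ln (p%:R - (s p)%:R))) @ \oo --> +oo) ->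
    ((fun p => (rho p)^-1 * (lam p * Num.sqrt ((s p)%:R)
          + Num.sqrt (sigma_avg2 p * ln ((s p)%:R) / (n p)%:R))) @ \oo --> 0) ->
    prob_rec lam @ \oo --> 1%E).
Proof.
move=> sigma_gt0 rho_gt0 supp rho_le iidXW s_y s_p n1_s n2_s n n_ALG sigma_avg2 prob_rec.
split=> -[eps eps0 hn] lam lam0.
  by move=> _; exact: (recovery_subcritical _ _ supp iidXW s_y s_p n1_s eps0 hn lam0).
move=> _ hkap hgap.
exact: (recovery_supercritical sigma_gt0 rho_gt0 supp rho_le iidXW s_y s_p n1_s n2_s
  eps0 hn lam0 hkap hgap).
Qed.
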